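(* Let $V\subset\mathbb{P}^n=H$ be a normal and projectively normal (non-degenerate) subvariety which satisfies $$H^0(V,N_{V/H}(-2))=0.$$ Then: (a) A $k$-step extension $W\subset\mathbb{P}^{n+k}$ of $V$ is uniquely determined, up to isomorphism of extensions, by its Kodaira-Spencer map $KS$; that is, two $k$-step extensions $V\subset H\subset\mathbb{P}^{n+k}$ with the same Kodaira-Spencer map are isomorphic. (b) A $k$-step extension $W$ of $V$ whose Kodaira-Spencer map $KS$ is an isomorphism is a universal extension: every extension of $V$ is isomorphic to a (cone over a) unique sub-extension of $W$.
   Context: All varieties are over $\mathbb{C}$. $\Theta$ is the tangent sheaf and $N$ the normal sheaf (dual of $\mathcal{I}/\mathcal{I}^2$). Extensions. Identify $\mathbb{P}^n$ with a linear subspace $H$ of $\mathbb{P}=\mathbb{P}^{n+k}$. A $k$-step extension of $V$ is a subvariety $W\subset\mathbb{P}^{n+k}$ with $V=W\cap H$ transversally: $\dim W=\dim V+k$ and the defining equations of $H$ form locally a regular sequence on $W$. ($V$ is the trivial $0$-step extension.) Two extensions $(V,H,W,\mathbb{P}^r)$, $(V,H',W',\mathbb{P}^r)$ are isomorphic (equivalent) if there is an automorphism of $\mathbb{P}^r$ sending $H$ onto $H'$, $W$ onto $W'$, and equal to the identity on $V$. A sub-extension of $W$ is $(V,H,W\cap L,L)$ for a linear subspace $H\subset L\subset\mathbb{P}^{n+k}$. A projective cone over an extension (in a larger projective space, iterated if necessary, and possibly trivial) is again an extension. Kodaira-Spencer map. For a $k$-step extension $W$ consider the composite $$\Gamma(\mathcal{O}_{\mathbb{P}}(1))^*\cong\Gamma(\Theta_{\mathbb{P}}(-1))\to\Gamma(\Theta_{\mathbb{P}}(-1)|_W)\to\Gamma(N_{W/\mathbb{P}}(-1))\to\Gamma(N_{V/H}(-1)),$$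 the last map coming from $\mathcal{I}_{W/\mathbb{P}}\otimes\mathcal{O}_H\cong\mathcal{I}_{V/H}$. The subspace $\Gamma(\mathcal{O}_H(1))^*\cong\Gamma(\Theta_H(-1))$ is sent to the image of $\Gamma(\Theta_H(-1))$; passing to the quotient $\Gamma(\mathcal{O}_{\mathbb{P}}(1))^*/\Gamma(\mathcal{O}_H(1))^*=\Gamma(\mathbb{P},\mathcal{I}_H(1))^*$ gives $$KS:\Gamma(\mathbb{P},\mathcal{I}_H(1))^*\to\Gamma(V,N_{V/H}(-1))/\Gamma(H,\Theta_H(-1)).$$ *)

(* Defs.v *)
From HB Require Import structures.
From mathcomp Require Import all_boot all_order all_algebra.
From mathcomp Require Import mpoly complex reals.

Set Implicit Arguments.
Unset Strict Implicit.
Unset Printing Implicit Defensive.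

Import GRing.Theory.
Local Open Scope ring_scope.

(* Classical projective geometry over an algebraically closed field C.
   A subset of P^(N-1) is represented by its punctured affine cone, a set of
   nonzero row vectors, and a local section of O(m) by a function on the cone. *)

Definition pset (C : closedFieldType) (N : nat) := 'rV[C]_N -> Prop.

Definition cfun (C : closedFieldType) (N : nat) := 'rV[C]_N -> C.

Definition pspace {C : closedFieldType} {N} : pset C N := fun w => w != 0.

Definition psubset (C : closedFieldType) N (X Y : pset C N) :=
  forall w, X w -> Y w.

Definition pclosed (C : closedFieldType) N (X : pset C N) :=
  exists S : {mpoly C[N]} -> Prop,
    (forall p, S p -> exists d : nat, p \is d.-homog) /\
    (forall w, X w <-> (w != 0 /\ forall p, S p -> p.@[w 0] = 0)).

Definition popen (C : closedFieldType) N (U : pset C N) :=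
  exists Z : pset C N, pclosed Z /\ forall w, U w <-> (w != 0 /\ ~ Z w).

Definition pirreducible (C : closedFieldType) N (X : pset C N) :=
  (exists w, X w) /\
  forall Y Z : pset C N, pclosed Y -> pclosed Z ->
    (forall w, X w -> Y w \/ Z w) -> psubset X Y \/ psubset X Z.

Definition variety (C : closedFieldType) N (X : pset C N) :=
  pclosed X /\ pirreducible X.

Definition variety_chain (C : closedFieldType) N (X : pset C N) (d : nat)
    (Z : nat -> pset C N) :=
  (forall i, (i <= d)%N -> variety (Z i) /\ psubset (Z i) X) /\
  (forall i, (i < d)%N ->
     psubset (Z i) (Z i.+1) /\ exists w, Z i.+1 w /\ ~ Z i w).

(* Krull dimension of the topological space X. *)
Definition has_dim (C : closedFieldType) N (X : pset C N) (d : nat) :=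
  (exists Z, variety_chain X d Z) /\
  (forall e Z, variety_chain X e Z -> (e <= d)%N).

Definition nondegenerate_pset (C : closedFieldType) N (X : pset C N) :=
  forall a : 'cV[C]_N, (forall w, X w -> w *m a = 0) -> a = 0.

(* On the set D, the function s is the quotient p / q of homogeneous
   polynomials with deg p - deg q = m and q nowhere zero. *)
Definition is_frac (C : closedFieldType) N (m : int) (D : pset C N)
    (s : cfun C N) (p q : {mpoly C[N]}) :=
  exists d e : nat,
    [/\ p \is d.-homog, q \is e.-homog, d%:Z = e%:Z + m &
        forall w, D w -> q.@[w 0] != 0 /\ s w = p.@[w 0] / q.@[w 0]].

(* s restricts to an element of O_X(m)(X n U); only the values of s on X n U
   matter. *)
Definition is_section (C : closedFieldType) N (X U : pset C N) (m : int)
    (s : cfun C N) :=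
  forall w, X w -> U w ->
    exists U' : pset C N, [/\ popen U', U' w &
      exists p q, is_frac m (fun x => [/\ X x, U x & U' x]) s p q].

(* s is an element of I_X(U), with I_X the ideal sheaf of the (reduced) closed
   subset X. *)
Definition is_ideal_section (C : closedFieldType) N (X U : pset C N)
    (s : cfun C N) :=
  is_section pspace U 0 s /\ forall w, X w -> U w -> s w = 0.

(* Every element a / b of the function field of X which is integral over the
   local ring of X at w lies in this local ring. *)
Definition normal_variety (C : closedFieldType) N (X : pset C N) :=
  forall (w : 'rV[C]_N) (U : pset C N) (e : nat) (a b : cfun C N)
         (c : nat -> cfun C N),
    X w -> popen U -> U w ->
    is_section X U 0 a -> is_section X U 0 b ->
    (forall i, is_section X U 0 (c i)) ->
    (exists x, [/\ X x, U x & b x != 0]) ->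
    (forall x, X x -> U x ->
       a x ^+ e + \sum_(i < e) c i x * a x ^+ i * b x ^+ (e - i) = 0) ->
    exists (U' : pset C N) (r : cfun C N),
      [/\ popen U', U' w, is_section X U' 0 r &
          forall x, X x -> U x -> U' x -> a x = b x * r x].

(* Gamma(P, O_P(m)) -> Gamma(X, O_X(m)) is onto for all m >= 0. *)
Definition projectively_normal (C : closedFieldType) N (X : pset C N) :=
  forall (m : nat) (s : cfun C N),
    is_section X pspace m%:Z s ->
    exists p : {mpoly C[N]},
      p \is m.-homog /\ forall w, X w -> s w = p.@[w 0].

(* Global sections of N_X(d) = Hom(I_X / I_X^2, O_X(d)) = Hom_{O_P}(I_X, O_X(d)):
   O_P-linear sheaf morphisms I_X -> O_X(d), given on each open U by s |-> f U s
   for s in I_X(U).  Such an f only matters through the values f U s w with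
   U open, s in I_X(U) and w in X n U. *)
Definition sheaf_map (C : closedFieldType) N :=
  pset C N -> cfun C N -> cfun C N.

Definition is_normal_section (C : closedFieldType) N (X : pset C N) (d : int)
    (f : sheaf_map C N) :=
  [/\ forall U s, popen U -> is_ideal_section X U s -> is_section X U d (f U s),
      forall U U' s s', popen U -> popen U' -> psubset U' U ->
        is_ideal_section X U s -> is_ideal_section X U' s' ->
        (forall w, U' w -> s w = s' w) ->
        forall w, X w -> U' w -> f U s w = f U' s' w &
      forall U a b s t, popen U ->
        is_section pspace U 0 a -> is_section pspace U 0 b ->
        is_ideal_section X U s -> is_ideal_section X U t ->
        forall w, X w -> U w ->
          f U (fun x => a x * s x + b x * t x) w = a w * f U s w + b w * f U t w].

(* H^0(X, N_X(d)) = 0 *)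
Definition no_normal_sections (C : closedFieldType) N (X : pset C N) (d : int) :=
  forall f, is_normal_section X d f ->
  forall U s w, popen U -> is_ideal_section X U s -> X w -> U w -> f U s w = 0.

Definition pderiv (C : closedFieldType) N (v : 'rV[C]_N) (p : {mpoly C[N]}) :=
  \sum_(i < N) v 0 i *: p^`M(i).

(* c is the value at w of D_v s, for s a local section of O_P and D_v the
   derivation (degree -1) in the direction v.  The space Gamma(O_P(1))^* is the
   space of vectors v, and v |-> D_v is the map to Gamma(Theta_P(-1)) from the
   Euler sequence. *)
Definition deriv_at (C : closedFieldType) N (v w : 'rV[C]_N) (s : cfun C N)
    (c : C) :=
  exists (U : pset C N) (p q : {mpoly C[N]}),
    [/\ popen U, U w, is_frac 0 U s p q &
        c = ((pderiv v p).@[w 0] * q.@[w 0] - p.@[w 0] * (pderiv v q).@[w 0])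
              / q.@[w 0] ^+ 2].

(* f is the image of D_u under Gamma(Theta_P(-1)) -> Gamma(N_X(-1)). *)
Definition is_tangent_section (C : closedFieldType) N (X : pset C N)
    (u : 'rV[C]_N) (f : sheaf_map C N) :=
  is_normal_section X (-1) f /\
  forall U s w, popen U -> is_ideal_section X U s -> X w -> U w ->
    deriv_at u w s (f U s w).

(* P^n is identified with the linear subspace H of P^(n+k) through a row-free
   matrix iota, as w |-> w *m iota, so that H is the row space of iota. *)

(* The scheme-theoretic intersection of W and H is V: the ideal sheaf of V in H
   is the restriction of the ideal sheaf of W. *)
Definition is_linear_section (C : closedFieldType) n N (V : pset C n.+1)
    (iota : 'M[C]_(n.+1, N)) (W : pset C N) :=
  (forall w, V w <-> W (w *m iota)) /\
  (forall w U s, V w -> popen U -> U w -> is_ideal_section V U s ->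
     exists (U' : pset C N) (F : cfun C N),
       [/\ popen U', U' (w *m iota), is_ideal_section W U' F &
           forall x, U x -> U' (x *m iota) -> F (x *m iota) = s x]).

(* At every point of V, any k linear equations of H (the columns of D) form a
   regular sequence in the local ring of W. *)
Definition regular_equations (C : closedFieldType) n k (V : pset C n.+1)
    (iota : 'M[C]_(n.+1, (n + k).+1)) (W : pset C (n + k).+1) :=
  forall D : 'M[C]_((n + k).+1, k), (iota :=: kermx D)%MS ->
  forall (w : 'rV[C]_n.+1) (U : pset C (n + k).+1) (i : 'I_k)
         (g : cfun C (n + k).+1) (h : 'I_k -> cfun C (n + k).+1),
    V w -> popen U -> U (w *m iota) ->
    is_section W U 0 g -> (forall j, is_section W U 0 (h j)) ->
    (forall x, W x -> U x ->
       (x *m D) 0 i * g x = \sum_(j < k | (j < i)%N) (x *m D) 0 j * h j x) ->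
    exists (U' : pset C (n + k).+1) (h' : 'I_k -> cfun C (n + k).+1),
      [/\ popen U', U' (w *m iota), forall j, is_section W U' (-1) (h' j) &
          forall x, W x -> U x -> U' x ->
            g x = \sum_(j < k | (j < i)%N) (x *m D) 0 j * h' j x].

Definition extension (C : closedFieldType) n k (V : pset C n.+1)
    (iota : 'M[C]_(n.+1, (n + k).+1)) (W : pset C (n + k).+1) :=
  [/\ row_free iota, variety W, is_linear_section V iota W,
      exists d : nat, has_dim V d /\ has_dim W (d + k) &
      regular_equations V iota W].

(* An automorphism of projective space is given by an invertible matrix, and
   equality of points holds up to a nonzero scalar. *)
Definition extension_iso (C : closedFieldType) n k (V : pset C n.+1)
    (iota : 'M[C]_(n.+1, (n + k).+1)) (W : pset C (n + k).+1)
    (iota' : 'M[C]_(n.+1, (n + k).+1)) (W' : pset C (n + k).+1) :=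
  exists g : 'M[C]_((n + k).+1),
    [/\ g \in unitmx, (iota *m g :=: iota')%MS,
        forall x, W x <-> W' (x *m g) &
        forall w, V w ->
          exists2 c : C, c != 0 & w *m iota *m g = c *: (w *m iota')].

(* (kappa, X) is the sub-extension (V, H, W n L, L) of (iota, W); the matrix B
   identifies P^(n+l) with L. *)
Definition sub_extension (C : closedFieldType) n k l
    (iota : 'M[C]_(n.+1, (n + k).+1)) (W : pset C (n + k).+1)
    (L : {vspace 'rV[C]_((n + k).+1)})
    (kappa : 'M[C]_(n.+1, (n + l).+1)) (X : pset C (n + l).+1) :=
  exists B : 'M[C]_((n + l).+1, (n + k).+1),
    [/\ row_free B, forall v, (v \in L) = (v <= B)%MS,
        iota = kappa *m B & forall v, X v <-> W (v *m B)].

(* (iota, Y) is the cone over (kappa, X), with X placed in P^(n+m) through j and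
   with vertex a linear subspace Z complementary to the span P^(n+l) of X: this
   is the cone over X from points, iterated m - l times (X itself if Z = 0). *)
Definition cone_extension (C : closedFieldType) n l m
    (kappa : 'M[C]_(n.+1, (n + l).+1)) (X : pset C (n + l).+1)
    (iota : 'M[C]_(n.+1, (n + m).+1)) (Y : pset C (n + m).+1) :=
  exists (j : 'M[C]_((n + l).+1, (n + m).+1)) (Z : 'M[C]_((n + m).+1)),
    [/\ row_free j, (j :&: Z = 0)%MS /\ (j + Z :=: 1%:M)%MS,
        iota = kappa *m j &
        forall v, Y v <->
          (v != 0 /\ exists x c z,
             [/\ X x, (z <= Z)%MS & v = c *: (x *m j) + z])].

(* f is the image of the vector v under the composite
     Gamma(O_P(1))^* -> Gamma(Theta_P(-1)) -> Gamma(N_W(-1)) -> Gamma(N_{V/H}(-1)):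
   it sends the restriction to H of a local section F of I_W to (D_v F)|_V.
   This determines f, since I_W restricts onto the ideal sheaf of V in H. *)
Definition is_KS_section (C : closedFieldType) n N (V : pset C n.+1)
    (iota : 'M[C]_(n.+1, N)) (W : pset C N) (v : 'rV[C]_N)
    (f : sheaf_map C n.+1) :=
  is_normal_section V (-1) f /\
  forall U F w, popen U -> is_ideal_section W U F -> V w -> U (w *m iota) ->
    deriv_at v (w *m iota) F
      (f (fun x => U (x *m iota)) (fun x => F (x *m iota)) w).

(* KS V iota W v is the value of the Kodaira-Spencer map at the class of v, as an
   element of Gamma(V, N_{V/H}(-1)) / Gamma(H, Theta_H(-1)), that is as a coset:
   the set of all f + t with f the image of v and t the image of a section of
   Theta_H(-1). *)
Definition KS (C : closedFieldType) n N (V : pset C n.+1)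
    (iota : 'M[C]_(n.+1, N)) (W : pset C N) (v : 'rV[C]_N)
    (h : sheaf_map C n.+1) :=
  is_normal_section V (-1) h /\
  exists f t u,
    [/\ is_KS_section V iota W v f, is_tangent_section V u t &
        forall U s w, popen U -> is_ideal_section V U s -> V w -> U w ->
          h U s w = f U s w + t U s w].

Definition same_KS (C : closedFieldType) n N (V : pset C n.+1)
    (iota : 'M[C]_(n.+1, N)) (W W' : pset C N) :=
  forall v h, KS V iota W v h <-> KS V iota W' v h.

(* The source Gamma(P, I_H(1))^* = Gamma(O_P(1))^* / Gamma(O_H(1))^* of KS is the
   quotient of the space of vectors by the row space of iota. *)
Definition KS_bijective (C : closedFieldType) n N (V : pset C n.+1)
    (iota : 'M[C]_(n.+1, N)) (W : pset C N) :=
  (forall v v', (forall h, KS V iota W v h <-> KS V iota W v' h) ->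
     (v - v' <= iota)%MS) /\
  (forall h, is_normal_section V (-1) h -> exists v, KS V iota W v h).

(* Every extension of V is isomorphic to a cone over (iota, W n L), for a unique
   linear subspace L containing H. *)
Definition universal_extension (C : closedFieldType) n k (V : pset C n.+1)
    (iota : 'M[C]_(n.+1, (n + k).+1)) (W : pset C (n + k).+1) :=
  forall m (iota' : 'M[C]_(n.+1, (n + m).+1)) (W' : pset C (n + m).+1),
    extension V iota' W' ->
    exists! L : {vspace 'rV[C]_((n + k).+1)},
      (forall w : 'rV[C]_n.+1, w *m iota \in L) /\
      exists l (kappa : 'M[C]_(n.+1, (n + l).+1)) (X : pset C (n + l).+1)
             (tau : 'M[C]_(n.+1, (n + m).+1)) (Y : pset C (n + m).+1),
        [/\ sub_extension iota W L kappa X, cone_extension kappa X tau Y &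
            extension_iso V tau Y iota' W'].

(* Main.v *)
(* Let I be the ideal of V in S = C[x_0, ..., x_n], J the ideal of an extension W,
   and t_1, ..., t_k equations of H.  Sections along V of O_W(m) / (t_1, ..., t_i)
   come from polynomials: for i = k this is projective normality, and one passes
   from i + 1 to i by subtracting a polynomial and dividing by t_(i+1), which lowers
   m; in negative degree a section is infinitely divisible by t_(i+1), hence zero by
   Krull.  Therefore I lifts to J and the t_i form a regular sequence modulo J.
   Restricting W to the span of H and one more point gives a flat graded family of
   ideals in S[tau].  Two such families which agree modulo tau^r differ at order r
   by a homomorphism I -> S/I of degree -r, that is, a section of N_V(-r): for r = 1
   it is the difference of the Kodaira-Spencer classes, and for r >= 2 it vanishes.
   Consequently, if a linear map A, compatible with H, satisfies KS' = KS o A, then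
   W' is the pull-back of W by A: this gives (a) when A is invertible, and (b) since
   the pull-back is the cone with vertex ker A over the intersection of W with the
   image of A. *)
Require Import Defs.
From HB Require Import structures.
From mathcomp Require Import all_boot all_order all_algebra.
From mathcomp Require Import mpoly complex reals boolp zify ring.

Set Implicit Arguments.
Unset Strict Implicit.
Unset Printing Implicit Defensive.

Import GRing.Theory.
Local Open Scope ring_scope.

(** * Polynomials as functions on vectors *)

(** The hypotheses on W are local along V, whereas the comparison of families needs homogeneous
    ideals; passing from one to the other is the main difficulty. The bridge is that a homogeneous
    polynomial lying in J + (t_1, ..., t_i) at every point of V lies in this ideal. For n > 0 one
    climbs from i = 0, using that sections of negative degree vanish; for n = 0 that vanishing
    fails, but V is all of P^0 and one descends from i = k. The family attached to a direction is
    the image of J in S[tau], not the ideal of a zero set, since the section of W may a priori be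
    non-reduced. When A sends a vector outside H' into H there is no such section, and a cone over V
    takes its place. Kodaira-Spencer classes live modulo Theta_H(-1), so directions are only
    determined up to vectors of H; hence the A of (a) is unipotent rather than the identity. For the
    uniqueness in (b), A is recovered from a cone; an isomorphism fixes the points of V only up to
    scalars that might vary, and projective normality makes them constant. *)

Lemma mpoly_ring_ind (R : comNzRingType) n (P : {mpoly R[n]} -> Prop) :
  (forall c, P c%:MP) -> (forall i, P 'X_i) ->
  (forall p q, P p -> P q -> P (p + q)) ->
  (forall p q, P p -> P q -> P (p * q)) -> forall p, P p.
Proof.
move=> hC hX hD hM.
have hXn i k : P ('X_i ^+ k).
  by elim: k => [|k IH]; rewrite ?expr0 -?mpolyC1 ?exprS //; apply: hM.
elim/mpolyind => [|c m p _ _ hp]; first by rewrite -mpolyC0.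
apply: (hD) => //; rewrite -mul_mpolyC; apply: (hM) => //.
by rewrite mpolyXE_id; apply: (big_ind P) => //; rewrite -mpolyC1.
Qed.

Section Poly.
Variable C : closedFieldType.

(** The identification of C[x_0, ..., x_(N-1)][X] with C[x_0, ..., x_N]. Inductions on the number of
    variables only need it to be onto. *)
Definition unmuni N (u : {poly {mpoly C[N]}}) : {mpoly C[N.+1]} :=
  (map_poly (@mwiden N C) u).['X_ord_max].

Lemma unmuni_onto N (p : {mpoly C[N.+1]}) : exists u, p = unmuni u.
Proof.
elim/mpoly_ring_ind: p => [c|i|p q [u ->] [v ->]|p q [u ->] [v ->]].
- by exists c%:MP%:P; rewrite /unmuni map_polyC hornerC /= mwidenC.
- case: (unliftP ord_max i) => [j ->|->]; last first.
    by exists 'X; rewrite /unmuni map_polyX hornerX.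
  exists ('X_j)%:P; rewrite /unmuni map_polyC hornerC /= mwidenX mnmwiden1.
  by congr 'X__; apply/val_inj; rewrite /= /bump leqNgt ltn_ord.
- by exists (u + v); rewrite /unmuni rmorphD hornerD.
- by exists (u * v); rewrite /unmuni rmorphM hornerM.
Qed.

Lemma ev_unmuni N (u : {poly {mpoly C[N]}}) (w : 'rV[C]_N.+1) :
  (unmuni u).@[w 0] =
  (map_poly (meval (fun i => w 0 (widen_ord (leqnSn N) i))) u).[w 0 ord_max].
Proof.
elim/poly_ind: u => [|u c IH]; first by rewrite /unmuni !rmorph0 !horner0 meval0.
rewrite /unmuni !rmorphD !rmorphM /= !map_polyX !map_polyC !hornerMXaddC mevalD mevalM IH mevalXU.
congr (_ + _); rewrite /=.
elim/mpoly_ring_ind: c => [c|i|p q hp hq|p q hp hq].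
- by rewrite mwidenC !mevalC.
- by rewrite mwidenX mnmwiden1 !mevalXU.
- by rewrite mwidenD !mevalD hp hq.
- by rewrite mwidenM !mevalM hp hq.
Qed.

(** An algebraically closed field is infinite: once the other variables are fixed, a nonzero
    polynomial in the last one has a non-root. *)
Lemma mpoly_eval_eq0 N (p : {mpoly C[N]}) :
  (forall w : 'rV[C]_N, p.@[w 0] = 0) -> p = 0.
Proof.
elim: N p => [|N IH] p hp.
  have [c pE] : exists c, p = c%:MP.
    elim/mpoly_ring_ind: p {hp} => [c|[]//|p q [c ->] [d ->]|p q [c ->] [d ->]].
    - by exists c.
    - by exists (c + d); rewrite mpolyCD.
    - by exists (c * d); rewrite mpolyCM.
  by move: (hp 0); rewrite pE mevalC => ->; rewrite mpolyC0.
have [u uE] := unmuni_onto p; suff: u = 0 by rewrite uE /unmuni => ->; rewrite map_poly0 horner0.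
apply/polyP => i; rewrite coef0; apply: IH => w.
pose g := meval (w 0) : {mpoly C[N]} -> C.
have {hp} hz x : (map_poly g u).[x] = 0.
  pose w' : 'rV[C]_N.+1 := \row_j (oapp (w 0) x (unlift ord_max j)).
  have := hp w'; rewrite uE ev_unmuni mxE unlift_none /= => <-; congr (_.[_]).
  apply: eq_map_poly => q; apply: meval_eq => j; rewrite mxE.
  have -> : widen_ord (leqnSn N) j = lift ord_max j.
    by apply/val_inj; rewrite /= /bump leqNgt ltn_ord.
  by rewrite liftK.
have /eqP : map_poly g u = 0.
  apply/eqP/negPn/negP => /closed_nonrootP[x]; rewrite /root hz eqxx //.
by move=> /eqP/polyP/(_ i); rewrite coef_map coef0.
Qed.

Lemma mpoly_eval_inj N (p q : {mpoly C[N]}) :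
  (forall w : 'rV[C]_N, p.@[w 0] = q.@[w 0]) -> p = q.
Proof.
move=> h; apply/eqP; rewrite -subr_eq0; apply/eqP/mpoly_eval_eq0 => w.
by rewrite mevalB h subrr.
Qed.

(** * Linear forms and linear substitutions *)

Definition lform N (c : 'cV[C]_N) : {mpoly C[N]} := \sum_i c i 0 *: 'X_i.

Lemma meval_lform N (c : 'cV[C]_N) (w : 'rV_N) : (lform c).@[w 0] = (w *m c) 0 0.
Proof.
by rewrite raddf_sum mxE; apply: eq_bigr => i _; rewrite /= mevalZ mevalXU mulrC.
Qed.

Lemma homogX N (i : 'I_N) : ('X_i : {mpoly C[N]}) \is 1.-homog.
Proof. by rewrite dhomogX; apply/eqP/mdeg1. Qed.

Lemma lform_homog N (c : 'cV[C]_N) : lform c \is 1.-homog.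
Proof. by apply: rpred_sum => i _; apply: rpredZ; apply: homogX. Qed.

Definition lsub M N (A : 'M[C]_(M, N)) (p : {mpoly C[N]}) : {mpoly C[M]} :=
  p \mPo [tuple lform (col j A) | j < N].

Lemma meval_lsub M N (A : 'M[C]_(M, N)) p (w : 'rV_M) :
  (lsub A p).@[w 0] = p.@[(w *m A) 0].
Proof.
rewrite comp_mpoly_meval; apply: meval_eq => j.
rewrite tnth_mktuple meval_lform !mxE.
by apply: eq_bigr => i _; rewrite mxE.
Qed.

Lemma lsubD M N (A : 'M[C]_(M, N)) p q : lsub A (p + q) = lsub A p + lsub A q.
Proof. exact: raddfD. Qed.
Lemma lsubB M N (A : 'M[C]_(M, N)) p q : lsub A (p - q) = lsub A p - lsub A q.
Proof. exact: raddfB. Qed.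
Lemma lsub0 M N (A : 'M[C]_(M, N)) : lsub A 0 = 0.
Proof. exact: raddf0. Qed.
Lemma lsubM M N (A : 'M[C]_(M, N)) p q : lsub A (p * q) = lsub A p * lsub A q.
Proof. exact: rmorphM. Qed.
Lemma lsubC M N (A : 'M[C]_(M, N)) c : lsub A c%:MP = c%:MP.
Proof. exact: comp_mpolyC. Qed.
Lemma lsub_sum M N (A : 'M[C]_(M, N)) (I : Type) (r : seq I) (P : pred I) F :
  lsub A (\sum_(i <- r | P i) F i) = \sum_(i <- r | P i) lsub A (F i).
Proof. exact: raddf_sum. Qed.
Lemma lsub_lsub M N K (A : 'M[C]_(M, N)) (B : 'M_(N, K)) p :
  lsub A (lsub B p) = lsub (A *m B) p.
Proof. by apply: mpoly_eval_inj => w; rewrite !meval_lsub mulmxA. Qed.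

Lemma lsub_id N (p : {mpoly C[N]}) : lsub 1%:M p = p.
Proof. by apply: mpoly_eval_inj => w; rewrite meval_lsub mulmx1. Qed.

Lemma lsub_lform M N (A : 'M[C]_(M, N)) c : lsub A (lform c) = lform (A *m c).
Proof. by apply: mpoly_eval_inj => w; rewrite meval_lsub !meval_lform mulmxA. Qed.

Lemma lsubXU M N (A : 'M[C]_(M, N)) i : lsub A 'X_i = lform (col i A).
Proof. by rewrite /lsub comp_mpolyXU -tnth_nth tnth_mktuple. Qed.

Lemma lsub_homog M N (A : 'M[C]_(M, N)) d p :
  p \is d.-homog -> lsub A p \is d.-homog.
Proof.
move=> /dhomogP hp; rewrite /lsub comp_mpolyE big_seq.
set t := [tuple _ | _ < _].
have hm (m : 'X_{1..N}) : \prod_(i < N) tnth t i ^+ m i \is (mdeg m).-homog.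
  rewrite mdegE; elim/big_rec2: _ => [|i d' q _ hq]; first exact: dhomog1.
  apply: dhomogM => //; rewrite tnth_mktuple -[X in X.-homog]mul1n.
  exact/dhomogMn/lform_homog.
by apply: rpred_sum => m mp; apply: rpredZ; rewrite -(hp _ mp).
Qed.

Lemma pihomog_lsub M N (A : 'M[C]_(M, N)) d p :
  pihomog mdeg d (lsub A p) = lsub A (pihomog mdeg d p).
Proof.
rewrite {1}(pihomog_partitionE (leqnn (mmeasure mdeg p))) lsub_sum raddf_sum /=.
have [lt|le] := ltnP d (mmeasure mdeg p).
  rewrite (bigD1 (Ordinal lt)) //= pihomog_dE ?lsub_homog ?pihomogP //.
  rewrite big1 ?addr0 // => i ne; apply: (@pihomog_ne0 _ _ _ i); last exact/lsub_homog/pihomogP.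
  by apply: contraNneq ne => eid; apply/eqP/val_inj.
rewrite big1 => [|i _]; last first.
  apply: (@pihomog_ne0 _ _ _ i); last exact/lsub_homog/pihomogP.
  by rewrite neq_ltn (leq_trans (ltn_ord i)).
suff -> : pihomog mdeg d p = 0 by rewrite lsub0.
rewrite /pihomog big1 // => m /eqP hd.
by rewrite memN_msupp_eq0 ?scale0r //; apply: (@mmeasure_mnm_ge _ _ mdeg); rewrite hd.
Qed.

Lemma meval_homogZ N d (p : {mpoly C[N]}) c (w : 'rV_N) :
  p \is d.-homog -> p.@[(c *: w) 0] = c ^+ d * p.@[w 0].
Proof.
move=> /dhomogP hp; rewrite !mevalE mulr_sumr; apply: eq_big_seq => m /hp/= <-.
rewrite mulrCA; congr (_ * _); rewrite mdegE -prodrXr -big_split /=.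
by apply: eq_bigr => i _; rewrite mxE exprMn.
Qed.

Lemma homog0_const N (p : {mpoly C[N]}) : p \is 0.-homog -> p = (p.@[(0 : 'rV_N) 0])%:MP.
Proof.
move=> hp; apply: mpoly_eval_inj => w; rewrite mevalC.
by rewrite -[in RHS](scale0r w) (meval_homogZ _ _ hp) expr0 mul1r.
Qed.

Lemma homog_eq_deg N d e (p : {mpoly C[N]}) : p \is d.-homog -> d = e -> p \is e.-homog.
Proof. by move=> h <-. Qed.

Lemma mpoly_homog_ind N (P : {mpoly C[N]} -> Prop) :
  P 0 -> (forall p q, P p -> P q -> P (p + q)) ->
  (forall d p, p \is d.-homog -> P p) -> forall p, P p.
Proof.
move=> h0 hD h p; rewrite (pihomog_partitionE (leqnn (mmeasure mdeg p))).
by apply: big_ind => // i _; apply/h/pihomogP.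
Qed.

Lemma pihomog_homogM N d e (q p : {mpoly C[N]}) :
  q \is d.-homog -> pihomog mdeg (d + e) (q * p) = q * pihomog mdeg e p.
Proof.
move=> hq; elim/mpoly_homog_ind: p => [|p r hp hr|i p hp].
- by rewrite mulr0 !raddf0 mulr0.
- by rewrite mulrDr !raddfD /= hp hr mulrDr.
have hqi : q * p \is (d + i).-homog by apply: dhomogM.
have [<-|ne] := eqVneq i e; first by rewrite !pihomog_dE.
rewrite (pihomog_ne0 _ hqi) ?eqn_add2l //.
by rewrite (pihomog_ne0 ne) ?mulr0.
Qed.

Lemma pihomog_homogM_lt N d e (q p : {mpoly C[N]}) :
  q \is d.-homog -> (e < d)%N -> pihomog mdeg e (q * p) = 0.
Proof.
move=> hq lt; elim/mpoly_homog_ind: p => [|p r hp hr|i p hp].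
- by rewrite mulr0 !raddf0.
- by rewrite mulrDr !raddfD /= hp hr addr0.
have hqi : q * p \is (d + i).-homog by apply: dhomogM.
by apply: (pihomog_ne0 _ hqi); rewrite neq_ltn (leq_trans lt (leq_addr _ _)) orbT.
Qed.

(* The coefficients of c |-> p(c w) are the p_d(w), so a polynomial vanishing on
   a cone has all its homogeneous components vanishing there. *)
Lemma pihomog_eval_eq0 N (p : {mpoly C[N]}) (w : 'rV_N) :
  (forall c, c != 0 -> p.@[(c *: w) 0] = 0) ->
  forall d, (pihomog mdeg d p).@[w 0] = 0.
Proof.
move=> h d; set m := mmeasure mdeg p.
pose P : {poly C} := \poly_(i < m) (pihomog mdeg i p).@[w 0].
have hP c : P.[c] = p.@[(c *: w) 0].
  rewrite horner_poly {2}(pihomog_partitionE (leqnn m)) raddf_sum /=.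
  by apply: eq_bigr => i _; rewrite (meval_homogZ _ _ (pihomogP _ _ _)) mulrC.
have P0 : P = 0.
  suff /eqP : P * 'X = 0 by rewrite mulf_eq0 polyX_eq0 orbF => /eqP.
  apply/eqP/negPn/negP => /closed_nonrootP[x]; rewrite /root hornerM hornerX hP.
  by have [->|/h->] := eqVneq x 0; rewrite ?mulr0 ?mul0r eqxx.
have [lt|le] := ltnP d m; first by have := coef_poly m (fun i => (pihomog mdeg i p).@[w 0]) d; rewrite -/P P0 coef0 lt.
rewrite /pihomog big1 ?meval0 // => k /eqP hd.
by rewrite memN_msupp_eq0 ?scale0r //; apply: (@mmeasure_mnm_ge _ _ mdeg); rewrite hd.
Qed.

(** * Directional derivatives *)

Lemma pderivD N (v : 'rV[C]_N) p q : pderiv v (p + q) = pderiv v p + pderiv v q.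
Proof.
by rewrite /pderiv -big_split /=; apply: eq_bigr => i _; rewrite mderivD scalerDr.
Qed.

Lemma pderivN N (v : 'rV[C]_N) p : pderiv v (- p) = - pderiv v p.
Proof.
by rewrite /pderiv -sumrN; apply: eq_bigr => i _; rewrite mderivN scalerN.
Qed.

Lemma pderivB N (v : 'rV[C]_N) p q : pderiv v (p - q) = pderiv v p - pderiv v q.
Proof. by rewrite pderivD pderivN. Qed.

Lemma pderivM N (v : 'rV[C]_N) p q :
  pderiv v (p * q) = pderiv v p * q + p * pderiv v q.
Proof.
rewrite /pderiv mulr_suml mulr_sumr -big_split /=; apply: eq_bigr => i _.
by rewrite mderivM scalerDr scalerAl scalerAr.
Qed.

Lemma pderivC N (v : 'rV[C]_N) c : pderiv v c%:MP = 0.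
Proof. by rewrite /pderiv big1 // => i _; rewrite mderivC scaler0. Qed.

Lemma pderiv0 N (v : 'rV[C]_N) : pderiv v 0 = 0.
Proof. by have := pderivC v 0; rewrite mpolyC0. Qed.

Lemma pderivXU N (v : 'rV[C]_N) i : pderiv v 'X_i = (v 0 i)%:MP.
Proof.
rewrite /pderiv (bigD1 i) //= mderivX mnmE eqxx.
have -> : (U_(i) - U_(i) = 0)%MM by apply/mnmP => j; rewrite mnmBE mnm0E subnn.
rewrite mpolyX0 scale1r -mul_mpolyC mulr1.
by rewrite big1 ?addr0 // => j ne; rewrite mderivX mnmE eq_sym (negbTE ne) scale0r scaler0.
Qed.

Lemma pderiv_sum N (v : 'rV[C]_N) (I : Type) (r : seq I) (P : pred I) F :
  pderiv v (\sum_(i <- r | P i) F i) = \sum_(i <- r | P i) pderiv v (F i).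
Proof. by apply: (big_morph (pderiv v)); [apply: pderivD|apply: pderiv0]. Qed.

Lemma pderivDl N (v w : 'rV[C]_N) p : pderiv (v + w) p = pderiv v p + pderiv w p.
Proof.
by rewrite /pderiv -big_split /=; apply: eq_bigr => i _; rewrite mxE scalerDl.
Qed.

Lemma pderivZl N c (v : 'rV[C]_N) p : pderiv (c *: v) p = c *: pderiv v p.
Proof. by rewrite /pderiv scaler_sumr; apply: eq_bigr => i _; rewrite mxE scalerA. Qed.

Lemma pderiv_lform N (v : 'rV[C]_N) c : pderiv v (lform c) = ((v *m c) 0 0)%:MP.
Proof.
rewrite /lform pderiv_sum mxE (raddf_sum (@mpolyC N C)); apply: eq_bigr => i _.
by rewrite -mul_mpolyC pderivM pderivC mul0r add0r pderivXU -mpolyCM mulrC.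
Qed.

Lemma pderiv_lsub M N (A : 'M[C]_(M, N)) v p :
  pderiv v (lsub A p) = lsub A (pderiv (v *m A) p).
Proof.
elim/mpoly_ring_ind: p => [c|i|p q hp hq|p q hp hq].
- by rewrite lsubC !pderivC lsub0.
- rewrite lsubXU pderiv_lform pderivXU lsubC; congr _%:MP.
  by rewrite !mxE; apply: eq_bigr => j _; rewrite mxE.
- by rewrite lsubD !pderivD lsubD hp hq.
- by rewrite lsubM !pderivM lsubD !lsubM hp hq.
Qed.

Lemma pderiv_homog N (v : 'rV[C]_N) d p : p \is d.+1.-homog -> pderiv v p \is d.-homog.
Proof.
move=> hp; apply: rpred_sum => i _; apply: rpredZ; apply/dhomogP => m.
rewrite mcoeff_msupp mcoeff_mderiv; apply: contraNeq => /= ne.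
rewrite (dhomog_nemf_coeff hp) ?mul0rn //= mdegD mdeg1 addn1 eqSS.
by [].
Qed.

Lemma pderiv_homog0 N (v : 'rV[C]_N) p : p \is 0.-homog -> pderiv v p = 0.
Proof. by move=> /homog0_const ->; rewrite pderivC. Qed.

(** * Ideals generated by initial segments of a list of linear forms *)

Definition lspan N k (D : 'M[C]_(N, k)) (i : nat) (p : {mpoly C[N]}) :=
  exists h : 'I_k -> {mpoly C[N]}, p = \sum_(j < k | (j < i)%N) lform (col j D) * h j.

Lemma lspanD N k (D : 'M[C]_(N, k)) i p q : lspan D i p -> lspan D i q -> lspan D i (p + q).
Proof.
move=> [h ->] [g ->]; exists (fun j => h j + g j).
by rewrite -big_split; apply: eq_bigr => j _; rewrite mulrDr.
Qed.

Lemma lspanMl N k (D : 'M[C]_(N, k)) i p q : lspan D i p -> lspan D i (q * p).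
Proof.
move=> [h ->]; exists (fun j => q * h j).
by rewrite mulr_sumr; apply: eq_bigr => j _; rewrite mulrCA.
Qed.

Lemma lspan0 N k (D : 'M[C]_(N, k)) i : lspan D i 0.
Proof. by exists (fun=> 0); rewrite big1 // => j _; rewrite mulr0. Qed.

Lemma lspanS N k (D : 'M[C]_(N, k)) (i : 'I_k) p :
  lspan D i.+1 p <-> exists h q, lspan D i q /\ p = q + lform (col i D) * h.
Proof.
split=> [[h ->]|[h [q [[g ->] ->]]]].
  exists (h i), (\sum_(j < k | (j < i)%N) lform (col j D) * h j); split; first by exists h.
  rewrite (bigD1 i) //= addrC; congr (_ + _); apply: eq_bigl => j.
  by rewrite ltnS ltn_neqAle andbC.
exists (fun j => if j == i then h else g j).
rewrite [RHS](bigD1 i) //= eqxx addrC; congr (_ + _); apply: eq_big => j.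
  by rewrite ltnS [in RHS]andbC -val_eqE /= -ltn_neqAle.
by move=> lt; rewrite -val_eqE /= (ltn_eqF lt).
Qed.

Lemma lspan_le N k (D : 'M[C]_(N, k)) i i' p : (i <= i')%N -> lspan D i p -> lspan D i' p.
Proof.
move=> le [h ->]; exists (fun j : 'I_k => if (j < i)%N then h j else 0).
rewrite [RHS](bigID (fun j : 'I_k => (j < i)%N)) /= [X in _ + X]big1 ?addr0; last first.
  by move=> j /andP[_ /negbTE->]; rewrite mulr0.
apply: eq_big => [j|j ->] //.
by apply/idP/andP => [lt|[]//]; rewrite lt (leq_trans lt).
Qed.

(* The matrix is the projection x |-> x - \sum_(j < i) t_j(x) E_j, where t_j is the
   j-th column of D and E_j the j-th row of E. *)
Lemma lspan_division N k (D : 'M[C]_(N, k)) (E : 'M[C]_(k, N)) i p :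
  lspan D i (p - lsub (1%:M - \sum_(j < k | (j < i)%N) col j D *m row j E) p).
Proof.
set B := 1%:M - _; elim/mpoly_ring_ind: p => [c|a|p q hp hq|p q hp hq].
- by rewrite lsubC subrr; apply: lspan0.
- exists (fun j => (E j a)%:MP); apply: mpoly_eval_inj => w.
  rewrite mevalB mevalXU meval_lsub mevalXU /B mulmxBr mulmx1 mulmx_sumr.
  rewrite mxE [X in _ - (_ + X)]mxE opprD opprK addNKr summxE raddf_sum /=; apply: eq_bigr => j _.
  by rewrite mevalM mevalC meval_lform mulmxA mxE big_ord1 [row _ _ _ _]mxE.
- by rewrite lsubD opprD addrACA; apply: lspanD.
- rewrite lsubM -[_ - _](_ : q * (p - lsub B p) + lsub B p * (q - lsub B q) = _).
    by apply: lspanD; apply: lspanMl.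
  by rewrite !mulrBr addrA [q * _]mulrC [q * _]mulrC subrK.
Qed.

(** The projection of [lspan_division] lands in the common zeros of the first [i] forms, so [p]
    composed with it is 0 and [p] itself equals the remainder. This is the Nullstellensatz for a
    linear subspace. *)
Lemma lspan_vanish N k (D : 'M[C]_(N, k)) (E : 'M[C]_(k, N)) i p :
  E *m D = 1%:M ->
  (forall w : 'rV_N, (forall j : 'I_k, (j < i)%N -> (w *m D) 0 j = 0) -> p.@[w 0] = 0) ->
  lspan D i p.
Proof.
move=> ED h; have := lspan_division D E i p.
set B := 1%:M - _; rewrite (_ : lsub B p = 0) ?subr0 //.
apply: mpoly_eval_inj => w; rewrite meval0 meval_lsub; apply: h => j lt.
rewrite -mulmxA mxE big1 // => a _; rewrite (_ : (B *m D) a j = 0) ?mulr0 //.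
rewrite /B mulmxBl mul1mx mulmx_suml !mxE summxE (bigD1 j) //= big1 ?addr0 => [|l /andP[_ ne]].
  by rewrite -mulmxA -row_mul ED !mxE big_ord1 !mxE eqxx mulr1 subrr.
by rewrite -mulmxA -row_mul ED !mxE big_ord1 !mxE (negbTE ne) mulr0.
Qed.

End Poly.

(** * Hilbert's basis theorem *)

(** The ascending chain condition in the form used for Krull's theorem: in every sequence some term
    is a combination of the earlier ones. *)
Definition noeth (R : comNzRingType) := forall f : nat -> R,
  exists (a : nat) (c : nat -> R), f a = \sum_(b < a) c b * f b.

Definition is_ideal (R : comNzRingType) (P : R -> Prop) :=
  [/\ P 0, forall x y, P x -> P y -> P (x + y) & forall x y, P y -> P (x * y)].

Lemma ideal_sum (R : comNzRingType) (P : R -> Prop) (I : Type) (r : seq I) (Q : pred I) F :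
  is_ideal P -> (forall i, Q i -> P (F i)) -> P (\sum_(i <- r | Q i) F i).
Proof. by move=> [h0 hD _] h; apply: big_ind. Qed.

Lemma idealB (R : comNzRingType) (P : R -> Prop) x y :
  is_ideal P -> P x -> P y -> P (x - y).
Proof. by move=> [h0 hD hM] hx hy; rewrite -mulN1r; apply: hD => //; apply: hM. Qed.

(** Hilbert's argument: in the ideal [J] generated by a bad sequence, choose successively [g n] of
    least size outside the ideal of its predecessors. A relation between leading coefficients then
    lowers the size of some [g a]. *)
Lemma noeth_poly (R : comNzRingType) : noeth R -> noeth {poly R}.
Proof.
move=> nR f; apply: contrapT => bad.
pose I M (x : {poly R}) := exists c : nat -> {poly R}, x = \sum_(b < M) c b * f b.
have I_ideal M : is_ideal (I M).
  split=> [|x y [c ->] [d ->]|x y [c ->]].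
  - by exists (fun=> 0); rewrite big1 // => b _; rewrite mul0r.
  - by exists (fun b => c b + d b); rewrite -big_split; apply: eq_bigr => b _; rewrite mulrDl.
  - by exists (fun b => x * c b); rewrite mulr_sumr; apply: eq_bigr => b _; rewrite mulrA.
have IS M x : I M x -> I M.+1 x.
  move=> [c ->]; exists (fun b => if b == M then 0 else c b).
  rewrite big_ord_recr /= eqxx mul0r addr0; apply: eq_bigr => b _.
  by rewrite (ltn_eqF (ltn_ord b)).
have Ile M M' x : (M <= M')%N -> I M x -> I M' x.
  by move=> /subnKC <-; elim: (M' - M)%N => [|k IH]; rewrite ?addn0 ?addnS // => /IH/IS.
have f_notin M : ~ I M (f M) by move=> h; apply: bad; exists M.
have f_in M : I M.+1 (f M).
  exists (fun b => if b == M then 1 else 0).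
  rewrite big_ord_recr /= eqxx mul1r big1 ?add0r // => b _.
  by rewrite (ltn_eqF (ltn_ord b)) mul0r.
pose J (x : {poly R}) := exists M, I M x.
have J_ideal : is_ideal J.
  split=> [|x y [M hx] [M' hy]|x y [M hx]].
  - by exists 0%N; have [] := I_ideal 0%N.
  - exists (maxn M M'); have [_ hD _] := I_ideal (maxn M M').
    by apply: hD; [apply: Ile hx; apply: leq_maxl|apply: Ile hy; apply: leq_maxr].
  - by exists M; have [_ _ hM] := I_ideal M; apply: hM.
(* An ideal contained in some [I M] misses [f M], so the choice of generators never stops. *)
pose fin (P : {poly R} -> Prop) := is_ideal P /\ exists M, forall x, P x -> I M x.
have step (P : {P | fin P}) : {x : {poly R} | [/\ J x, ~ sval P x &
    forall y : {poly R}, J y -> ~ sval P y -> (size x <= size y)%N]}.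
  apply: cid; case: P => P [/= _ [M hM]].
  pose Q k := `[< exists x, [/\ J x, ~ P x & size x = k] >].
  have exQ : exists k, Q k.
    exists (size (f M)); apply/asboolP; exists (f M); split=> //; first by exists M.+1.
    by move=> /hM; apply: f_notin.
  case: (ex_minnP exQ) => k /asboolP[x [Jx Px sx]] kmin; exists x; split=> // y Jy Py.
  by rewrite sx; apply: kmin; apply/asboolP; exists y.
have next (P : {P | fin P}) : fin (fun x => exists c, sval P (x - c * sval (step P))).
  case: (step P) => g [[N gN] _ _] /=; case: P => P [/= [h0 hD hM] [M PM]]; split; first split.
  - by exists 0; rewrite mul0r subr0.
  - move=> x y [c hx] [d hy]; exists (c + d).
    by rewrite mulrDl opprD addrACA; apply: hD.
  - by move=> x y [c hy]; exists (x * c); rewrite -mulrA -mulrBr; apply: hM.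
  - exists (maxn N M) => x [c /PM hx]; have [_ D' M'] := I_ideal (maxn N M).
    rewrite -[x](subrK (c * g)); apply: D'; first by apply: Ile hx; apply: leq_maxr.
    by apply: M'; apply: Ile gN; apply: leq_maxl.
have fin0 : fin (fun x => x = 0).
  split; first split=> // [x y -> ->|x y ->]; rewrite ?addr0 ?mulr0 //.
  by exists 0%N => x ->; have [] := I_ideal 0%N.
pose st := fix st n : {P | fin P} :=
  if n is n'.+1 then exist fin _ (next (st n')) else exist fin _ fin0.
pose g n := sval (step (st n)).
have gP n : [/\ J (g n), ~ sval (st n) (g n) &
    forall y : {poly R}, J y -> ~ sval (st n) y -> (size (g n) <= size y)%N].
  exact: (svalP (step (st n))).
have st_ideal n : is_ideal (sval (st n)) by case: (svalP (st n)).
have stS n x : sval (st n) x -> sval (st n.+1) x.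
  by move=> h; exists 0; rewrite mul0r subr0.
have st_le n n' x : (n <= n')%N -> sval (st n) x -> sval (st n') x.
  by move=> /subnKC <-; elim: (n' - n)%N => [|k IH]; rewrite ?addn0 ?addnS // => /IH/stS.
have g_st n n' : (n < n')%N -> sval (st n') (g n).
  move=> lt; apply: (st_le _ _ _ lt); exists 1; rewrite mul1r subrr.
  by have [] := st_ideal n.
have [a [c hc]] := nR (fun n => lead_coef (g n)).
have [Jg stg ming] := gP a.
have size_le b : (b < a)%N -> (size (g b) <= size (g a))%N.
  move=> lt; have [_ _ h] := gP b; apply: h => // hb; apply: stg.
  exact: st_le (ltnW lt) hb.
have g_n0 n : g n != 0.
  by apply/eqP => gn0; have [_ h _] := gP n; apply: h; rewrite gn0; have [] := st_ideal n.
(* The powers of X bring every [g b] to the size of [g a]; by the relation between leading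
   coefficients the top term of [g a - Y] cancels. *)
pose Y := \sum_(b < a) (c b)%:P * 'X^(size (g a) - size (g b)) * g b.
have Yst : sval (st a) Y.
  apply: ideal_sum => // b _; have [_ _ hM] := st_ideal a; apply: hM.
  exact: g_st.
have JY : J Y.
  apply: ideal_sum => // b _; have [_ _ hM] := J_ideal; apply: hM.
  by have [] := gP b.
have : (size (g a) <= size (g a - Y)%R)%N.
  apply: ming; first exact: idealB.
  move=> h; apply: stg; rewrite -[g a](subrK Y).
  by have [_ hD _] := st_ideal a; apply: hD.
apply/negP; rewrite -ltnNge.
have : (0 < size (g a))%N by rewrite size_poly_gt0.
case E: (size (g a)) => [//|s] _; rewrite ltnS; apply/leq_sizeP => i le_i.
have co b : (b < a)%N ->
    ('X^(s.+1 - size (g b)) * g b)`_i = if i == s then lead_coef (g b) else 0.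
  move=> lt; rewrite coefXnM; have le := size_le b lt; rewrite E in le.
  have gb0 : (0 < size (g b))%N by rewrite size_poly_gt0.
  have -> : (i < s.+1 - size (g b))%N = false by lia.
  have [->|ne] := eqVneq i s; last first.
    rewrite nth_default //; move/eqP: ne => ne; move: le gb0.
    by move: (size (g b)) => m; lia.
  move: le gb0; rewrite lead_coefE => le gb0; congr (nth _ _ _).
  by move: le gb0; move: (size (g b)) => m; lia.
rewrite coefB /Y coef_sum E.
under eq_bigr => b _ do rewrite -mulrA coefCM co ?ltn_ord //.
have [->|ne] := eqVneq i s; first by rewrite -hc lead_coefE E subrr.
rewrite big1 => [|b _]; last by rewrite mulr0.
by rewrite subr0 nth_default // E; move/eqP: ne => ne; lia.
Qed.

Section MpolyNoeth.
Variable C : closedFieldType.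

Lemma noeth_mpoly N : noeth {mpoly C[N]}.
Proof.
elim: N => [|N IH] f.
  have fE a : exists c, f a = c%:MP.
    elim/mpoly_ring_ind: (f a) => [c|[]//|p q [c ->] [d ->]|p q [c ->] [d ->]].
    - by exists c.
    - by exists (c + d); rewrite mpolyCD.
    - by exists (c * d); rewrite mpolyCM.
  (* Over a field two terms suffice: either the first is 0 or the second is a multiple of it. *)
  have [[c0 f0] [c1 f1]] := (fE 0%N, fE 1%N).
  have [z|nz] := eqVneq c0 0.
    by exists 0%N, (fun=> 0); rewrite big_ord0 f0 z mpolyC0.
  exists 1%N, (fun=> (c1 / c0)%:MP); rewrite big_ord1 f0 f1 -mpolyCM.
  by rewrite divfK.
have [u uE] := choice (fun a => unmuni_onto (f a)).
have [a [c hc]] := noeth_poly IH u.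
exists a, (fun b => unmuni (c b)); rewrite uE hc.
rewrite /unmuni rmorph_sum horner_sum; apply: eq_bigr => b _.
by rewrite rmorphM hornerM uE.
Qed.
End MpolyNoeth.

(** * The Zariski topology *)

Section Zariski.
Variable C : closedFieldType.

Definition vanish N (X : pset C N) (p : {mpoly C[N]}) := forall w, X w -> p.@[w 0] = 0.

Definition cone N (X : pset C N) := forall (w : 'rV_N) (c : C), c != 0 -> X w -> X (c *: w).

Lemma vanish_ideal N (X : pset C N) : is_ideal (vanish X).
Proof.
split=> [w _|p q hp hq w Xw|p q hq w Xw]; first by rewrite meval0.
- by rewrite mevalD hp ?hq ?addr0.
- by rewrite mevalM hq ?mulr0.
Qed.

Lemma pclosed_cone N (X : pset C N) : pclosed X -> cone X.
Proof.
move=> [S [hS hX]] w c c0 /hX[w0 h]; apply/hX; split=> [|p Sp].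
  by rewrite scaler_eq0 negb_or c0.
by have [d hp] := hS p Sp; rewrite (meval_homogZ _ _ hp) h ?mulr0.
Qed.

Lemma pclosed_neq0 N (X : pset C N) w : pclosed X -> X w -> w != 0.
Proof. by move=> [S [_ hX]] /hX[]. Qed.

Lemma vanish_pihomog N (X : pset C N) p d :
  cone X -> vanish X p -> vanish X (pihomog mdeg d p).
Proof.
move=> cX hp w Xw; apply: pihomog_eval_eq0 => c c0.
exact/hp/cX.
Qed.

Lemma pclosed_vanishP N (X : pset C N) w : pclosed X ->
  (X w <-> w != 0 /\ forall p, vanish X p -> p.@[w 0] = 0).
Proof.
move=> cX; split=> [Xw|].
  by split=> [|p]; [apply: (pclosed_neq0 cX Xw)|apply].
case: cX => S [_ hX] [w0 h]; apply/hX; split=> // p Sp.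
by apply: h => x /hX[_]; apply.
Qed.

Lemma pclosed_zero N d (p : {mpoly C[N]}) :
  p \is d.-homog -> pclosed (fun w => w != 0 /\ p.@[w 0] = 0).
Proof.
move=> hp; exists (eq p); split=> [_ <-|w]; first by exists d.
by split=> -[w0 h]; split=> //; [move=> _ <-|apply: h].
Qed.

Lemma pclosedU N (X Y : pset C N) :
  pclosed X -> pclosed Y -> pclosed (fun w => X w \/ Y w).
Proof.
move=> [S [hS hX]] [T [hT hY]].
exists (fun r => exists p q, [/\ S p, T q & r = p * q]); split.
  move=> r [p [q [/hS[d hd] /hT[e he] ->]]]; exists (d + e)%N; exact: dhomogM.
move=> w; split.
  case=> [/hX|/hY] [w0 h]; split=> // r [p [q [Sp Tq ->]]]; rewrite mevalM.
    by rewrite h ?mul0r.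
  by rewrite (h q) ?mulr0.
move=> [w0 h]; apply: contrapT => /not_orP[nX nY].
have /existsNP[p /not_implyP[Sp /eqP hp]] : ~ (forall p, S p -> p.@[w 0] = 0).
  by move=> h'; apply: nX; apply/hX.
have /existsNP[q /not_implyP[Tq /eqP hq]] : ~ (forall p, T p -> p.@[w 0] = 0).
  by move=> h'; apply: nY; apply/hY.
have /eqP := h (p * q) (ex_intro _ p (ex_intro _ q (And3 Sp Tq erefl))).
by rewrite mevalM mulf_eq0 (negbTE hp) (negbTE hq).
Qed.

Lemma popen_neq0 N (U : pset C N) w : popen U -> U w -> w != 0.
Proof. by move=> [Z [_ hU]] /hU[]. Qed.

Lemma popen_pspace N : popen (@pspace C N).
Proof.
exists (fun _ => False); split; last by move=> w; split=> [w0|[]//]; split.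
exists (eq 1); split=> [_ <-|w]; first by exists 0%N; apply: dhomog1.
by split=> // -[_ /(_ _ erefl)/eqP]; rewrite meval1 oner_eq0.
Qed.

Lemma popenI N (U U' : pset C N) : popen U -> popen U' -> popen (fun w => U w /\ U' w).
Proof.
move=> [Z [cZ hU]] [Z' [cZ' hU']]; exists (fun w => Z w \/ Z' w).
split; first exact: pclosedU.
move=> w; rewrite hU hU'; split=> [[[w0 h] [_ h']]|[w0 h]]; split=> //; first by case.
by split=> // h'; apply: h; left.
by split=> // h'; apply: h; right.
Qed.

Lemma popen_neq N d (q : {mpoly C[N]}) :
  q \is d.-homog -> popen (fun w => w != 0 /\ q.@[w 0] != 0).
Proof.
move=> hq; exists (fun w : 'rV_N => w != 0 /\ q.@[w 0] = 0); split; first exact: pclosed_zero hq.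
move=> w; split=> -[w0 h]; split=> //; first by case=> _; apply/eqP.
by apply/eqP => h'; apply: h.
Qed.

Lemma popen_basis N (U : pset C N) w : popen U -> U w ->
  exists d (q : {mpoly C[N]}), [/\ q \is d.-homog, q.@[w 0] != 0 &
    forall x : 'rV_N, x != 0 -> q.@[x 0] != 0 -> U x].
Proof.
move=> [Z [[S [hS hZ]] hU]] /hU[w0 nZ].
have /existsNP[q /not_implyP[Sq /eqP hq]] : ~ (forall p, S p -> p.@[w 0] = 0).
  by move=> h; apply: nZ; apply/hZ.
have [d hd] := hS _ Sq; exists d, q; split=> // x x0 qx; apply/hU; split=> // /hZ[_].
by move=> /(_ _ Sq) h; rewrite h eqxx in qx.
Qed.

Lemma popen_lsub M N (A : 'M[C]_(M, N)) (U : pset C N) :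
  row_free A -> popen U -> popen (fun x => U (x *m A)).
Proof.
move=> fA; have A0 (x : 'rV_M) : (x *m A != 0) = (x != 0).
  by rewrite -(mul0mx _ A) (inj_eq (row_free_inj fA)).
move=> [Z [[S [hS hZ]] hU]]; exists (fun x => Z (x *m A)); split; last first.
  by move=> x; rewrite -A0; apply: hU.
exists (fun p => exists2 q, S q & p = lsub A q); split.
  by move=> _ [q /hS[d hd] ->]; exists d; apply: lsub_homog.
move=> x; rewrite hZ A0; split=> -[x0 h]; split=> //.
  by move=> _ [q /h hq ->]; rewrite meval_lsub.
by move=> p Sp; rewrite -meval_lsub; apply: h; exists p.
Qed.

(** Zero sets of homogeneous polynomials are closed, so irreducibility of [X] becomes primality of
    its ideal on homogeneous elements. *)
Lemma variety_mul N (X : pset C N) d e (p q : {mpoly C[N]}) : variety X ->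
  p \is d.-homog -> q \is e.-homog -> vanish X (p * q) -> vanish X p \/ vanish X q.
Proof.
move=> [cX [_ irr]] hp hq h.
have [w Xw|hX|hX] := irr _ _ (pclosed_zero hp) (pclosed_zero hq).
- have /eqP := h w Xw; rewrite mevalM mulf_eq0 => /orP[]/eqP ?; [left|right];
  by split=> //; apply: pclosed_neq0 Xw.
- by left=> w /hX[].
- by right=> w /hX[].
Qed.

Lemma vanish_open N (X U : pset C N) d (p : {mpoly C[N]}) : variety X -> popen U ->
  (exists w, X w /\ U w) -> p \is d.-homog -> (forall w, X w -> U w -> p.@[w 0] = 0) ->
  vanish X p.
Proof.
move=> vX oU [w [Xw Uw]] hp h; have [e [q [hq qw qU]]] := popen_basis oU Uw.
have [] // := variety_mul vX hp hq; last by move=> /(_ w Xw)/eqP; rewrite (negbTE qw).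
move=> x Xx; rewrite mevalM; have [->|/qU Ux] := eqVneq (q.@[x 0]) 0; first by rewrite mulr0.
by rewrite h ?mul0r //; apply/Ux/pclosed_neq0/Xx; case: vX.
Qed.

Lemma exists_pihomog_neq0 N (q : {mpoly C[N]}) (w : 'rV_N) : q.@[w 0] != 0 ->
  exists i, (pihomog mdeg i q).@[w 0] != 0.
Proof.
move=> qw; apply: contrapT => /forallNP h'; move: qw; apply/negP/negPn/eqP.
rewrite (pihomog_partitionE (leqnn (mmeasure mdeg q))) raddf_sum /= big1 // => i _.
by have /negP/negPn/eqP := h' i.
Qed.

(** The factor [q] may be inhomogeneous: one of its components is nonzero at [w], and primality
    applies to that component. *)
Lemma vanish_mul N (X : pset C N) d (p q : {mpoly C[N]}) w : variety X ->
  p \is d.-homog -> X w -> q.@[w 0] != 0 -> vanish X (q * p) -> vanish X p.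
Proof.
move=> vX hp Xw qw h; have cX : cone X by apply: pclosed_cone; case: vX.
have [i qi] := exists_pihomog_neq0 qw.
have hi : pihomog mdeg i q \is i.-homog by apply: pihomogP.
have : vanish X (pihomog mdeg i q * p).
  have := vanish_pihomog (d + i) cX h.
  by rewrite [q * p]mulrC (pihomog_homogM _ _ hp) mulrC.
by move=> /(variety_mul vX hi hp)[/(_ w Xw)/eqP|//]; rewrite (negbTE qi).
Qed.

(** Multiplying by a coordinate makes the polynomial vanish at the origin too. *)
Lemma mpoly_eq0_off0 N (p : {mpoly C[N.+1]}) :
  (forall w : 'rV_N.+1, w != 0 -> p.@[w 0] = 0) -> p = 0.
Proof.
move=> h; suff /eqP : p * 'X_ord0 = 0.
  rewrite mulf_eq0 => /orP[/eqP //|/eqP/(congr1 (fun q : {mpoly C[N.+1]} => q.@[(const_mx 1 : 'rV_N.+1) 0]))].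
  by rewrite mevalXU meval0 mxE => /eqP; rewrite oner_eq0.
apply: mpoly_eval_eq0 => w; rewrite mevalM mevalXU.
by have [->|/h->] := eqVneq w 0; rewrite ?mul0r ?mxE ?mulr0.
Qed.

Lemma mpoly_open_eq0 N (U : pset C N) (p : {mpoly C[N]}) : popen U ->
  (exists w, U w) -> (forall w, U w -> p.@[w 0] = 0) -> p = 0.
Proof.
case: N U p => [|N] U p oU [w Uw] h.
  by have := popen_neq0 oU Uw; rewrite [w]thinmx0 eqxx.
have [d [q [hq qw qU]]] := popen_basis oU Uw.
suff /eqP : p * q = 0.
  by rewrite mulf_eq0 => /orP[/eqP//|/eqP q0]; rewrite q0 meval0 eqxx in qw.
apply: mpoly_eq0_off0 => x x0; rewrite mevalM.
have [->|/(qU _ x0)/h->] := eqVneq (q.@[x 0]) 0; by rewrite ?mulr0 ?mul0r.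
Qed.

(** Powers of such a form are the standard denominators near [w]. *)
Lemma lform_neq0 N (w : 'rV[C]_N) : w != 0 -> exists c, (lform c).@[w 0] = 1.
Proof.
move=> w0; have [i wi] : exists i, w 0 i != 0.
  apply: contrapT => /forallNP h; case/eqP: w0; apply/rowP => i; rewrite mxE.
  by have /negP/negPn/eqP := h i.
exists ((w 0 i)^-1 *: delta_mx i 0); rewrite meval_lform -scalemxAr mxE -colE mxE.
by rewrite mulVf.
Qed.

End Zariski.

(** * Local fractions and normal sections *)

Section Fractions.
Variable C : closedFieldType.

Definition homogeneous N (p : {mpoly C[N]}) := exists d, p \is d.-homog.

Lemma homogeneousI N d (p : {mpoly C[N]}) : p \is d.-homog -> homogeneous p.
Proof. by exists d. Qed.

Definition frac_at N (w : 'rV[C]_N) (s : cfun C N) (p q : {mpoly C[N]}) :=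
  exists U : pset C N, [/\ popen U, U w & is_frac 0 U s p q].

Lemma frac_at_neq0 N (w : 'rV[C]_N) s p q : frac_at w s p q -> q.@[w 0] != 0.
Proof. by move=> [U [_ Uw [d [e [_ _ _ /(_ w Uw)[]]]]]]. Qed.

Lemma frac_at_homog N (w : 'rV[C]_N) s p q :
  frac_at w s p q -> exists d, p \is d.-homog /\ q \is d.-homog.
Proof.
move=> [U [_ Uw [d [e [hp hq]]]]]; rewrite addr0 => -[de] _.
by exists d; split => //; rewrite de.
Qed.

Lemma frac_atP N (w : 'rV[C]_N) s p q d : p \is d.-homog -> q \is d.-homog ->
  (exists U, [/\ popen U, U w & forall x, U x -> q.@[x 0] != 0 /\ s x = p.@[x 0] / q.@[x 0]]) ->
  frac_at w s p q.
Proof.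
move=> hp hq [U [oU Uw h]]; exists U; split=> //; exists d, d; split=> //.
by rewrite addr0.
Qed.

Lemma frac_at_open N (w : 'rV[C]_N) s p q : frac_at w s p q ->
  exists U, [/\ popen U, U w & forall x, U x -> q.@[x 0] != 0 /\ s x = p.@[x 0] / q.@[x 0]].
Proof. by move=> [U [oU Uw [d [e [_ _ _ h]]]]]; exists U. Qed.

Lemma frac_at_eq N (w : 'rV[C]_N) s s' p q (U : pset C N) : popen U -> U w ->
  (forall x, U x -> s x = s' x) -> frac_at w s p q -> frac_at w s' p q.
Proof.
move=> oU Uw ss hs; have [d [hp hq]] := frac_at_homog hs.
have [U' [oU' U'w h]] := frac_at_open hs.
apply: (frac_atP hp hq); exists (fun x => U x /\ U' x); split=> //; first exact: popenI.
by move=> x [Ux U'x]; rewrite -ss //; apply: h.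
Qed.

(** Nonempty open subsets of projective space are dense, so a germ determines its fraction up to
    cross-multiplication. *)
Lemma frac_at_uniq N (w : 'rV[C]_N) s p q p' q' :
  frac_at w s p q -> frac_at w s p' q' -> p * q' = p' * q.
Proof.
move=> /frac_at_open[U [oU Uw h]] /frac_at_open[U' [oU' Uw' h']].
apply/eqP; rewrite -subr_eq0; apply/eqP.
apply: (mpoly_open_eq0 (popenI oU oU')); first by exists w.
move=> x [/h[q0 sE] /h'[q0' sE']]; rewrite mevalB !mevalM; apply/eqP.
by rewrite subr_eq0 -eqr_div // -sE -sE'.
Qed.

Lemma section_frac N (U : pset C N) s w : popen U -> U w ->
  is_section pspace U 0 s -> exists p q, frac_at w s p q.
Proof.
move=> oU Uw h; have w0 := popen_neq0 oU Uw.
have [U' [oU' U'w [p [q [d [e [hp hq de hf]]]]]]] := h w w0 Uw.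
exists p, q, (fun x => U x /\ U' x); split=> //; first exact: popenI.
exists d, e; split=> // x [Ux U'x]; apply: hf; split=> //.
exact: (popen_neq0 oU Ux).
Qed.

Lemma frac_section N (U : pset C N) s :
  (forall w, U w -> exists p q, frac_at w s p q) -> is_section pspace U 0 s.
Proof.
move=> h w _ /h[p [q [U' [oU' U'w [d [e [hp hq de hf]]]]]]].
exists U'; split=> //; exists p, q, d, e; split=> // x [_ _]; exact: hf.
Qed.

Lemma ideal_frac_vanish N (V U : pset C N) s w p q : variety V -> popen U -> U w -> V w ->
  is_ideal_section V U s -> frac_at w s p q -> vanish V p.
Proof.
move=> vV oU Uw Vw [_ hs] hf; have [d [hp _]] := frac_at_homog hf.
have [U' [oU' U'w h]] := frac_at_open hf.
apply: (vanish_open vV (popenI oU oU') _ hp); first by exists w.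
move=> x Vx [Ux /h[q0 sE]]; have := hs x Vx Ux; rewrite sE => /eqP.
by rewrite mulf_eq0 invr_eq0 (negbTE q0) orbF => /eqP.
Qed.

Lemma frac_at_ratio N (w : 'rV[C]_N) d p q : p \is d.-homog -> q \is d.-homog ->
  q.@[w 0] != 0 -> w != 0 -> frac_at w (fun x => p.@[x 0] / q.@[x 0]) p q.
Proof.
move=> hp hq qw w0; apply: (frac_atP hp hq).
exists (fun x : 'rV_N => x != 0 /\ q.@[x 0] != 0); split=> //; first exact: popen_neq hq.
by move=> x [].
Qed.

Lemma ratio_ideal_section N (V : pset C N) d (p q : {mpoly C[N]}) :
  p \is d.-homog -> q \is d.-homog -> vanish V p ->
  is_ideal_section V (fun x : 'rV_N => x != 0 /\ q.@[x 0] != 0) (fun x => p.@[x 0] / q.@[x 0]).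
Proof.
move=> hp hq Vp; split; last by move=> w Vw _; rewrite Vp ?mul0r.
apply: frac_section => w [w0 qw]; exists p, q; exact: (frac_at_ratio hp hq qw w0).
Qed.

(** A normal section is prescribed on homogeneous equations: on the germ p / q it takes the value
    Phi(p) / q. The first hypothesis makes Phi(f) a section of O_V(d - r) for f of degree d; the
    second gives linearity and independence of the fraction. *)
Lemma normal_section_of N (V : pset C N) (r : nat)
    (Phi : {mpoly C[N]} -> 'rV[C]_N -> C) :
  variety V ->
  (forall d f w, f \is d.-homog -> vanish V f -> V w ->
     exists e e' (G Q : {mpoly C[N]}), [/\ G \is e.-homog, Q \is e'.-homog,
       (e + r = e' + d)%N, Q.@[w 0] != 0 &
       forall x, V x -> Q.@[x 0] != 0 -> Phi f x = G.@[x 0] / Q.@[x 0]]) ->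
  (forall a b c p1 p2 p3, vanish V p1 -> vanish V p2 -> vanish V p3 ->
     homogeneous p1 -> homogeneous p2 -> homogeneous p3 ->
     c * p3 = a * p1 + b * p2 -> forall w, V w ->
     c.@[w 0] * Phi p3 w = a.@[w 0] * Phi p1 w + b.@[w 0] * Phi p2 w) ->
  exists f, is_normal_section V (- r%:Z) f /\
    forall U s w p q, popen U -> is_ideal_section V U s -> V w -> U w ->
      frac_at w s p q -> f U s w = Phi p w / q.@[w 0].
Proof.
move=> vV H1 H2.
pose P (s : cfun C N) (w : 'rV[C]_N) (pq : {mpoly C[N]} * {mpoly C[N]}) :=
  frac_at w s pq.1 pq.2 /\ vanish V pq.1.
(* The open set is ignored and a fraction is chosen at each point; 0 is a default value where none
   exists. *)
pose f (U : pset C N) s w :=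
  if pselect (exists pq, P s w pq) is left h then Phi (sval (cid h)).1 w / (sval (cid h)).2.@[w 0] else 0.
have fE U s w p q : V w -> frac_at w s p q -> vanish V p -> f U s w = Phi p w / q.@[w 0].
  move=> Vw hf hp; rewrite /f; case: pselect => [h|[]]; last by exists (p, q).
  case: (cid h) => -[p' q'] [/= hf' hp'].
  have e := frac_at_uniq hf hf'.
  have [d [hd _]] := frac_at_homog hf; have [d' [hd' _]] := frac_at_homog hf'.
  have hv0 : vanish V 0 by move=> x _; rewrite meval0.
  apply/eqP; rewrite eqr_div ?(frac_at_neq0 hf) ?(frac_at_neq0 hf') //; apply/eqP.
  have e' : q' * p = q * p' + 0 * 0 by rewrite mul0r addr0 mulrC e mulrC.
  have := H2 q 0 q' p' 0 p hp' hv0 hp (homogeneousI hd')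
    (homogeneousI (dhomog0 _ mdeg 0)) (homogeneousI hd) e' w Vw.
  by rewrite meval0 mul0r addr0 => h'; rewrite mulrC -h' mulrC.
have fE' U s w p q : popen U -> is_ideal_section V U s -> V w -> U w ->
    frac_at w s p q -> f U s w = Phi p w / q.@[w 0].
  by move=> oU hs Vw Uw hf; apply: fE => //; apply: ideal_frac_vanish Vw hs hf.
exists f; split=> //; split.
- move=> U s oU hs w Vw Uw; have [p [q hf]] := section_frac oU Uw hs.1.
  have Vp := ideal_frac_vanish vV oU Uw Vw hs hf.
  have [d [hp hq]] := frac_at_homog hf; have [U1 [oU1 U1w h1]] := frac_at_open hf.
  have [e [e' [G [Q [hG hQ ee Qw PhiE]]]]] := H1 d p w hp Vp Vw.
  exists (fun x : 'rV_N => U1 x /\ (x != 0 /\ Q.@[x 0] != 0)); split.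
  + by apply: popenI => //; apply: popen_neq hQ.
  + by split=> //; split=> //; apply: popen_neq0 oU Uw.
  exists G, (Q * q), e, (e' + d)%N; split=> //; first exact: dhomogM.
    by rewrite -ee PoszD addrK.
  move=> x [Vx Ux [U1x [_ Qx]]]; have [qx _] := h1 x U1x.
  rewrite mevalM mulf_neq0 //; split=> //.
  rewrite (fE U s x p q) //; first by rewrite PhiE // invfM mulrA.
  by exists U1; split=> //; exists d, d; split=> //; rewrite addr0.
- move=> U U' s s' oU oU' UU' hs hs' ss' w Vw U'w.
  have [p [q hf]] := section_frac oU' U'w hs'.1.
  rewrite (fE' U' s' w p q) // (fE' U s w p q) //; first exact: UU'.
  by apply: frac_at_eq oU' U'w _ hf => x Ux; rewrite ss'.
- move=> U a b s t oU ha hb hs ht w Vw Uw.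
  have [a1 [a2 fa]] := section_frac oU Uw ha; have [b1 [b2 fb]] := section_frac oU Uw hb.
  have [s1 [s2 fs]] := section_frac oU Uw hs.1; have [t1 [t2 ft]] := section_frac oU Uw ht.1.
  have Vs := ideal_frac_vanish vV oU Uw Vw hs fs; have Vt := ideal_frac_vanish vV oU Uw Vw ht ft.
  have [da [ha1 ha2]] := frac_at_homog fa; have [db [hb1 hb2]] := frac_at_homog fb.
  have [ds [hs1 hs2]] := frac_at_homog fs; have [dt [ht1 ht2]] := frac_at_homog ft.
  have [Ua [oUa Uaw Ea]] := frac_at_open fa; have [Ub [oUb Ubw Eb]] := frac_at_open fb.
  have [Us [oUs Usw Es]] := frac_at_open fs; have [Ut [oUt Utw Et]] := frac_at_open ft.
  pose p3 := (a1 * b2 * t2) * s1 + (b1 * a2 * s2) * t1.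
  pose q3 := a2 * b2 * s2 * t2.
  have h3 : p3 \is (da + db + ds + dt).-homog.
    apply: dhomogD.
      apply: (@homog_eq_deg _ _ (da + db + dt + ds)); last lia.
      by do !apply: dhomogM.
    apply: (@homog_eq_deg _ _ (db + da + ds + dt)); last lia.
    by do !apply: dhomogM.
  have h3' : q3 \is (da + db + ds + dt).-homog by do !apply: dhomogM.
  have V3 : vanish V p3.
    by have [_ hD hM] := vanish_ideal V; apply: hD; apply: hM.
  have f3 : frac_at w (fun x => a x * s x + b x * t x) p3 q3.
    apply: (frac_atP h3 h3'); exists (fun x => (Ua x /\ Ub x) /\ (Us x /\ Ut x)).
    split=> //; first by apply: popenI; apply: popenI.
    move=> x [[/Ea[a0 aE] /Eb[b0 bE]] [/Es[s0 sE] /Et[t0 tE]]].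
    rewrite !mevalD !mevalM !mulf_neq0 //; split=> //; rewrite aE bE sE tE mulf_div mulf_div.
    rewrite addf_div ?mulf_neq0 //; apply/eqP; rewrite eqr_div ?mulf_neq0 //; apply/eqP.
    by ring.
  rewrite (fE U _ w p3 q3) // (fE U s w s1 s2) // (fE U t w t1 t2) //.
  have h1 : 1 * p3 = (a1 * b2 * t2) * s1 + (b1 * a2 * s2) * t1 by rewrite mul1r.
  have := H2 _ _ _ _ _ _ Vs Vt V3 (homogeneousI hs1) (homogeneousI ht1) (homogeneousI h3) h1 w Vw.
  rewrite meval1 mul1r => ->; have [[a0 aE] [b0 bE]] := (Ea w Uaw, Eb w Ubw).
  have [[s0 _] [t0 _]] := (Es w Usw, Et w Utw).
  rewrite aE bE !mevalM mulf_div mulf_div addf_div ?mulf_neq0 //.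
  apply/eqP; rewrite eqr_div ?mulf_neq0 //; apply/eqP; ring.
Qed.
End Fractions.

(** * Germs of an extension along V *)

Section Spans.
Variable C : closedFieldType.

Lemma meval_lform_col N k (D : 'M[C]_(N, k)) j (x : 'rV_N) :
  (lform (col j D)).@[x 0] = (x *m D) 0 j.
Proof. by rewrite meval_lform !mxE; apply: eq_bigr => i _; rewrite mxE. Qed.

Lemma meval_lform_sum N k (D : 'M[C]_(N, k)) (P : pred 'I_k) h (x : 'rV_N) :
  (\sum_(j < k | P j) lform (col j D) * h j).@[x 0] =
  \sum_(j < k | P j) (x *m D) 0 j * (h j).@[x 0].
Proof.
by rewrite raddf_sum; apply: eq_bigr => j _; rewrite /= mevalM meval_lform_col.
Qed.

Lemma ratio_section N (X U : pset C N) (m : int) d e (p q : {mpoly C[N]}) :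
  p \is d.-homog -> q \is e.-homog -> d%:Z = e%:Z + m ->
  (forall x, U x -> q.@[x 0] != 0) -> (forall x, X x -> x != 0) ->
  is_section X U m (fun x => p.@[x 0] / q.@[x 0]).
Proof.
move=> hp hq de hU X0 w Xw Uw; exists pspace; split; [exact: popen_pspace|exact: X0|].
by exists p, q, d, e; split=> // x [_ Ux _]; split=> //; apply: hU.
Qed.

Lemma lspan_pihomog N k (D : 'M[C]_(N, k)) i d p :
  lspan D i p -> lspan D i (pihomog mdeg d p).
Proof.
move=> [h ->]; rewrite raddf_sum /=; case: d => [|d].
  rewrite big1 => [|j _]; first exact: lspan0.
  by apply: pihomog_homogM_lt (lform_homog _) _.
exists (fun j => pihomog mdeg d (h j)); apply: eq_bigr => j _.
by rewrite -add1n (pihomog_homogM _ _ (lform_homog _)).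
Qed.

Lemma lspan_ideal N k (D : 'M[C]_(N, k)) i : is_ideal (lspan D i).
Proof.
by split=> [|x y|x y]; [apply: lspan0|apply: lspanD|apply: lspanMl].
Qed.

Lemma dhomog_prod_exists N (I : Type) (r : seq I) (P : pred I) (F : I -> {mpoly C[N]}) (d : I -> nat) :
  (forall i, F i \is (d i).-homog) ->
  \prod_(i <- r | P i) F i \is (\sum_(i <- r | P i) d i)%N.-homog.
Proof.
move=> h; apply: (big_ind2 (fun p e => p \is e.-homog)) => //; first exact: dhomog1.
by move=> p d1 q d2; apply: dhomogM.
Qed.

End Spans.

Section Extension.
Variables (C : closedFieldType) (n k : nat).
Local Notation N := (n + k).+1.
Variables (V : pset C n.+1) (iota : 'M[C]_(n.+1, N)) (W : pset C N).
Hypotheses (vV : variety V) (extW : extension V iota W).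

Let fi : row_free iota. Proof. by case: extW. Qed.
Let vW : variety W. Proof. by case: extW. Qed.

Lemma extension_restr w : V w <-> W (w *m iota).
Proof. by case: extW => _ _ []. Qed.

Lemma extension_vanish_lsub p : vanish W p -> vanish V (lsub iota p).
Proof. by move=> h w /extension_restr/h; rewrite meval_lsub. Qed.

Lemma lsub_section p : exists P, lsub iota P = p.
Proof. by exists (lsub (pinvmx iota) p); rewrite lsub_lsub mulmxVp // lsub_id. Qed.

Lemma lsub_section_homog d p : p \is d.-homog -> exists P, P \is d.-homog /\ lsub iota P = p.
Proof.
move=> hp; exists (lsub (pinvmx iota) p); rewrite lsub_lsub mulmxVp // lsub_id.
by split=> //; apply: lsub_homog.
Qed.

(** The scheme-theoretic condition is applied to the section p / c^d of the ideal sheaf, [c] being a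
    linear form with value 1 at [w]; then denominators are cleared. *)
Lemma extension_local_lift d p w : p \is d.-homog -> vanish V p -> V w ->
  exists P Q, [/\ vanish W P, Q.@[(w *m iota) 0] != 0 & lsub iota P = lsub iota Q * p].
Proof.
move=> hp Vp Vw; have w0 : w != 0 by apply: pclosed_neq0 Vw; case: vV.
have [c cw] := lform_neq0 w0; pose q := lform c ^+ d.
have hq : q \is d.-homog.
  by apply: homog_eq_deg (dhomogMn _ (lform_homog c)) _; rewrite mul1n.
have qw : q.@[w 0] != 0 by rewrite rmorphXn /= cw expr1n oner_eq0.
have [_ _ [_ lin] _ _] := extW.
have oU := popen_neq hq.
have [U' [F [oU' U'w hF Fs]]] := lin w _ _ Vw oU (conj w0 qw) (ratio_ideal_section hp hq Vp).
have [P [Q hPQ]] := section_frac oU' U'w hF.1.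
have WP : vanish W P by apply: ideal_frac_vanish vW oU' U'w _ hF hPQ; apply/extension_restr.
have [U2 [oU2 U2w hU2]] := frac_at_open hPQ.
have [Q' Q'E] := lsub_section q.
have e : lsub iota P * q = p * lsub iota Q.
  apply/eqP; rewrite -subr_eq0; apply/eqP.
  apply: (mpoly_open_eq0 (popenI oU (popen_lsub fi (popenI oU' oU2)))); first by exists w.
  move=> x [[x0 qx] [U'x U2x]]; have [Qx FE] := hU2 _ U2x.
  have := Fs x (conj x0 qx) U'x; rewrite FE => /eqP; rewrite eqr_div // => /eqP.
  by rewrite mevalB !mevalM !meval_lsub => ->; rewrite subrr.
exists (P * Q'), Q; split=> //; first by move=> x /WP h; rewrite mevalM h mul0r.
  exact: frac_at_neq0 hPQ.
by rewrite lsubM Q'E e mulrC.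
Qed.

Variable D : 'M[C]_(N, k).
Hypothesis kerD : (iota :=: kermx D)%MS.

Lemma extension_kermx : iota *m D = 0.
Proof. by apply/sub_kermxP; rewrite kerD. Qed.

Lemma lspan_lsub0 i p : lspan D i p -> lsub iota p = 0.
Proof.
move=> [h ->]; rewrite lsub_sum big1 // => j _.
rewrite lsubM (_ : lsub iota (lform _) = 0) ?mul0r //.
apply: mpoly_eval_inj => w.
by rewrite meval_lsub meval_lform_col -mulmxA extension_kermx mulmx0 mxE meval0.
Qed.

(** The ideal J + (t_0, ..., t_(i-1)), which interpolates between W for [i = 0] and its section by H
    for [i = k]. *)
Definition eqideal (i : nat) (p : {mpoly C[N]}) :=
  exists F, vanish W F /\ lspan D i (p - F).

Lemma eqideal_ideal i : is_ideal (eqideal i).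
Proof.
have [v0 vD vM] := vanish_ideal W; have [l0 lD lM] := lspan_ideal D i.
split=> [|p q [F [WF hF]] [G [WG hG]]|p q [F [WF hF]]].
- by exists 0; rewrite subr0.
- by exists (F + G); rewrite opprD addrACA; split; [apply: vD|apply: lD].
- by exists (p * F); rewrite -mulrBr; split; [apply: vM|apply: lM].
Qed.

Lemma vanish_eqideal i p : vanish W p -> eqideal i p.
Proof. by move=> h; exists p; rewrite subrr; split=> //; apply: lspan0. Qed.

Lemma lspan_eqideal i p : lspan D i p -> eqideal i p.
Proof. by move=> h; exists 0; rewrite subr0; split=> // w _; rewrite meval0. Qed.

Lemma eqideal0 p : eqideal 0 p -> vanish W p.
Proof.
move=> [F [WF [h]]]; rewrite big_pred0 // => /eqP.
by rewrite subr_eq0 => /eqP->.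
Qed.

Lemma eqideal_le i i' p : (i <= i')%N -> eqideal i p -> eqideal i' p.
Proof. by move=> le [F [WF hF]]; exists F; split=> //; apply: lspan_le hF. Qed.

Lemma eqidealS (i : 'I_k) p :
  eqideal i.+1 p <-> exists h q, eqideal i q /\ p = q + lform (col i D) * h.
Proof.
split=> [[F [WF /lspanS[h [q [hq pE]]]]]|[h [q [[F [WF hF]] ->]]]].
  exists h, (q + F); split; last by rewrite addrAC -pE subrK.
  by exists F; rewrite addrK.
exists F; split=> //; apply/lspanS; exists h, (q - F); split=> //.
by rewrite addrAC.
Qed.

Lemma eqideal_pihomog i d p : eqideal i p -> eqideal i (pihomog mdeg d p).
Proof.
move=> [F [WF hF]]; exists (pihomog mdeg d F); rewrite -raddfB; split.
  by apply: vanish_pihomog => //; apply: pclosed_cone; case: vW.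
exact: lspan_pihomog.
Qed.

Lemma eqideal_vanish i p : eqideal i p -> vanish V (lsub iota p).
Proof.
move=> [F [WF /lspan_lsub0/eqP]]; rewrite lsubB subr_eq0 => /eqP->.
exact: extension_vanish_lsub.
Qed.

(** Membership in [eqideal i] after localizing at [w], regarded as a point of H; the denominator
    need not be homogeneous. *)
Definition loc (i : nat) (w : 'rV[C]_n.+1) (p : {mpoly C[N]}) :=
  exists q, q.@[(w *m iota) 0] != 0 /\ eqideal i (q * p).

Lemma loc_ideal i w : is_ideal (loc i w).
Proof.
have [v0 vD vM] := eqideal_ideal i.
split=> [|x y [p [pw hp]] [q [qw hq]]|x y [q [qw hq]]].
- by exists 1; rewrite meval1 oner_eq0 mulr0.
- exists (p * q); rewrite mevalM mulf_neq0 //; split=> //.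
  rewrite mulrDr; apply: vD; last by rewrite -mulrA; apply: vM.
  by rewrite mulrAC mulrC; apply: vM.
- by exists q; split=> //; rewrite mulrCA; apply: vM.
Qed.

Lemma eqideal_loc i w p : eqideal i p -> loc i w p.
Proof. by move=> h; exists 1; rewrite meval1 oner_eq0 mul1r. Qed.

Lemma loc_le i i' w p : (i <= i')%N -> loc i w p -> loc i' w p.
Proof. by move=> le [q [qw hq]]; exists q; split=> //; apply: eqideal_le hq. Qed.

Lemma loc_mul i w p q : q.@[(w *m iota) 0] != 0 -> loc i w (q * p) -> loc i w p.
Proof.
move=> qw [r [rw hr]]; exists (r * q); rewrite mevalM mulf_neq0 //.
by rewrite -mulrA.
Qed.

(* Germwise, the equations of H form a regular sequence on W: the hypothesis on
   local sections, with denominators cleared. *)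
Lemma loc_regular (i : 'I_k) w d G : V w -> G \is d.-homog ->
  loc i w (lform (col i D) * G) -> loc i w G.
Proof.
move=> Vw hG [q [qw hq]]; have Ww : W (w *m iota) by apply/extension_restr.
have W0 x : W x -> x != 0 by apply: pclosed_neq0; case: vW.
have [m mw] := exists_pihomog_neq0 qw.
set b := pihomog mdeg m q in mw; have hb : b \is m.-homog by apply: pihomogP.
pose t := lform (col i D); have ht : t \is 1.-homog by apply: lform_homog.
have : eqideal i (b * (t * G)).
  have := eqideal_pihomog (1 + d + m) hq; rewrite mulrC.
  by rewrite (pihomog_homogM _ _ (dhomogM ht hG)) mulrC.
clearbody b; move=> [F [WF [H HE]]].
(* Keeping only components of the right degree makes the coefficients homogeneous, so that they
   define local sections of O_W. *)
have {HE} : exists F (H : 'I_k -> {mpoly C[N]}), [/\ vanish W F, forall j, H j \is (m + d).-homog &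
    b * (t * G) = F + \sum_(j < k | (j < i)%N) lform (col j D) * H j].
  exists (pihomog mdeg (1 + (m + d)) F), (fun j => pihomog mdeg (m + d) (H j)); split.
  - by apply: vanish_pihomog => //; apply: pclosed_cone; case: vW.
  - by move=> j; apply: pihomogP.
  have hbt : b * (t * G) \is (1 + (m + d)).-homog.
    by apply: homog_eq_deg (dhomogM hb (dhomogM ht hG)) _; rewrite addnCA addnA.
  rewrite -[LHS](pihomog_dE hbt) -[b * _](subrK F) HE raddfD /= addrC; congr (_ + _).
  rewrite raddf_sum /=; apply: eq_bigr => j _.
  by rewrite (pihomog_homogM _ _ (lform_homog _)).
move: F H WF => _ _ _ [F [H [WF hH HE]]].
have wi0 := W0 _ Ww; have [c cw] := lform_neq0 wi0; set L := lform c in cw.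
have hL : L \is 1.-homog by apply: lform_homog.
have hLd : L ^+ d \is d.-homog by apply: homog_eq_deg (dhomogMn _ hL) _; rewrite mul1n.
pose U := fun x : 'rV_N => x != 0 /\ (b * L).@[x 0] != 0.
have oU : popen U by apply: popen_neq (dhomogM hb hL).
have Uw : U (w *m iota) by split=> //; rewrite mevalM cw mulr1.
have UL x : U x -> b.@[x 0] != 0 /\ L.@[x 0] != 0.
  by move=> [_]; rewrite mevalM mulf_eq0 negb_or => /andP[].
have [_ _ _ _ reg] := extW.
have sg : is_section W U 0 (fun x => G.@[x 0] / (L ^+ d).@[x 0]).
  apply: (ratio_section hG hLd) => //; first by rewrite addr0.
  by move=> x /UL[_ Lx]; rewrite rmorphXn expf_neq0.
have sh j : is_section W U 0 (fun x => (H j).@[x 0] / (b * L ^+ d).@[x 0]).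
  apply: (ratio_section (hH j) (dhomogM hb hLd)) => //; first by rewrite addr0.
  by move=> x /UL[bx Lx]; rewrite mevalM mulf_neq0 // rmorphXn expf_neq0.
have [] := reg D kerD w U i _ _ Vw oU Uw sg sh.
  move=> x Wx Ux; have [bx Lx] := UL x Ux.
  have /(congr1 (meval (x 0))) := HE; rewrite mevalD (WF x Wx) add0r !mevalM.
  rewrite meval_lform_col => hx.
  have -> : \sum_(j < k | (j < i)%N) (x *m D) 0 j * ((H j).@[x 0] / (b.@[x 0] * (L ^+ d).@[x 0])) =
      b.@[x 0] * ((x *m D) 0 i * G.@[x 0]) / (b.@[x 0] * (L ^+ d).@[x 0]).
    by rewrite hx meval_lform_sum [RHS]mulr_suml; apply: eq_bigr => j _; rewrite mulrA.
  by rewrite -mulf_div divff // mul1r mulrA.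
move=> U' [h [oU' U'w hh gE]].
have loc_h j : exists pq : ({mpoly C[N]} * {mpoly C[N]} * {mpoly C[N]}), exists e,
    [/\ pq.1.1 \is e.-homog, pq.1.2 \is e.+1.-homog, homogeneous pq.2,
        (pq.1.2 * pq.2).@[(w *m iota) 0] != 0 &
    forall x, W x -> U' x -> pq.2.@[x 0] != 0 ->
      pq.1.2.@[x 0] != 0 /\ h j x = pq.1.1.@[x 0] / pq.1.2.@[x 0]].
  have [U1 [oU1 U1w [p' [q' [e [e' [hp hq' ee hE]]]]]]] := hh j _ Ww U'w.
  have [f [r [hr rw rU]]] := popen_basis oU1 U1w.
  exists (p', q', r), e => /=; split=> //.
  - by rewrite (_ : e.+1 = e')%N //; move: ee; clear; lia.
  - by exists f.
  - have [q'w _] := hE _ (And3 Ww U'w U1w).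
    by rewrite mevalM; apply: mulf_neq0.
  - by move=> x Wx U'x rx; apply: hE; split=> //; apply: rU => //; apply: W0.
have {loc_h} [pq /choice[e loc_h]] := choice loc_h.
have /choice[f hf] : forall j, exists f, (pq j).2 \is f.-homog.
  by move=> j; have [_ _] := loc_h j.
pose q_ j := (pq j).1.2; pose p_ j := (pq j).1.1; pose r_ j := (pq j).2.
have hqr j : q_ j * r_ j \is ((e j).+1 + f j).-homog.
  by apply: dhomogM; [case: (loc_h j)|apply: hf].
(* A common homogeneous denominator. The factors [r_ j] confine it to the open sets on which the
   fractions represent the local sections. *)
pose R := \prod_j (q_ j * r_ j).
pose R_ j := r_ j * \prod_(l | l != j) (q_ l * r_ l).
have RE j : R = q_ j * R_ j by rewrite /R (bigD1 j) //= mulrA.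
pose r := (\sum_j ((e j).+1 + f j))%N.
have hR : R \is r.-homog by apply: dhomog_prod_exists.
have Rx (x : 'rV_N) : R.@[x 0] != 0 -> forall j, (r_ j).@[x 0] != 0.
  by move=> + j; rewrite (RE j) !mevalM !mulf_eq0 !negb_or => /andP[_ /andP[]].
have Rw : R.@[(w *m iota) 0] != 0.
  rewrite rmorph_prod; apply/prodf_neq0 => j _; by case: (loc_h j).
(* The relation given by regularity with its denominators cleared. By homogeneity its vanishing on W
   can be checked on a nonempty open subset. *)
pose K := R * G - L ^+ d * \sum_(j < k | (j < i)%N) lform (col j D) * (p_ j * R_ j).
have hK : K \is (r + d).-homog.
  apply: rpredB; first exact: dhomogM.
  rewrite mulr_sumr; apply: rpred_sum => j _.
  have hRj : R_ j \is (f j + \sum_(l | l != j) ((e l).+1 + f l)).-homog.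
    by apply: dhomogM; [apply: hf|apply: dhomog_prod_exists].
  have hpj : p_ j \is (e j).-homog by case: (loc_h j).
  apply: homog_eq_deg (dhomogM hLd (dhomogM (lform_homog _) (dhomogM hpj hRj))) _.
  rewrite /r [in RHS](bigD1 j) //=; move: (\sum_(_ < k | _) _)%N => z; clear; lia.
have WK : vanish W K.
  have oUU := popenI (popenI oU oU') (popen_neq hR).
  apply: (vanish_open vW oUU _ hK); first by exists (w *m iota).
  move=> x Wx [[Ux U'x] [_ Rx0]]; have [bx Lx] := UL x Ux.
  rewrite mevalB !mevalM; have /eqP := gE x Wx Ux U'x; rewrite rmorphXn /=.
  rewrite -(inj_eq (mulfI (expf_neq0 d Lx))) mulrCA divff ?expf_neq0 // mulr1 => /eqP->.
  rewrite meval_lform_sum mulrCA -mulrBr mulr_sumr -sumrB big1 ?mulr0 // => j _.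
  have [_ _ _ _ hj] := loc_h j; have [qx ->] := hj x Wx U'x (Rx x Rx0 j).
  rewrite (RE j) !mevalM -/(p_ j) -/(q_ j).
  apply/eqP; rewrite subr_eq0; apply/eqP.
  have aux (s1 s2 s3 s4 : C) : s1 != 0 -> s1 * s2 * (s3 * (s4 / s1)) = s3 * (s4 * s2).
    by move=> s0; field.
  exact: aux.
exists R; split=> //; exists K; split=> //; rewrite opprB addrC addrNK.
apply: lspanMl; by exists (fun j => p_ j * R_ j).
Qed.
End Extension.

(** * Lifting equations from V to W *)

Section NegativeSections.
Variables (C : closedFieldType) (n : nat) (V : pset C n.+1).
Hypotheses (vV : variety V) (pnV : projectively_normal V) (ndV : nondegenerate_pset V).

(** [Negz m] is -(m+1), so s L^(m+1) has degree 0 for a linear form L and is constant by projective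
    normality. L is chosen with value 1 at [w] and a zero [w1] on V: as n > 0 some hyperplane passes
    through [w], it misses a point [w1] of V by nondegeneracy, and its equation [a] corrects [c]. *)
Lemma no_negative_sections m s : (0 < n)%N ->
  is_section V pspace (Negz m) s -> forall w, V w -> s w = 0.
Proof.
move=> n0 hs w Vw; have cV : pclosed V by case: vV.
have [a a0 aw] : exists2 a : 'cV[C]_n.+1, a != 0 & w *m a = 0.
  have /rowV0Pn[a /sub_kermxP ha a0] : kermx w^T != 0.
    rewrite -mxrank_eq0 mxrank_ker subn_eq0 -ltnNge.
    by apply: leq_ltn_trans (rank_leq_col _) _.
  exists a^T; first by rewrite -(inj_eq trmx_inj) trmxK trmx0.
  by apply: trmx_inj; rewrite trmx_mul trmxK trmx0.
have /existsNP[w1 /not_implyP[Vw1 /eqP aw1]] : ~ (forall x, V x -> x *m a = 0).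
  by move=> /ndV/eqP; rewrite (negbTE a0).
have {}aw1 : (w1 *m a) 0 0 != 0.
  by apply: contraNneq aw1 => z; apply/eqP/matrixP => i j; rewrite !ord1 z mxE.
have [c cw] := lform_neq0 (pclosed_neq0 cV Vw).
pose c' := c - ((w1 *m c) 0 0 / (w1 *m a) 0 0) *: a; pose L := lform c'.
have Lw : L.@[w 0] = 1.
  rewrite meval_lform /c' mulmxBr -scalemxAr aw scaler0 subr0.
  by rewrite -meval_lform cw.
have Lw1 : L.@[w1 0] = 0.
  by rewrite meval_lform /c' mulmxBr -scalemxAr mxE [X in _ + X]mxE [X in _ - X]mxE divfK ?subrr.
have hL : L ^+ m.+1 \is m.+1.-homog.
  by apply: homog_eq_deg (dhomogMn _ (lform_homog c')) _; rewrite mul1n.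
have /pnV[p [/homog0_const pE hp]] : is_section V pspace 0%N%:Z (fun x => (L ^+ m.+1).@[x 0] * s x).
  move=> x Vx px; have [U [oU Ux [p [q [d [e [hp hq de hf]]]]]]] := hs x Vx px.
  exists U; split=> //; exists (L ^+ m.+1 * p), q, (m.+1 + d)%N, e; split=> //.
  - exact: dhomogM.
  - by rewrite PoszD de NegzE addrCA addrN.
  - by move=> y /hf[q0 sy]; rewrite mevalM sy mulrA.
have := hp w1 Vw1; rewrite rmorphXn /= Lw1 expr0n mul0r pE mevalC => z.
by have := hp w Vw; rewrite rmorphXn /= Lw expr1n mul1r pE mevalC -z.
Qed.
End NegativeSections.

(** * Krull's intersection theorem *)

Section Krull.
Variables (C : closedFieldType) (N : nat) (P : {mpoly C[N]} -> Prop) (w : 'rV[C]_N).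
Hypothesis idP : is_ideal P.

(* Krull's intersection theorem for the localization at w of the quotient by P. *)
Lemma infinitely_divisible (t : {mpoly C[N]}) (p q : nat -> {mpoly C[N]}) :
  t.@[w 0] = 0 -> (forall a, (q a).@[w 0] != 0) ->
  (forall a, P (q a * p a - t * p a.+1)) ->
  exists u, u.@[w 0] != 0 /\ P (u * p 0%N).
Proof.
have [P0 PD PM] := idP => tw qw h.
have chain a j : (0 < j)%N -> exists u c, u.@[w 0] != 0 /\ P (u * p a - t * c * p (a + j)%N).
  elim: j a => [//|j IH] a _; case: j IH => [|j] IH.
    by exists (q a), 1; rewrite mulr1 addn1.
  have [u [c [uw hu]]] := IH a.+1 erefl; exists (u * q a), (t * c).
  rewrite mevalM mulf_neq0 //; split=> //.
  rewrite (_ : _ - _ = u * (q a * p a - t * p a.+1) + t * (u * p a.+1 - t * c * p (a.+1 + j.+1)%N)).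
    by apply: PD; apply: PM.
  by rewrite addSnnS; ring.
(* [p a] is a combination of earlier terms, each of which is, up to a unit at [w], [t] times a
   multiple of [p a]. Hence some u - t c' multiplies [p a] into [P], and it is a unit at [w] because
   [t] vanishes there. *)
have [a [c pa]] := noeth_mpoly p.
have comb r : (r <= a)%N -> exists u c', u.@[w 0] != 0 /\
    P (u * \sum_(b < r) c b * p b - t * c' * p a).
  elim: r => [|r IH] ra.
    by exists 1, 0; rewrite meval1 oner_eq0 big_ord0 !mulr0 mul0r subr0.
  have [u [c1 [uw hu]]] := IH (ltnW ra).
  have [|v [c2 [vw hv]]] := chain r (a - r)%N; first by rewrite subn_gt0.
  rewrite subnKC ?(ltnW ra) // in hv.
  exists (u * v), (v * c1 + u * c r * c2); rewrite mevalM mulf_neq0 //; split=> //.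
  rewrite big_ord_recr /=; set S := \sum_(_ < _) _ in hu *.
  rewrite (_ : _ - _ = v * (u * S - t * c1 * p a) + (u * c r) * (v * p r - t * c2 * p a)).
    by apply: PD; apply: PM.
  by ring.
have [u [c' [uw]]] := comb a (leqnn a); rewrite -pa -mulrBl => hu.
have [v [vw hv]] : exists v, v.@[w 0] != 0 /\ P (v * p a).
  by exists (u - t * c'); rewrite mevalB mevalM tw mul0r subr0.
case: a {c pa comb hu} v vw hv => [|a] v vw hv; first by exists v.
have [//|v' [c2 [v'w hv']]] := chain 0%N a.+1; exists (v * v').
rewrite mevalM mulf_neq0 //; split=> //.
rewrite (_ : _ * _ = v * (v' * p 0%N - t * c2 * p (0 + a.+1)%N) + t * c2 * (v * p a.+1)).
  by apply: PD; apply: PM.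
by rewrite add0n; ring.
Qed.
End Krull.

(** * From local to global equations of W *)

Section Lifting.
Variables (C : closedFieldType) (n k : nat).
Local Notation N := (n + k).+1.
Variables (V : pset C n.+1) (iota : 'M[C]_(n.+1, N)) (W : pset C N).
Hypotheses (vV : variety V) (pnV : projectively_normal V) (ndV : nondegenerate_pset V).
Hypothesis (extW : extension V iota W).
Variable D : 'M[C]_(N, k).
Hypothesis kerD : (iota :=: kermx D)%MS.

Let fi : row_free iota. Proof. by case: extW. Qed.
Let vW : variety W. Proof. by case: extW. Qed.
Local Notation eqideal := (eqideal W D).
Local Notation loc := (loc iota W D).
Local Notation t_ i := (lform (col i D)).

(** A count of ranks: [k] equations of a subspace of codimension [k] are independent. *)
Lemma equations_row_full : pinvmx D *m D = 1%:M.
Proof.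
apply: mulVpmx; rewrite /row_full.
have := mxrank_ker D; have /eqP <- : \rank iota == \rank (kermx D) by rewrite kerD.
have /eqP -> := fi; have := rank_leq_col D; have := rank_leq_row D.
by clear; move: (\rank D) => r; move=> *; apply/eqP; lia.
Qed.

Lemma kermx_iota (w : 'rV_N) : w *m D = 0 -> exists u, w = u *m iota.
Proof. by move=> /sub_kermxP; rewrite -kerD => /submxP[u ->]; exists u. Qed.

Lemma vanish_lspan p : lsub iota p = 0 -> lspan D k p.
Proof.
move=> h; apply: (lspan_vanish equations_row_full) => w wD.
have [u ->] : exists u, w = u *m iota.
  by apply: kermx_iota; apply/rowP => j; rewrite wD // mxE.
by rewrite -meval_lsub h meval0.
Qed.

Lemma t_iota (w : 'rV_n.+1) i : (t_ i).@[(w *m iota) 0] = 0.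
Proof. by rewrite meval_lform_col -mulmxA (extension_kermx kerD) mulmx0 mxE. Qed.

Lemma loc0_vanish w d p : V w -> p \is d.-homog -> loc 0 w p -> vanish W p.
Proof.
move=> Vw hp [q [qw /eqideal0 hq]]; apply: (vanish_mul vW hp _ qw hq).
exact/(extension_restr extW).
Qed.

Lemma loc_vanish w d p : V w -> p \is d.-homog -> loc k w p -> vanish V (lsub iota p).
Proof.
move=> Vw hp [q [qw /(eqideal_vanish extW kerD)]]; rewrite lsubM.
by apply: (vanish_mul vV (lsub_homog _ hp) Vw); rewrite meval_lsub.
Qed.

Lemma loc_eval w i p : V w -> loc i w p -> p.@[(w *m iota) 0] = 0.
Proof.
move=> Vw [q [qw /(eqideal_vanish extW kerD)/(_ w Vw)/eqP]].
by rewrite meval_lsub mevalM mulf_eq0 (negbTE qw) => /eqP.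
Qed.

Lemma vanish_loc w d p : V w -> p \is d.-homog -> vanish V (lsub iota p) -> loc k w p.
Proof.
move=> Vw hp Vp; have [P [Q [WP Qw PQ]]] := extension_local_lift vV extW (lsub_homog iota hp) Vp Vw.
exists Q; split=> //; exists P; split=> //; apply: vanish_lspan.
by rewrite lsubB lsubM PQ subrr.
Qed.

(** The positive degree of the denominator, obtained from an extra linear form, ensures that a later
    division by t_i leaves a nonnegative degree. *)
Lemma loc_homogS i w d p : V w -> p \is d.-homog -> loc i w p ->
  exists q e, [/\ q \is e.+1.-homog, q.@[(w *m iota) 0] != 0 & eqideal i (q * p)].
Proof.
move=> Vw hp [q [qw hq]]; have [m mw] := exists_pihomog_neq0 qw.
have wi0 : w *m iota != 0.
  by apply: (@pclosed_neq0 _ _ W); [case: vW|apply/(extension_restr extW)].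
have [c cw] := lform_neq0 wi0.
exists (lform c * pihomog mdeg m q), m; split.
- by rewrite -(add1n m); apply: dhomogM; [apply: lform_homog|apply: pihomogP].
- by rewrite mevalM cw mul1r.
have [_ _ hM] := eqideal_ideal W D i; rewrite -mulrA; apply: hM.
have := eqideal_pihomog extW (d + m) hq; rewrite [q * p]mulrC.
by rewrite (pihomog_homogM _ _ hp) mulrC.
Qed.

(* A section of O(m) along V of the quotient of O_W by t_0, ..., t_(i-1), given
   near each point w of V by the fraction P w / Q w. *)
Definition local_family (i : nat) (m : int) (P Q : 'rV[C]_n.+1 -> {mpoly C[N]}) :=
  [/\ forall w, V w -> exists d e, [/\ P w \is d.-homog, Q w \is e.-homog & d%:Z = e%:Z + m],
      forall w, V w -> (Q w).@[(w *m iota) 0] != 0 &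
      forall w w' x, V w -> V w' -> V x ->
        (Q w).@[(x *m iota) 0] != 0 -> (Q w').@[(x *m iota) 0] != 0 ->
        loc i x (P w * Q w' - P w' * Q w)].

(** In negative degree the only polynomial is 0. *)
Definition homog_int (m : int) (G : {mpoly C[N]}) :=
  if m is Posz d then is_true (G \is d.-homog) else G = 0.

Definition represents i (P Q : 'rV[C]_n.+1 -> {mpoly C[N]}) (G : {mpoly C[N]}) :=
  forall w, V w -> loc i w (P w - G * Q w).

Lemma local_family_le i i' m P Q : (i <= i')%N -> local_family i m P Q -> local_family i' m P Q.
Proof.
move=> le [h1 h2 h3]; split=> // w w' x Vw Vw' Vx q q'.
exact: loc_le le (h3 _ _ _ Vw Vw' Vx q q').
Qed.

Lemma homog_int_sub m d e p q G : p \is d.-homog -> q \is e.-homog ->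
  d%:Z = e%:Z + m -> homog_int m G -> p - G * q \is d.-homog.
Proof.
case: m => m hp hq de /= hG; last by rewrite hG mul0r subr0.
apply: rpredB => //; apply: homog_eq_deg (dhomogM hG hq) _.
by move: de; clear; lia.
Qed.

Lemma family_base m P Q : (0 < n)%N -> local_family k m P Q ->
  exists G, homog_int m G /\ represents k P Q G.
Proof.
move=> n0 fam; have [h1 h2 h3] := fam.
pose s (w : 'rV[C]_n.+1) := (P w).@[(w *m iota) 0] / (Q w).@[(w *m iota) 0].
have sE w x : V w -> V x -> (Q w).@[(x *m iota) 0] != 0 ->
    s x = (P w).@[(x *m iota) 0] / (Q w).@[(x *m iota) 0].
  move=> Vw Vx qx; apply/eqP; rewrite eqr_div ?h2 //.
  have := loc_eval Vx (h3 x w x Vx Vw Vx (h2 x Vx) qx).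
  by rewrite mevalB !mevalM => /eqP; rewrite subr_eq0.
have hs : is_section V pspace m s.
  move=> w Vw w0; have [d [e [hP hQ de]]] := h1 w Vw.
  exists (fun x : 'rV_n.+1 => x != 0 /\ (lsub iota (Q w)).@[x 0] != 0); split.
  - exact: popen_neq (lsub_homog iota hQ).
  - by rewrite meval_lsub h2.
  exists (lsub iota (P w)), (lsub iota (Q w)), d, e; split=> //; try exact: lsub_homog.
  by move=> x [Vx _ [_ qx]]; split=> //; rewrite !meval_lsub in qx *; apply: sE.
have [G [hG GE]] : exists G, homog_int m G /\ forall w, V w -> s w = G.@[(w *m iota) 0].
  case: m hs {fam h1} => m hs.
    have [p [hp ps]] := pnV hs; have [G [hG GE]] := lsub_section_homog extW hp.
    by exists G; split=> // w Vw; rewrite -meval_lsub GE ps.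
  exists 0; split=> // w Vw; rewrite meval0.
  exact: (no_negative_sections vV pnV ndV n0 hs).
exists G; split=> // w Vw; have [d [e [hP hQ de]]] := h1 w Vw.
have hd := homog_int_sub hP hQ de hG; apply: (vanish_loc Vw hd).
have oU := popen_neq (lsub_homog iota hQ).
have w0 : w != 0 by apply: pclosed_neq0 Vw; case: vV.
apply: (vanish_open vV oU _ (lsub_homog iota hd)).
  by exists w; split=> //; split=> //; rewrite meval_lsub h2.
move=> x Vx [x0]; rewrite !meval_lsub => qx.
by rewrite mevalB mevalM -GE // (sE w) // divfK ?subrr.
Qed.

(** Near each point P - G Q is t_i times a new numerator. The new fractions agree on overlaps
    because t_i times their discrepancy lies in the [i]-th ideal and t_i is a nonzerodivisor on
    germs. *)
Lemma family_divide (i : 'I_k) m P Q G : local_family i m P Q -> homog_int m G ->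
  represents i.+1 P Q G ->
  exists P' Q', local_family i (m - 1) P' Q' /\
    forall w, V w -> exists q, [/\ q.@[(w *m iota) 0] != 0, Q' w = q * Q w &
      eqideal i (q * (P w - G * Q w) - t_ i * P' w)].
Proof.
move=> fam hG rep; have [h1 h2 h3] := fam; have [e0 eD eM] := eqideal_ideal W D i.
have step w : exists qh : {mpoly C[N]} * {mpoly C[N]}, V w ->
    [/\ qh.1.@[(w *m iota) 0] != 0,
        exists d e, [/\ qh.2 \is d.-homog, qh.1 * Q w \is e.-homog & d%:Z = e%:Z + (m - 1)] &
        eqideal i (qh.1 * (P w - G * Q w) - t_ i * qh.2)].
  have [Vw|nV] := pselect (V w); last by exists (0, 0).
  have [d [e [hP hQ de]]] := h1 w Vw; have hX := homog_int_sub hP hQ de hG.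
  have [q [f [hq qw]]] := loc_homogS Vw hX (rep w Vw).
  move=> /eqidealS[h [q0 [hq0 qE]]].
  exists (q, pihomog mdeg (f + d) h) => _; split=> //.
    exists (f + d)%N, (f.+1 + e)%N; split; [exact: pihomogP|exact: dhomogM|].
    by move: de; clear; lia.
  have hqX : q * (P w - G * Q w) \is (1 + (f + d)).-homog.
    by apply: homog_eq_deg (dhomogM hq hX) _; rewrite add1n addSn.
  rewrite /= -(pihomog_dE hqX) qE raddfD /= (pihomog_homogM _ _ (lform_homog _)) addrK.
  exact: (eqideal_pihomog extW).
have {step}[qh step] := choice step.
exists (fun w => (qh w).2), (fun w => (qh w).1 * Q w); split; last first.
  by move=> w Vw; have [? _ ?] := step w Vw; exists (qh w).1.
split=> [w /step[]//|w Vw|w w' x Vw Vw' Vx].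
  by have [? _ _] := step w Vw; rewrite mevalM mulf_neq0 ?h2.
rewrite !mevalM !mulf_eq0 !negb_or => /andP[qx Qx] /andP[q'x Q'x].
have [_ [d [e [hd he de]]] E1] := step w Vw; have [_ [d' [e' [hd' he' de']]] E1'] := step w' Vw'.
have hh : (qh w).2 * ((qh w').1 * Q w') - (qh w').2 * ((qh w).1 * Q w) \is (d + e').-homog.
  apply: rpredB; first exact: dhomogM.
  by apply: homog_eq_deg (dhomogM hd' he) _; move: de de'; clear; lia.
apply: (loc_regular extW kerD Vx hh); have [l0 lD lM] := loc_ideal iota W D i x.
set q := (qh w).1 in E1 *; set q' := (qh w').1 in E1' *.
set h := (qh w).2 in E1 *; set h' := (qh w').2 in E1' *.
rewrite (_ : _ * _ = q * q' * (P w * Q w' - P w' * Q w) +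
  ((- (q' * Q w')) * (q * (P w - G * Q w) - t_ i * h) +
   (q * Q w) * (q' * (P w' - G * Q w') - t_ i * h'))); last by ring.
apply: (lD); first by apply: (lM); apply: h3.
by apply: (lD); apply: (lM); apply: eqideal_loc.
Qed.

(** A global representative of the divided family, multiplied by t_i, corrects [G]. The last clause
    keeps track of the congruence modulo t_i, which matters when [G] is 0. *)
Lemma family_refine (i : 'I_k) m P Q G :
  (forall P Q, local_family i (m - 1) P Q -> exists K, homog_int (m - 1) K /\ represents i P Q K) ->
  local_family i m P Q -> homog_int m G -> represents i.+1 P Q G ->
  exists G', homog_int m G' /\ (represents i P Q G' /\ exists K, G' = G + t_ i * K).
Proof.
move=> solve fam hG rep; have [P' [Q' [fam' hPQ]]] := family_divide fam hG rep.
have [K [hK repK]] := solve _ _ fam'; exists (G + t_ i * K); split.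
  case: m hK hG {solve fam fam'} => [[|m]|m] /= hK hG.
  - by rewrite hK mulr0 addr0.
  - apply: rpredD => //; rewrite subn1 /= in hK.
    by rewrite -(add1n m); apply: dhomogM => //; apply: lform_homog.
  - by rewrite hK hG mulr0 addr0.
split; last by exists K.
move=> w Vw; have [q [qw Q'E hq]] := hPQ w Vw; apply: (loc_mul qw).
have [l0 lD lM] := loc_ideal iota W D i w.
rewrite (_ : _ * _ = (q * (P w - G * Q w) - t_ i * P' w) + t_ i * (P' w - K * Q' w)).
  by apply: (lD); [apply: eqideal_loc|apply: (lM); apply: repK].
by rewrite Q'E; ring.
Qed.

Lemma family_negative i m P Q w : (0 < n)%N -> (i <= k)%N ->
  local_family i (Negz m) P Q -> V w -> loc i w (P w).
Proof.
move=> n0 ik; have [j jk ->] : exists2 j, (j <= k)%N & i = (k - j)%N.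
  by exists (k - i)%N; rewrite ?subKn ?leq_subr.
elim: j jk {i ik} m P Q w => [|j IH] jk m P Q w fam Vw.
  rewrite subn0 in fam *; have [G [/= ->]] := family_base n0 fam.
  by move=> /(_ w Vw); rewrite mul0r subr0.
have lt : (k - j.+1 < k)%N by rewrite ltn_subrL /= (leq_trans _ jk).
have {}IH := IH (ltnW jk); pose i := Ordinal lt; have iS : i.+1 = (k - j)%N by rewrite /= subnSK.
rewrite -[(k - j.+1)%N]/(nat_of_ord i) in fam *.
(* Families of arbitrary negative degree are packed together so that division by t_i, which lowers
   the degree, can be iterated; at stage [i + 1] they are represented by 0. *)
pose T := {x : ('rV[C]_n.+1 -> {mpoly C[N]}) * ('rV[C]_n.+1 -> {mpoly C[N]}) |
  exists m, local_family i (Negz m) x.1 x.2}.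
have next (x : T) : exists y : T, exists q, q.@[(w *m iota) 0] != 0 /\
    eqideal i (q * (sval x).1 w - t_ i * (sval y).1 w).
  case: x => -[P1 Q1] [m1 /= fam1].
  have [||P' [Q' [fam' hPQ]]] := @family_divide i (Negz m1) P1 Q1 0 fam1.
  - by [].
  - move=> x Vx; rewrite mul0r subr0 iS; apply: (IH m1 P1 Q1 x _ Vx).
    by apply: local_family_le fam1; rewrite -iS.
  have hy : exists m, local_family i (Negz m) (P', Q').1 (P', Q').2.
    by exists m1.+1; move: fam'; rewrite (_ : Negz m1 - 1 = Negz m1.+1) //; clear; lia.
  have [q [qw _]] := hPQ w Vw; rewrite mul0r subr0 => hq.
  by exists (exist _ (P', Q') hy), q.
have [nx nxP] := choice next; pose x0 : T := exist _ (P, Q) (ex_intro _ m fam).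
pose xs a := iter a nx x0.
have /choice[q hq] : forall a, exists q, q.@[(w *m iota) 0] != 0 /\
    eqideal i (q * (sval (xs a)).1 w - t_ i * (sval (xs a.+1)).1 w).
  by move=> a; apply: nxP.
have [] // := @infinitely_divisible _ _ _ (w *m iota) (eqideal_ideal W D i) (t_ i)
  (fun a => (sval (xs a)).1 w) q; first exact: t_iota.
- by move=> a; case: (hq a).
- by move=> a; case: (hq a).
by move=> u [uw hu]; exists u.
Qed.

(** Double induction: descending on [i], written k - j, and for fixed [i] ascending on [m], since
    correcting a section of degree m calls for one of degree m - 1 at the same [i]. At m = 0 that
    one has degree -1 and is zero. *)
Lemma family_solve i m P Q : (0 < n)%N -> (i <= k)%N -> local_family i m P Q ->
  exists G, homog_int m G /\ represents i P Q G.
Proof.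
move=> n0 ik; case: m => m; last first.
  move=> fam; exists 0; split=> // w Vw; rewrite mul0r subr0.
  exact: family_negative n0 ik fam Vw.
have [j jk ->] : exists2 j, (j <= k)%N & i = (k - j)%N.
  by exists (k - i)%N; rewrite ?subKn ?leq_subr.
elim: j jk {i ik} m P Q => [|j IH] jk m P Q.
  by rewrite subn0; apply: family_base.
have lt : (k - j.+1 < k)%N by rewrite ltn_subrL /= (leq_trans _ jk).
have {}IH := IH (ltnW jk); pose i := Ordinal lt; have iS : i.+1 = (k - j)%N by rewrite /= subnSK.
rewrite -[(k - j.+1)%N]/(nat_of_ord i).
elim: m P Q => [|m IHm] P Q fam.
  have famS := local_family_le (leqnSn i) fam; rewrite iS in famS.
  have [G [hG]] := IH 0%N P Q famS; rewrite -iS => rep.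
  have [||||G' [hG' [repG' _]]] := @family_refine i 0%N P Q G; [|by []|by []|by []|by exists G'].
  move=> P' Q' fam'; exists 0; split=> // w Vw; rewrite mul0r subr0.
  by apply: (@family_negative i 0 P' Q') => //; apply: ltnW.
have famS := local_family_le (leqnSn i) fam; rewrite iS in famS.
have [G [hG]] := IH m.+1 P Q famS; rewrite -iS => rep.
have [||||G' [hG' [repG' _]]] := @family_refine i m.+1%:Z P Q G; [|by []|by []|by []|by exists G'].
by move=> P' Q'; rewrite (_ : m.+1%:Z - 1 = m); [apply: IHm|clear; lia].
Qed.

(** The constant family p / 1 is represented by 0 modulo t_i. Its refinement is a global multiple
    t_i K, and p - t_i K is locally, hence by assumption globally, in the [i]-th ideal. *)
Lemma loc_eqidealS (i : 'I_k) : (0 < n)%N ->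
  (forall d p, p \is d.-homog -> (forall w, V w -> loc i w p) -> eqideal i p) ->
  forall d p, p \is d.-homog -> (forall w, V w -> loc i.+1 w p) -> eqideal i.+1 p.
Proof.
move=> n0 IH d p hp hl; have [l0 lD lM] := eqideal_ideal W D i.
have [||||G [hG [rep [K GE]]]] := @family_refine i d%:Z (fun=> p) (fun=> 1) 0.
- by move=> P Q; apply: family_solve => //; apply: ltnW.
- split=> [w Vw|w Vw|w w' x _ _ _ _ _].
  + by exists d, 0%N; split=> //; apply: dhomog1.
  + by rewrite meval1 oner_eq0.
  + by rewrite subrr; have [] := loc_ideal iota W D i x.
- by rewrite /= rpred0.
- by move=> w Vw; rewrite mul0r subr0; apply: hl.
apply/eqidealS; exists K, (p - G); rewrite GE add0r subrK; split=> //.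
apply: (IH d); first by apply: rpredB => //; move: hG; rewrite GE add0r.
by move=> w Vw; have := rep w Vw; rewrite GE add0r mulr1.
Qed.

(** Write p = q + t_i h. Then t_i h is locally in the [i]-th ideal, hence so is h by regularity, and
    h has smaller degree. *)
Lemma loc_eqideal_pred (i : 'I_k) :
  (forall d p, p \is d.-homog -> (forall w, V w -> loc i.+1 w p) -> eqideal i.+1 p) ->
  forall d p, p \is d.-homog -> (forall w, V w -> loc i w p) -> eqideal i p.
Proof.
move=> IH; elim=> [|d IHd] p hp hl; have [e0 eD eM] := eqideal_ideal W D i;
  have /eqidealS[h [q [hq pE]]] : eqideal i.+1 p.
- by apply: IH hp _ => w Vw; apply: loc_le (hl w Vw).
- rewrite -(pihomog_dE hp) pE raddfD /= (pihomog_homogM_lt _ (lform_homog _)) // addr0.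
  exact: (eqideal_pihomog extW).
- by apply: IH hp _ => w Vw; apply: loc_le (hl w Vw).
have hp1 : p \is (1 + d).-homog by [].
have qE : p - t_ i * pihomog mdeg d h = pihomog mdeg (1 + d) q.
  by rewrite -{1}(pihomog_dE hp1) pE raddfD /= (pihomog_homogM _ _ (lform_homog _)) addrK.
have hq' : eqideal i (p - t_ i * pihomog mdeg d h) by rewrite qE; apply: (eqideal_pihomog extW).
rewrite -[p](subrK (t_ i * pihomog mdeg d h)); apply: (eD) => //; apply: (eM).
have hh : pihomog mdeg d h \is d.-homog by apply: pihomogP.
apply: IHd => // w Vw; apply: (loc_regular extW kerD Vw hh).
have idl := loc_ideal iota W D i w.
rewrite -[X in loc i w X](subKr p); apply: idealB => //; first exact: hl.
exact: eqideal_loc.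
Qed.

(** For n > 0 the induction ascends from [i = 0], where W is a variety. For n = 0 it descends from
    [i = k]: there V is the single point of H, so a form vanishing on V vanishes on H. *)
Lemma loc_eqideal i d p : (i <= k)%N -> p \is d.-homog ->
  (forall w, V w -> loc i w p) -> eqideal i p.
Proof.
move=> ik; have [[w Vw] _] := vV.2; have [n0|n0] := posnP n; last first.
  elim: i ik d p => [|i IH] ik d p hp hl.
    by apply: vanish_eqideal; apply: (loc0_vanish Vw hp); apply: hl.
  by apply: (@loc_eqidealS (Ordinal ik) n0 _ d p hp hl) => d' p'; apply: IH; apply: ltnW.
have [j jk jE] : exists2 j, (j <= k)%N & i = (k - j)%N.
  by exists (k - i)%N; rewrite ?subKn ?leq_subr.
elim: j jk i ik jE d p => [|j IH] jk i ik jE d p hp hl.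
  rewrite subn0 in jE; rewrite {i ik}jE in hl *; apply: lspan_eqideal; apply: vanish_lspan.
  have Vp := loc_vanish Vw hp (hl w Vw).
  have cV : cone V by apply: pclosed_cone; case: vV.
  have w0 : w 0 0 != 0.
    have : w != 0 by apply: pclosed_neq0 Vw; case: vV.
    apply: contraNneq => z; apply/eqP/rowP => a; rewrite mxE -z; congr (w 0 _).
    by apply/val_inj; move: (ltn_ord a); rewrite /= [X in (_ < X.+1)%N]n0; case: (val a).
  apply: mpoly_eq0_off0 => x x0; rewrite (_ : x = (x 0 0 / w 0 0) *: w).
    rewrite Vp //; apply: cV => //; rewrite mulf_neq0 ?invr_eq0 //.
    apply: contraNneq x0 => z; apply/eqP/rowP => a; rewrite mxE -z; congr (x 0 _).
    by apply/val_inj; move: (ltn_ord a); rewrite /= [X in (_ < X.+1)%N]n0; case: (val a).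
  apply/rowP => a; rewrite mxE (_ : a = 0) ?divfK //.
  by apply/val_inj; move: (ltn_ord a); rewrite /= [X in (_ < X.+1)%N]n0; case: (val a).
have lt : (k - j.+1 < k)%N by rewrite ltn_subrL /= (leq_trans _ jk).
have {}IH := IH (ltnW jk); have iS : (k - j.+1).+1 = (k - j)%N by rewrite subnSK.
rewrite {}jE in hl *; apply: (@loc_eqideal_pred (Ordinal lt) _ d p hp hl) => d' p' /=.
by rewrite iS; apply: IH => //; apply: leq_subr.
Qed.

Lemma extension_lift_homog d p : p \is d.-homog -> vanish V p ->
  exists F, [/\ F \is d.-homog, vanish W F & lsub iota F = p].
Proof.
move=> hp Vp; have [G [hG GE]] := lsub_section_homog extW hp.
have [] : eqideal k G.
  by apply: (loc_eqideal (leqnn k) hG) => w Vw; apply: (vanish_loc Vw hG); rewrite GE.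
move=> F [WF /(lspan_lsub0 kerD)/eqP]; rewrite lsubB GE subr_eq0 => /eqP pE.
exists (pihomog mdeg d F); split; first exact: pihomogP.
  by apply: vanish_pihomog => //; apply: pclosed_cone; case: vW.
by rewrite -pihomog_lsub -pE pihomog_dE.
Qed.

Lemma eqideal_regular (i : 'I_k) p : eqideal i (t_ i * p) -> eqideal i p.
Proof.
move=> h; rewrite (pihomog_partitionE (leqnn (mmeasure mdeg p))).
apply: ideal_sum => [|d _]; first exact: eqideal_ideal.
have hd : pihomog mdeg d p \is d.-homog by apply: pihomogP.
apply: (loc_eqideal (ltnW (ltn_ord i)) hd) => w Vw.
apply: (loc_regular extW kerD Vw hd); apply: eqideal_loc.
have := eqideal_pihomog extW (1 + d) h.
by rewrite (pihomog_homogM _ _ (lform_homog _)).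
Qed.

(** For a sequence regular modulo J, the intersection of J with (t) is (t) J, a vanishing of Tor. At
    each stage regularity splits the last coefficient into an element of J and a combination of the
    earlier equations. *)
Lemma vanish_restr0 F : vanish W F -> lsub iota F = 0 ->
  exists g : 'I_k -> {mpoly C[N]}, (forall j, vanish W (g j)) /\ F = \sum_j t_ j * g j.
Proof.
move=> WF /vanish_lspan; have [v0 vD vM] := vanish_ideal W.
suff aux i : (i <= k)%N -> forall F, vanish W F -> lspan D i F ->
    exists g, (forall j, vanish W (g j)) /\ F = \sum_j t_ j * g j by apply: aux.
elim: i {F WF} => [|i IH] ik F WF.
  move=> [h ->]; exists (fun=> 0); split=> //; rewrite big_pred0 // big1 // => j _.
  by rewrite mulr0.
pose i' := Ordinal ik; move=> /(@lspanS _ _ _ _ i')[h [q [hq FE]]].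
have [F' [WF' hl]] : eqideal i' h.
  apply: eqideal_regular; exists F; split=> //.
  by rewrite FE opprD addrCA subrr addr0 -mulN1r; apply: lspanMl.
have [|g [Wg gE]] := IH (ltnW ik) (q + t_ i' * (h - F')) _ (lspanD hq (lspanMl _ hl)).
  rewrite (_ : _ + _ = F - t_ i' * F'); last by rewrite FE; ring.
  by apply: (idealB (vanish_ideal W) WF); apply: (vM).
exists (fun j => g j + (if j == i' then F' else 0)); split.
  by move=> j; apply: (vD) => //; case: eqP.
under eq_bigr => j _ do rewrite mulrDr.
rewrite big_split /= -gE (bigD1 i') //= eqxx [X in _ = _ + (_ + X)]big1 => [|j /negbTE->].
  by rewrite FE; ring.
by rewrite mulr0.
Qed.
End Lifting.

(** * The Kodaira-Spencer map *)

Section Equations.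
Variables (C : closedFieldType).

Lemma exists_unitmx_delta k (y : 'rV[C]_k) (i0 : 'I_k) : y != 0 ->
  exists2 G : 'M[C]_k, G \in unitmx & y *m G = delta_mx 0 i0.
Proof.
move=> y0; have k0 : (0 < k)%N by apply: leq_ltn_trans (ltn_ord i0).
have r1 : \rank y = 1%N.
  by apply/eqP; rewrite eqn_leq rank_leq_row lt0n mxrank_eq0.
pose c := col_ebase y 0 0; pose j0 := Ordinal k0.
have c0 : c != 0.
  have := col_ebase_unit y; rewrite unitmxE [col_ebase y]mx11_scalar det_scalar1.
  by rewrite unitfE.
exists (invmx (row_ebase y) *m (c^-1 *: tperm_mx j0 i0)).
  rewrite unitmx_mul unitmx_inv row_ebase_unit /= unitmxZ ?unitmx_perm //.
  by rewrite unitfE invr_eq0.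
rewrite -{1}(mulmx_ebase y) !mulmxA mulmxK ?row_ebase_unit // r1.
rewrite [col_ebase y]mx11_scalar -/c mul_scalar_mx -scalemxAr -scalemxAl scalerA mulVf // scale1r.
have -> : pid_mx 1 = delta_mx 0 j0 :> 'rV[C]_k.
  by apply/rowP => j; rewrite !mxE eqxx /= andbT -val_eqE /= eq_sym.
by apply/rowP => j; rewrite -rowE !mxE perm.tpermL eqxx /= eq_sym.
Qed.

Lemma exists_equations n k (iota : 'M[C]_(n.+1, (n + k).+1)) : row_free iota ->
  exists D : 'M[C]_((n + k).+1, k), (iota :=: kermx D)%MS.
Proof.
move=> fi; have : \rank (cokermx iota) = k.
  by rewrite mxrank_coker (eqP fi) subSS addKn.
move: (mulmx_base (cokermx iota)) (row_base_free (cokermx iota)).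
move: (col_base _) (row_base _); move: (\rank _) => r A B AB fB rk.
subst r; exists A; apply/eqmxP/andP; split.
  apply/sub_kermxP; apply: (row_free_inj fB); rewrite mul0mx -mulmxA AB.
  by rewrite mulmx_coker.
by rewrite submxE -AB mulmxA mulmx_ker mul0mx.
Qed.

(** Coordinates adapted to [v]: all equations but the last also vanish at [v], so they cut out the
    span of H and [v]. *)
Lemma exists_equations_last n k (iota : 'M[C]_(n.+1, (n + k).+1)) (v : 'rV_(n + k).+1) :
  row_free iota -> ~~ (v <= iota)%MS ->
  exists (i0 : 'I_k) (D : 'M[C]_((n + k).+1, k)),
    [/\ i0.+1 = k, (iota :=: kermx D)%MS & v *m D = delta_mx 0 i0].
Proof.
move=> fi vi; have [D0 kD] := exists_equations fi.
have y0 : v *m D0 != 0 by apply: contraNneq vi => z; rewrite kD; apply/sub_kermxP.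
have k0 : (0 < k)%N.
  rewrite lt0n; apply: contraNneq y0 => z; apply/eqP/rowP => -[j jk].
  by exfalso; rewrite z in jk.
have lt : (k.-1 < k)%N by rewrite prednK.
have [G uG GE] := exists_unitmx_delta (Ordinal lt) y0.
exists (Ordinal lt), (D0 *m G); split; [exact: prednK| |by rewrite mulmxA].
apply: (eqmx_trans kD); apply/eqmxP/andP; split; apply/sub_kermxP.
  by rewrite mulmxA mulmx_ker mul0mx.
by rewrite -[X in _ *m X](mulmxK uG) mulmxA mulmx_ker mul0mx.
Qed.

End Equations.

Section KodairaSpencer.
Variables (C : closedFieldType) (n : nat) (V : pset C n.+1).
Hypotheses (vV : variety V) (pnV : projectively_normal V) (ndV : nondegenerate_pset V).

Let cV : pclosed V. Proof. by case: vV. Qed.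

Section One.
Variables (k : nat).
Local Notation N := (n + k).+1.
Variables (iota : 'M[C]_(n.+1, N)) (W : pset C N).
Hypothesis (extW : extension V iota W).

Let fi : row_free iota. Proof. by case: extW. Qed.
Let vW : variety W. Proof. by case: extW. Qed.

(** By [vanish_restr0], F is a sum of products t_j g_j whose factors both vanish on V, so its
    derivative does too. Thus D_v F on V depends only on the restriction of F to H. *)
Lemma pderiv_restr0 v F w : vanish W F -> lsub iota F = 0 -> V w ->
  (pderiv v F).@[(w *m iota) 0] = 0.
Proof.
move=> WF F0 Vw; have [D kD] := exists_equations fi.
have [g [Wg ->]] := vanish_restr0 vV pnV ndV extW kD WF F0.
rewrite pderiv_sum raddf_sum /= big1 // => j _.
rewrite pderivM mevalD !mevalM (t_iota kD) mul0r addr0 Wg ?mulr0 //.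
exact/(extension_restr extW).
Qed.

Lemma extension_lift p : vanish V p -> exists F, vanish W F /\ lsub iota F = p.
Proof.
have [D kD] := exists_equations fi; have [v0 vD vM] := vanish_ideal W.
move=> Vp; have : forall d, exists F, vanish W F /\ lsub iota F = pihomog mdeg d p.
  move=> d; have hd : pihomog mdeg d p \is d.-homog by apply: pihomogP.
  have [F [_ WF FE]] := extension_lift_homog vV pnV ndV extW kD hd (vanish_pihomog d (pclosed_cone cV) Vp).
  by exists F.
move=> /choice[F hF]; rewrite (pihomog_partitionE (leqnn (mmeasure mdeg p))).
exists (\sum_(d < mmeasure mdeg p) F d); split.
  by apply: ideal_sum => [|d _]; [apply: vanish_ideal|case: (hF d)].
by rewrite lsub_sum; apply: eq_bigr => d _; case: (hF d).
Qed.

Lemma deriv_at_vanish N' (w v : 'rV[C]_N') s p q : frac_at w s p q -> p.@[w 0] = 0 ->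
  deriv_at v w s ((pderiv v p).@[w 0] / q.@[w 0]).
Proof.
move=> hf p0; have q0 := frac_at_neq0 hf; case: hf => U [oU Uw hf].
exists U, p, q; split=> //; rewrite p0 mul0r subr0 expr2 invfM mulrA mulfK //.
Qed.

(** At a zero of the numerator the derivative does not depend on the fraction: differentiate the
    cross-multiplied identity. *)
Lemma deriv_at_val N' (w v : 'rV[C]_N') s p q c : frac_at w s p q -> p.@[w 0] = 0 ->
  deriv_at v w s c -> c = (pderiv v p).@[w 0] / q.@[w 0].
Proof.
move=> hf p0 [U [p' [q' [oU Uw hf' ->]]]]; have q0 := frac_at_neq0 hf.
have hf2 : frac_at w s p' q' by exists U.
have q0' := frac_at_neq0 hf2; have e := frac_at_uniq hf hf2.
have p0' : p'.@[w 0] = 0.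
  have /(congr1 (meval (w 0))) := e; rewrite !mevalM p0 mul0r => /esym/eqP.
  by rewrite mulf_eq0 (negbTE q0) orbF => /eqP.
rewrite p0' mul0r subr0 expr2 invfM mulrA mulfK //.
have /(congr1 (fun r => (pderiv v r).@[w 0])) := e.
rewrite !pderivM !mevalD !mevalM p0 p0' !mul0r !addr0 => e'.
by apply/eqP; rewrite eqr_div //; apply/eqP.
Qed.

Lemma frac_at_lsub w F P Q : frac_at (w *m iota) F P Q ->
  frac_at w (fun x => F (x *m iota)) (lsub iota P) (lsub iota Q).
Proof.
move=> hf; have [d [hP hQ]] := frac_at_homog hf.
have [U [oU Uw h]] := frac_at_open hf.
apply: (frac_atP (lsub_homog iota hP) (lsub_homog iota hQ)).
exists (fun x => U (x *m iota)); split=> //; first exact: popen_lsub.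
by move=> x /h; rewrite !meval_lsub.
Qed.

Lemma ideal_section_lsub U F : popen U -> is_ideal_section W U F ->
  is_ideal_section V (fun x => U (x *m iota)) (fun x => F (x *m iota)).
Proof.
move=> oU hF; split; last by move=> w /(extension_restr extW) Ww Uw; apply: hF.2.
apply: frac_section => w Uw; have [P [Q hf]] := section_frac oU Uw hF.1.
by exists (lsub iota P), (lsub iota Q); apply: frac_at_lsub.
Qed.

(** An equation of V is lifted to J and differentiated along [v]; the lift is irrelevant by
    [pderiv_restr0]. The degree drops by 1, which gives a section of N_V(-1). *)
Lemma exists_KS_section v : exists f, is_KS_section V iota W v f.
Proof.
pose Phi p (w : 'rV_n.+1) : C := if pselect (exists F, vanish W F /\ lsub iota F = p) is left h
  then (pderiv v (sval (cid h))).@[(w *m iota) 0] else 0.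
have PhiE F w : vanish W F -> V w -> Phi (lsub iota F) w = (pderiv v F).@[(w *m iota) 0].
  move=> WF Vw; rewrite /Phi; case: pselect => [h|[]]; last by exists F.
  case: (cid h) => F' [WF' e] /=; apply/eqP; rewrite -subr_eq0 -mevalB -pderivB.
  rewrite pderiv_restr0 //; first exact: (idealB (vanish_ideal W)).
  by rewrite lsubB e subrr.
have [D kD] := exists_equations fi.
have [] := @normal_section_of _ _ V 1 Phi vV.
- move=> d p w hp Vp Vw.
  have [F [hF WF FE]] := extension_lift_homog vV pnV ndV extW kD hp Vp.
  (* In degree 0 the result would have degree -1, so zero is written as 0 over a linear form. *)
  rewrite -FE; case: d hp hF => [|d] hp hF.
    have [c cw] := lform_neq0 (pclosed_neq0 cV Vw).
    exists 0%N, 1%N, 0, (lform c); split=> //; [exact: dhomog0|exact: lform_homog|by rewrite cw oner_eq0|].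
    by move=> x Vx _; rewrite PhiE // pderiv_homog0 // !meval0 mul0r.
  exists d, 0%N, (lsub iota (pderiv v F)), 1; split.
  - exact/lsub_homog/pderiv_homog.
  - exact: dhomog1.
  - by rewrite addn1.
  - by rewrite meval1 oner_eq0.
  - by move=> x Vx _; rewrite PhiE // meval1 divr1 meval_lsub.
- move=> a b c p1 p2 p3 V1 V2 V3 _ _ _ e w Vw.
  have [F1 [W1 E1]] := extension_lift V1; have [F2 [W2 E2]] := extension_lift V2.
  have [F3 [W3 E3]] := extension_lift V3.
  have [a' aE] := lsub_section extW a; have [b' bE] := lsub_section extW b.
  have [c' cE] := lsub_section extW c; have [v0 vD vM] := vanish_ideal W.
  have Ww : W (w *m iota) by apply/(extension_restr extW).
  rewrite -E1 -E2 -E3 !PhiE // -aE -bE -cE !meval_lsub.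
  have := @pderiv_restr0 v (c' * F3 - (a' * F1 + b' * F2)) w.
  rewrite !pderivB !pderivD !pderivM !mevalB !mevalD !mevalM W1 // W2 // W3 // !mulr0 !add0r.
  move=> h; apply/eqP; rewrite -subr_eq0 h //.
    by apply: (idealB (vanish_ideal W)); [apply: vM|apply: vD; apply: vM].
  by rewrite lsubB lsubD !lsubM aE bE cE E1 E2 E3 e subrr.
move=> f [nf fE]; exists f; split=> // U F w oU hF Vw Uw.
have [P [Q hPQ]] := section_frac oU Uw hF.1; have Ww : W (w *m iota) by apply/(extension_restr extW).
have WP := ideal_frac_vanish vW oU Uw Ww hF hPQ.
rewrite (fE _ _ w _ _ (popen_lsub fi oU) (ideal_section_lsub oU hF) Vw Uw (frac_at_lsub hPQ)).
by rewrite PhiE // meval_lsub; apply: deriv_at_vanish => //; apply: WP.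
Qed.

(** On the sections p / c^d, with c of value 1 at [w], a normal section takes at [w] the value at p
    of the corresponding homomorphism. *)
Definition test_open d (c : 'cV[C]_n.+1) : pset C n.+1 :=
  fun x => x != 0 /\ (lform c ^+ d).@[x 0] != 0.
Definition test_section d (c : 'cV[C]_n.+1) (p : {mpoly C[n.+1]}) : cfun C n.+1 :=
  fun x => p.@[x 0] / (lform c ^+ d).@[x 0].

Lemma lformX_homog N' d (c : 'cV[C]_N') : lform c ^+ d \is d.-homog.
Proof. by apply: homog_eq_deg (dhomogMn _ (lform_homog c)) _; rewrite mul1n. Qed.

Lemma KS_section_val v f d c F w : is_KS_section V iota W v f -> F \is d.-homog ->
  vanish W F -> V w -> (lform c).@[w 0] = 1 ->
  f (test_open d c) (test_section d c (lsub iota F)) w = (pderiv v F).@[(w *m iota) 0].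
Proof.
move=> [nf fE] hF WF Vw cw; pose q := lsub (pinvmx iota) (lform c ^+ d).
have qE : lsub iota q = lform c ^+ d by rewrite lsub_lsub mulmxVp // lsub_id.
have hq : q \is d.-homog by apply: lsub_homog; apply: lformX_homog.
have qw : q.@[(w *m iota) 0] = 1 by rewrite -meval_lsub qE rmorphXn /= cw expr1n.
have q0 : q.@[(w *m iota) 0] != 0 by rewrite qw oner_eq0.
have w0 := pclosed_neq0 cV Vw.
have A0 (x : 'rV_n.+1) : (x *m iota != 0) = (x != 0).
  by rewrite -(mul0mx _ iota) (inj_eq (row_free_inj fi)).
have hI := ratio_ideal_section hF hq WF.
have Uw : w *m iota != 0 /\ q.@[(w *m iota) 0] != 0 by rewrite A0.
have := fE _ _ w (popen_neq hq) hI Vw Uw.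
have -> : (fun x : 'rV_n.+1 => x *m iota != 0 /\ q.@[(x *m iota) 0] != 0) = test_open d c.
  by apply: funext => x; rewrite A0 -meval_lsub qE.
have -> : (fun x : 'rV_n.+1 => F.@[(x *m iota) 0] / q.@[(x *m iota) 0]) =
    test_section d c (lsub iota F).
  by apply: funext => x; rewrite /test_section -qE !meval_lsub.
have hf := frac_at_ratio hF hq q0 Uw.1.
move=> /(deriv_at_val hf)->; first by rewrite qw divr1.
exact/WF/(extension_restr extW).
Qed.

Lemma KS_of_section v f : is_KS_section V iota W v f -> KS V iota W v f.
Proof.
move=> hf; split; first by case: hf.
exists f, (fun _ _ _ => 0), 0; split=> //; last by move=> U s w *; rewrite addr0.
split; last first.
  move=> U s w oU hs Vw Uw; have [p [q [U' [oU' U'w h]]]] := section_frac oU Uw hs.1.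
  exists U', p, q; split=> //.
  have p0 r : pderiv (0 : 'rV[C]_n.+1) r = 0.
    by rewrite -[X in pderiv X _](scale0r (0 : 'rV[C]_n.+1)) pderivZl scale0r.
  by rewrite !p0 !meval0 mul0r mulr0 subrr mul0r.
split=> //; last by move=> U a b s t *; rewrite !mulr0 addr0.
move=> U s oU hs w Vw Uw; have w0 := pclosed_neq0 cV Vw; have [c cw] := lform_neq0 w0.
exists (fun x : 'rV_n.+1 => x != 0 /\ (lform c).@[x 0] != 0); split.
- exact: popen_neq (lform_homog c).
- by rewrite cw oner_eq0.
exists 0, (lform c), 0%N, 1%N; split=> //; [exact: dhomog0|exact: lform_homog|].
by move=> x [_ _ [_ ?]]; rewrite meval0 mul0r.
Qed.

Lemma tangent_section_val u t d c p w : is_tangent_section V u t -> p \is d.-homog ->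
  vanish V p -> V w -> (lform c).@[w 0] = 1 ->
  t (test_open d c) (test_section d c p) w = (pderiv u p).@[w 0].
Proof.
move=> [nt tE] hp Vp Vw cw; have hq := lformX_homog d c.
have qw : (lform c ^+ d).@[w 0] = 1 by rewrite rmorphXn /= cw expr1n.
have q0 : (lform c ^+ d).@[w 0] != 0 by rewrite qw oner_eq0.
have w0 := pclosed_neq0 cV Vw.
have := tE _ _ w (popen_neq hq) (ratio_ideal_section hp hq Vp) Vw (conj w0 q0).
have hf := frac_at_ratio hp hq q0 w0.
by move=> /(deriv_at_val hf)->; [rewrite qw divr1|apply: Vp].
Qed.

End One.

(* The first-order deformations of V in the directions v and v' agree. *)
Definition same_direction k k' (iota : 'M[C]_(n.+1, (n + k).+1)) W
    (iota' : 'M[C]_(n.+1, (n + k').+1)) W' v v' :=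
  forall d F F', F \is d.-homog -> F' \is d.-homog -> vanish W F -> vanish W' F' ->
    lsub iota F = lsub iota' F' -> forall w, V w ->
    (pderiv v F).@[(w *m iota) 0] = (pderiv v' F').@[(w *m iota') 0].

(** Kodaira-Spencer classes are cosets modulo Theta_H(-1); moving [v'] by a vector [u] of H absorbs
    the difference. *)
Lemma KS_same_direction k k' (iota : 'M[C]_(n.+1, (n + k).+1)) W
    (iota' : 'M[C]_(n.+1, (n + k').+1)) W' v v' f :
  extension V iota W -> extension V iota' W' ->
  is_KS_section V iota W v f -> KS V iota' W' v' f ->
  exists u, same_direction iota W iota' W' v (v' + u *m iota').
Proof.
move=> extW extW' hf [_ [f' [t [u [hf' ht fE]]]]]; exists u.
move=> d F F' hF hF' WF WF' e w Vw; have [c cw] := lform_neq0 (pclosed_neq0 cV Vw).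
rewrite -(KS_section_val extW hf hF WF Vw cw) pderivDl mevalD.
rewrite -(KS_section_val extW' hf' hF' WF' Vw cw).
have Vp := extension_vanish_lsub extW' WF'; have hp := lsub_homog iota' hF'.
rewrite -[X in _ + X]meval_lsub -pderiv_lsub -(tangent_section_val ht hp Vp Vw cw) e.
apply: fE => //; first exact: popen_neq (lformX_homog d c).
  exact: ratio_ideal_section hp (lformX_homog d c) Vp.
by split; [apply: pclosed_neq0 Vw|rewrite rmorphXn /= cw expr1n oner_eq0].
Qed.

Lemma same_direction_KS k (iota : 'M[C]_(n.+1, (n + k).+1)) W v v' h :
  extension V iota W -> same_direction iota W iota W v v' ->
  KS V iota W v h -> KS V iota W v' h.
Proof.
move=> extW sd [nh [f [t [u [[nf fE] ht hE]]]]]; split=> //; exists f, t, u; split=> //.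
split=> // U F w oU hF Vw Uw; have Ww : W (w *m iota) by apply/(extension_restr extW).
have vW : variety W by case: extW.
have [P [Q hPQ]] := section_frac oU Uw hF.1.
have WP := ideal_frac_vanish vW oU Uw Ww hF hPQ; have [d [hP _]] := frac_at_homog hPQ.
have /(deriv_at_val hPQ (WP _ Ww)) -> := fE U F w oU hF Vw Uw.
by rewrite (sd d P P) //; apply: deriv_at_vanish => //; apply: WP.
Qed.

End KodairaSpencer.

(** * One-parameter extensions *)

Section OneParameter.
Variables (C : closedFieldType) (n : nat) (V : pset C n.+1).
Hypotheses (vV : variety V) (no_sections : no_normal_sections V (-2)).
Local Notation M := (1 + n.+1)%N.

Let cV : pclosed V. Proof. by case: vV. Qed.

(* A section of N_V(-r), r > 2, becomes a section of N_V(-2) after multiplication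
   by the (r - 2)-nd power of any linear form. *)
Lemma negative_hom_eq0 r (Phi : {mpoly C[n.+1]} -> 'rV[C]_n.+1 -> C) :
  (1 < r)%N ->
  (forall d f w, f \is d.-homog -> vanish V f -> V w ->
     exists e e' (G Q : {mpoly C[n.+1]}), [/\ G \is e.-homog, Q \is e'.-homog,
       (e + r = e' + d)%N, Q.@[w 0] != 0 &
       forall x, V x -> Q.@[x 0] != 0 -> Phi f x = G.@[x 0] / Q.@[x 0]]) ->
  (forall a b c p1 p2 p3, vanish V p1 -> vanish V p2 -> vanish V p3 ->
     homogeneous p1 -> homogeneous p2 -> homogeneous p3 ->
     c * p3 = a * p1 + b * p2 -> forall w, V w ->
     c.@[w 0] * Phi p3 w = a.@[w 0] * Phi p1 w + b.@[w 0] * Phi p2 w) ->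
  forall d p w, p \is d.-homog -> vanish V p -> V w -> Phi p w = 0.
Proof.
move=> r1 H1 H2 d p w hp Vp Vw; have w0 := pclosed_neq0 cV Vw.
have [c cw] := lform_neq0 w0; pose L := lform c ^+ (r - 2).
have [] := @normal_section_of _ _ V 2 (fun p w => L.@[w 0] * Phi p w) vV.
- move=> d' f x hf Vf Vx; have [e [e' [G [Q [hG hQ ee Qx PhiE]]]]] := H1 d' f x hf Vf Vx.
  exists ((r - 2) + e)%N, e', (L * G), Q; split=> //.
  + by apply: dhomogM => //; apply: lformX_homog.
  + by rewrite -ee addnAC subnK // addnC.
  + by move=> y Vy Qy; rewrite PhiE // mevalM mulrA.
- move=> a b c' p1 p2 p3 V1 V2 V3 h1 h2 h3 e x Vx.
  rewrite mulrCA (H2 a b c' p1 p2 p3) //; ring.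
move=> f [nf fE]; have hq := lformX_homog d c.
have qw : (lform c ^+ d).@[w 0] = 1 by rewrite rmorphXn /= cw expr1n.
have q0 : (lform c ^+ d).@[w 0] != 0 by rewrite qw oner_eq0.
have hI := ratio_ideal_section hp hq Vp.
have := fE _ _ w p _ (popen_neq hq) hI Vw (conj w0 q0) (frac_at_ratio hp hq q0 w0).
rewrite (no_sections nf (popen_neq hq) hI Vw (conj w0 q0)) qw divr1.
by rewrite rmorphXn /= cw expr1n mul1r.
Qed.

(** The parameter tau, first of the 1 + (n + 1) coordinates; [par_dir] is the direction of d/dtau
    and [special] embeds the fibre tau = 0, a copy of H. *)
Definition par : {mpoly C[M]} := lform (col_mx 1 0).
Definition par_dir : 'rV[C]_M := row_mx 1 0.
Definition special : 'M[C]_(n.+1, M) := row_mx 0 1%:M.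

Lemma parX_homog r : par ^+ r \is r.-homog. Proof. exact: lformX_homog. Qed.

Lemma meval_par (c : 'rV_1) x : par.@[(row_mx c x : 'rV_M) 0] = c 0 0.
Proof. by rewrite meval_lform mul_row_col mulmx0 mulmx1 addr0. Qed.

Lemma meval_par_special (w : 'rV_n.+1) : par.@[(w *m special) 0] = 0.
Proof. by rewrite mul_mx_row mulmx0 meval_par mxE. Qed.

Lemma pderiv_par : pderiv par_dir par = 1.
Proof.
by rewrite pderiv_lform mul_row_col mulmx1 mul0mx addr0 mxE eqxx mpolyC1.
Qed.

Lemma special_section p : exists P, lsub special P = p.
Proof.
exists (lsub (col_mx 0 1%:M) p).
by rewrite lsub_lsub mul_row_col mul0mx mul1mx add0r lsub_id.
Qed.

Lemma special_eq0 P : lsub special P = 0 -> exists Q, P = par * Q.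
Proof.
move=> h; pose D : 'cV[C]_M := col_mx 1 0.
have ED : (row_mx 1 0 : 'rV[C]_M) *m D = 1%:M.
  by rewrite mul_row_col mulmx1 mul0mx addr0; apply/matrixP => i j; rewrite !ord1 !mxE.
have [] := @lspan_vanish _ _ _ D (row_mx 1 0) 1 P ED.
  move=> w /(_ ord0 erefl); rewrite -{1 2}[w]hsubmxK mul_row_col mulmx1 mulmx0 addr0 => w0.
  suff -> : row_mx (lsubmx w) (rsubmx w) = rsubmx w *m special by rewrite -meval_lsub h meval0.
  rewrite mul_mx_row mulmx0 mulmx1; congr row_mx.
  by apply/matrixP => i j; rewrite !ord1 w0 mxE.
move=> g ->; exists (g ord0); rewrite big_mkcond big_ord1 /=.
by rewrite (_ : col ord0 D = D) //; apply/colP => i; rewrite [LHS]mxE.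
Qed.

(* The homogeneous ideals of the one-parameter extensions of V, over C[tau]. *)
Definition deformation (J : {mpoly C[M]} -> Prop) :=
  [/\ is_ideal J, forall d p, J p -> J (pihomog mdeg d p),
      forall p, J p -> vanish V (lsub special p),
      forall p, vanish V p -> exists P, J P /\ lsub special P = p &
      forall p, J (par * p) -> J p].

Lemma deformation_parX J r p : deformation J -> J (par ^+ r * p) -> J p.
Proof.
move=> [_ _ _ _ h]; elim: r => [|r IH]; first by rewrite expr0 mul1r.
by rewrite exprS -mulrA => /h/IH.
Qed.

Lemma deformation_pderiv J P Q w : deformation J -> J P -> J Q ->
  lsub special P = lsub special Q -> V w ->
  (pderiv par_dir P).@[(w *m special) 0] = (pderiv par_dir Q).@[(w *m special) 0].
Proof.
move=> [iJ _ rJ _ nJ] JP JQ e Vw; apply/eqP; rewrite -subr_eq0 -mevalB -pderivB.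
have [R RE] : exists R, P - Q = par * R by apply: special_eq0; rewrite lsubB e subrr.
have JR : J R by apply: nJ; rewrite -RE; apply: idealB.
rewrite RE pderivM pderiv_par mul1r mevalD mevalM meval_par_special mul0r addr0.
by rewrite -meval_lsub rJ.
Qed.

Lemma deformation_homog J d p : deformation J -> p \is d.-homog -> vanish V p ->
  exists P, [/\ J P, P \is d.-homog & lsub special P = p].
Proof.
move=> [_ gJ _ lJ _] hp /lJ[P [JP PE]]; exists (pihomog mdeg d P); split.
- exact: gJ.
- exact: pihomogP.
- by rewrite -pihomog_lsub PE pihomog_dE.
Qed.

Section Unique.
Variables J J' : {mpoly C[M]} -> Prop.
Hypotheses (dJ : deformation J) (dJ' : deformation J').
Hypothesis first_order : forall d p, p \is d.-homog -> vanish V p ->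
  exists P P', [/\ J P, J' P', lsub special P = p, lsub special P' = p &
    forall w, V w ->
      (pderiv par_dir P).@[(w *m special) 0] = (pderiv par_dir P').@[(w *m special) 0]].

(** Membership in J' + (tau^r), that is, agreement to order r. *)
Let agree r P := exists P' Q, J' P' /\ P = P' + par ^+ r * Q.

Let agree_homog r : (forall d P, P \is d.-homog -> J P -> agree r P) ->
  forall P, J P -> agree r P.
Proof.
have [iJ gJ _ _ _] := dJ; have [[z aJ _] _ _ _ _] := dJ'.
move=> h P JP; rewrite (pihomog_partitionE (leqnn (mmeasure mdeg P))).
apply: (big_ind (agree r)); first by exists 0, 0; rewrite mulr0 addr0.
  move=> _ _ [P1 [Q1 [J1 ->]]] [P2 [Q2 [J2 ->]]]; exists (P1 + P2), (Q1 + Q2).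
  by split; [apply: aJ|rewrite mulrDr addrACA].
by move=> d _; apply: (h d); [apply: pihomogP|apply: gJ].
Qed.

(** A discrepancy whose leading coefficient restricts into I is absorbed: that coefficient lifts to
    J' up to a multiple of tau. *)
Let agree_step r P P' Q : J P -> J' P' -> P = P' + par ^+ r * Q ->
  vanish V (lsub special Q) -> agree r.+1 P.
Proof.
move=> JP JP' PE VQ; have [[_ aJ mJ] _ _ lJ _] := dJ'.
have [Q' [JQ' e]] := lJ _ VQ.
have [R RE] : exists R, Q - Q' = par * R by apply: special_eq0; rewrite lsubB e subrr.
exists (P' + par ^+ r * Q'), R; split; first by apply: aJ => //; apply: mJ.
by rewrite PE exprSr -mulrA -RE; ring.
Qed.

Let agree1 P : J P -> agree 1 P.
Proof.
have [_ _ rJ _ _] := dJ; have [_ _ _ lJ _] := dJ'.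
move=> JP; have [P' [JP' e]] := lJ _ (rJ _ JP).
have [R RE] : exists R, P - P' = par * R by apply: special_eq0; rewrite lsubB e subrr.
by exists P', R; split=> //; rewrite expr1 -RE addrCA subrr addr0.
Qed.

(** At tau = 0 the derivative of tau Q along tau is Q, so the first-order hypothesis says exactly
    that Q vanishes on V. *)
Let agree2 P : J P -> agree 2 P.
Proof.
have [_ _ rJ _ _] := dJ; have [_ _ _ lJ _] := dJ'.
apply: (agree_homog (r := 2)) => d {}P hP JP.
have [P' [Q [JP' PE]]] := agree1 JP; apply: (agree_step JP JP' PE) => w Vw.
have hp := lsub_homog special hP; have [P1 [P1' [J1 J1' e1 e1' he]]] := first_order hp (rJ _ JP).
have e : lsub special P' = lsub special P.
  rewrite PE lsubD lsubM; apply/esym/eqP; rewrite -subr_eq0 addrAC subrr add0r; apply/eqP.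
  by apply: mpoly_eval_inj => x; rewrite mevalM meval_lsub expr1 meval_par_special mul0r meval0.
have := he w Vw; rewrite (deformation_pderiv dJ J1 JP) ?e1 //.
rewrite (deformation_pderiv dJ' J1' JP') ?e1' ?e //.
rewrite PE expr1 pderivD pderivM pderiv_par mul1r !mevalD mevalM meval_par_special mul0r addr0.
by rewrite meval_lsub => /eqP; rewrite -subr_eq0 addrAC subrr add0r => /eqP.
Qed.

(** The order-r discrepancy, modulo I, depends only on the restriction to tau = 0: if X = tau Z,
    flatness puts Z in J, and agreement to order r for Z gains one more factor tau. *)
Let agree_restr0 r X X' Y : (forall P, J P -> agree r P) -> J X -> J' X' ->
  X - X' = par ^+ r * Y -> lsub special X = 0 -> vanish V (lsub special Y).
Proof.
have [_ _ _ _ nJ] := dJ; have [iJ' _ rJ' _ _] := dJ'.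
move=> ag JX JX' XE /special_eq0[Z ZE].
have [|Z' [H [JZ' ZE']]] := ag Z; first by apply: nJ; rewrite -ZE.
have : J' (par * H - Y).
  apply: (deformation_parX (r := r) dJ').
  rewrite (_ : _ * _ = X' - par * Z').
    by apply: idealB => //; have [_ _ mJ] := iJ'; apply: mJ.
  rewrite mulrBr -XE ZE ZE'; ring.
move=> /rJ' h w Vw; have := h w Vw; rewrite lsubB mevalB lsubM mevalM !meval_lsub.
by rewrite meval_par_special mul0r sub0r => /eqP; rewrite oppr_eq0 => /eqP.
Qed.

Let agreeS r : (1 < r)%N -> (forall P, J P -> agree r P) -> forall P, J P -> agree r.+1 P.
Proof.
move=> r1 ag; have [iJ gJ rJ lJ _] := dJ; have [iJ' gJ' _ _ _] := dJ'.
have [_ aJ mJ] := iJ; have [_ aJ' mJ'] := iJ'.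
(* The homomorphism I -> S/I of degree -r sends [p] to the restriction of any such [Q]. *)
pose rel p Q := exists P P', [/\ J P, J' P', lsub special P = p & P = P' + par ^+ r * Q].
pose Phi p (w : 'rV_n.+1) : C :=
  if pselect (exists Q, rel p Q) is left h then (sval (cid h)).@[(w *m special) 0] else 0.
have ex_rel p : vanish V p -> exists Q, rel p Q.
  move=> /lJ[P [JP PE]]; have [P' [Q [JP' e]]] := ag P JP.
  by exists Q, P, P'.
have rel_lin a b c p1 p2 p3 Q1 Q2 Q3 w : rel p1 Q1 -> rel p2 Q2 -> rel p3 Q3 ->
    c * p3 = a * p1 + b * p2 -> V w ->
    c.@[w 0] * Q3.@[(w *m special) 0] =
    a.@[w 0] * Q1.@[(w *m special) 0] + b.@[w 0] * Q2.@[(w *m special) 0].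
  move=> [P1 [P1' [J1 J1' E1 e1]]] [P2 [P2' [J2 J2' E2 e2]]] [P3 [P3' [J3 J3' E3 e3]]] e Vw.
  have [a' aE] := special_section a; have [b' bE] := special_section b.
  have [c' cE] := special_section c.
  have := @agree_restr0 r (c' * P3 - (a' * P1 + b' * P2)) (c' * P3' - (a' * P1' + b' * P2'))
    (c' * Q3 - (a' * Q1 + b' * Q2)) ag.
  have h1 : J (c' * P3 - (a' * P1 + b' * P2)).
    by apply: idealB => //; [apply: mJ|apply: (aJ); apply: (mJ)].
  have h2 : J' (c' * P3' - (a' * P1' + b' * P2')).
    by apply: idealB => //; [apply: mJ'|apply: (aJ'); apply: (mJ')].
  move=> /(_ h1 h2) h; apply/eqP; rewrite -subr_eq0.
  have := h _ _ w Vw; rewrite meval_lsub !mevalB !mevalD !mevalM -!meval_lsub aE bE cE => -> //.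
    by rewrite e1 e2 e3; ring.
  by rewrite lsubB lsubD !lsubM aE bE cE E1 E2 E3 e subrr.
have rel_fun p Q Q' w : rel p Q -> rel p Q' -> V w -> Q.@[(w *m special) 0] = Q'.@[(w *m special) 0].
  move=> h h' Vw; have := @rel_lin 1 0 1 p p p Q' Q' Q w h' h' h _ Vw.
  by rewrite mul0r addr0 meval1 meval0 !mul1r mul0r addr0; apply.
have PhiE p Q w : rel p Q -> V w -> Phi p w = Q.@[(w *m special) 0].
  move=> h Vw; rewrite /Phi; case: pselect => [h'|[]]; last by exists Q.
  by apply: (rel_fun p) => //; case: (cid h').
(* For homogeneous P the coefficient of tau^r can be taken of degree d - r, and zero when d < r. *)
have split_homog d P : P \is d.-homog -> J P -> exists P' Q, [/\ J' P', P = P' + par ^+ r * Q &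
    if (r <= d)%N then Q \is (d - r)%N.-homog else Q == 0].
  move=> hP JP; have [P' [Q [JP' PE]]] := ag P JP; have := pihomog_dE hP; rewrite PE raddfD /=.
  case: leqP => rd.
    rewrite -{2}(subnKC rd) (pihomog_homogM _ _ (parX_homog r)) => e.
    exists (pihomog mdeg d P'), (pihomog mdeg (d - r) Q); split; [exact: gJ'|by rewrite -e|].
    exact: pihomogP.
  rewrite (pihomog_homogM_lt _ (parX_homog r) rd) => e.
  by exists (pihomog mdeg d P'), 0; split=> //; [apply: gJ'|rewrite -e mulr0].
have Phi0 : forall d p w, p \is d.-homog -> vanish V p -> V w -> Phi p w = 0.
  apply: (@negative_hom_eq0 r Phi r1).
  - move=> d p w hp Vp Vw; have [P [JP hP PE]] := deformation_homog dJ hp Vp.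
    have [P' [Q [JP' e hQ]]] := split_homog d P hP JP.
    have relQ : rel p Q by exists P, P'.
    case: leqP hQ => rd hQ.
      exists (d - r)%N, 0%N, (lsub special Q), 1; split.
      + exact: lsub_homog.
      + exact: dhomog1.
      + by rewrite subnK.
      + by rewrite meval1 oner_eq0.
      + by move=> x Vx _; rewrite (PhiE p Q) // meval1 divr1 meval_lsub.
    have [c cw] := lform_neq0 (pclosed_neq0 cV Vw).
    exists 0%N, (r - d)%N, 0, (lform c ^+ (r - d)); split.
    + exact: dhomog0.
    + exact: lformX_homog.
    + by rewrite subnK // ltnW.
    + by rewrite rmorphXn /= cw expr1n oner_eq0.
    + by move=> x Vx _; rewrite (PhiE p Q) // (eqP hQ) !meval0 mul0r.
  - move=> a b c p1 p2 p3 /ex_rel[Q1 h1] /ex_rel[Q2 h2] /ex_rel[Q3 h3] _ _ _ e w Vw.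
    by rewrite (PhiE p1 Q1) // (PhiE p2 Q2) // (PhiE p3 Q3) //; apply: rel_lin h1 h2 h3 e Vw.
apply: (agree_homog (r := r.+1)) => d P hP JP; have [P' [Q [JP' PE]]] := ag P JP.
apply: (agree_step JP JP' PE) => w Vw; rewrite meval_lsub.
have relQ : rel (lsub special P) Q by exists P, P'.
by rewrite -(PhiE (lsub special P)) // (Phi0 d) //; [apply: lsub_homog|apply: rJ].
Qed.

(** In degree d a multiple of tau^(d+2) has no component, so agreement to order d + 2 is membership
    in J'. *)
Lemma deformation_unique P : J P -> J' P.
Proof.
have ag r : forall P, J P -> agree r.+2 P.
  by elim: r => [|r IH]; [apply: agree2|apply: agreeS].
have [[_ aJ' _] gJ' _ _ _] := dJ'; have [iJ gJ _ _ _] := dJ.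
move=> JP; rewrite (pihomog_partitionE (leqnn (mmeasure mdeg P))).
apply: ideal_sum => [|d _]; first by case: dJ'.
have hd : pihomog mdeg d P \is d.-homog by apply: pihomogP.
have [P' [Q [JP' PE]]] := ag d _ (gJ d _ JP).
rewrite -(pihomog_dE hd) PE raddfD /= (pihomog_homogM_lt _ (parX_homog d.+2)) ?addr0 //.
exact: gJ'.
Qed.
End Unique.

(** The family of a direction [u] inside H: the cone over V with vertex (1, -u), the pull-back of V
    under (c, x) |-> x + c u. *)
Lemma trivial_deformation (u : 'rV[C]_n.+1) :
  deformation (vanish (fun y => exists c w, V w /\ y = row_mx c (w - c *m u))).
Proof.
have coV := pclosed_cone cV; split.
- exact: vanish_ideal.
- move=> d p; apply: vanish_pihomog => y c c0 [b [w [Vw ->]]].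
  exists (c *: b), (c *: w); split; first exact: coV.
  by rewrite scale_row_mx scalerBr scalemxAl.
- move=> p hp w Vw; rewrite meval_lsub; apply: hp; exists 0, w; split=> //.
  by rewrite mul_mx_row mulmx0 mulmx1 mul0mx subr0.
- move=> p Vp; exists (lsub (col_mx u 1%:M) p); split.
    move=> _ [c [w [Vw ->]]].
    by rewrite meval_lsub mul_row_col mulmx1 addrCA subrr addr0 Vp.
  by rewrite lsub_lsub mul_row_col mul0mx mul1mx add0r lsub_id.
move=> p hp _ [c [w [Vw ->]]].
(* On the plane spanned by (1, -u) and (0, w), with coordinates a and b, the hypothesis gives a b p
   = 0, whence p = 0 there, including at tau = 0. *)
pose A : 'M[C]_(1 + 1, M) := col_mx (row_mx 1 (- u)) (row_mx 0 w).
have AE (a b : 'rV[C]_1) : (row_mx a b : 'rV_(1 + 1)) *m A = row_mx a (b *m w - a *m u).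
  by rewrite /A mul_row_col !mul_mx_row mulmx1 mulmx0 mulmxN add_row_mx addr0 [_ + b *m w]addrC.
suff /(congr1 (fun q : {mpoly C[1 + 1]} => q.@[(row_mx c 1 : 'rV_(1 + 1)) 0])) : lsub A p = 0.
  by rewrite meval_lsub AE mul1mx meval0.
suff /eqP : lsub A p * (lform (col_mx 1 0 : 'cV[C]_(1 + 1)) * lform (col_mx 0 1 : 'cV[C]_(1 + 1))) = 0.
  rewrite !mulf_eq0 => /or3P[/eqP//|/eqP|/eqP] /(congr1 (fun q : {mpoly C[1 + 1]} => q.@[(row_mx 1 1 : 'rV_(1 + 1)) 0])).
    by rewrite meval0 meval_lform mul_row_col mulmx1 mulmx0 addr0 mxE eqxx => /eqP; rewrite oner_eq0.
  by rewrite meval0 meval_lform mul_row_col mulmx1 mulmx0 add0r mxE eqxx => /eqP; rewrite oner_eq0.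
apply: mpoly_eval_eq0 => y; rewrite -[y]hsubmxK !mevalM meval_lsub AE !meval_lform !mul_row_col.
set a := lsubmx y; set b := rsubmx y; rewrite !mulmx1 !mulmx0 addr0 add0r mulrA.
have [->|b0] := eqVneq (b 0 0) 0; first by rewrite mulr0.
have := hp (row_mx a (b *m w - a *m u)); rewrite mevalM meval_par mulrC => ->; first by rewrite mul0r.
exists a, (b *m w); split=> //; rewrite [b]mx11_scalar mul_scalar_mx; exact: coV.
Qed.

End OneParameter.

(** * Comparison of extensions *)

Section Main.
Variables (C : closedFieldType) (n : nat) (V : pset C n.+1).
Hypotheses (vV : variety V) (pnV : projectively_normal V) (ndV : nondegenerate_pset V).
Hypothesis no_sections : no_normal_sections V (-2).

Let cV : pclosed V. Proof. by case: vV. Qed.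

(** Needed for points that a linear map sends to 0, which lie outside the punctured cone; in degree
    0 the nonemptiness of W forces the vanishing. *)
Lemma vanish_homog0 N d (W : pset C N) F : variety W -> F \is d.-homog -> vanish W F ->
  F.@[(0 : 'rV_N) 0] = 0.
Proof.
move=> [_ [[w Ww] _]] hF /(_ w Ww) Fw.
by rewrite -(scale0r w) (meval_homogZ _ _ hF) Fw mulr0.
Qed.

Lemma special_col_mx k (v : 'rV[C]_(n + k).+1) (iota : 'M[C]_(n.+1, (n + k).+1)) :
  special C n *m col_mx v iota = iota.
Proof. by rewrite mul_row_col mul0mx mul1mx add0r. Qed.

(** The section of W by the span of H and [v], with ideal the image of J. In adapted equations the
    last one restricts to tau and the others to 0, so flatness is the regularity of the last
    equation. *)
Lemma section_deformation k (iota : 'M[C]_(n.+1, (n + k).+1)) W v :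
  extension V iota W -> ~~ (v <= iota)%MS ->
  deformation V (fun P => exists F, vanish W F /\ P = lsub (col_mx v iota) F).
Proof.
move=> extW vi; have [fi vW _ _ _] := extW.
set B := col_mx v iota; have [v0 vD vM] := vanish_ideal W.
have fB : row_free B.
  have [i0 [D [_ kD vDE]]] := exists_equations_last fi vi.
  have iD : iota *m D = 0 by apply/sub_kermxP; rewrite kD.
  apply: inj_row_free => x; rewrite -[x]hsubmxK mul_row_col.
  move: (lsubmx x) (rsubmx x) => a b; rewrite [a]mx11_scalar mul_scalar_mx => ab0.
  have /rowP/(_ i0) := congr1 (mulmx^~ D) ab0.
  rewrite /= mulmxDl -mulmxA iD mulmx0 addr0 -scalemxAl vDE mul0mx !mxE !eqxx mulr1 => a0.
  move: ab0; rewrite a0 scale0r add0r => b0.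
  have -> : b = 0 by apply: (row_free_inj fi); rewrite b0 mul0mx.
  by rewrite (_ : 0%:M = 0) ?row_mx0 //; apply/matrixP => i j; rewrite !mxE mul0rn.
have [i0 [D [i0k kD vDE]]] := exists_equations_last fi vi.
have iD : iota *m D = 0 by apply/sub_kermxP; rewrite kD.
have BD : B *m D = col_mx (delta_mx 0 i0) 0 by rewrite mul_col_mx vDE iD.
split.
- split=> [|_ _ [F [WF ->]] [G [WG ->]]|p _ [F [WF ->]]].
  + by exists 0; rewrite lsub0.
  + by exists (F + G); rewrite lsubD; split=> //; apply: vD.
  + exists (lsub (pinvmx B) p * F); rewrite lsubM lsub_lsub mulmxVp // lsub_id.
    by split=> //; apply: vM.
- move=> d _ [F [WF ->]]; exists (pihomog mdeg d F); rewrite pihomog_lsub; split=> //.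
  by apply: vanish_pihomog => //; apply: pclosed_cone; case: vW.
- move=> _ [F [WF ->]]; rewrite lsub_lsub special_col_mx.
  exact: (extension_vanish_lsub extW).
- move=> p Vp; have [F [WF FE]] := extension_lift vV pnV ndV extW Vp.
  exists (lsub B F); split; first by exists F.
  by rewrite lsub_lsub special_col_mx.
move=> G [F [WF GE]]; pose G' := lsub (pinvmx B) G.
have G'E : lsub B G' = G by rewrite lsub_lsub mulmxVp // lsub_id.
have tB : lsub B (lform (col i0 D)) = par C n.
  rewrite lsub_lform /par; congr lform.
  have -> : B *m col i0 D = col i0 (B *m D) by rewrite !colE mulmxA.
  rewrite BD; apply/matrixP => i j; rewrite !ord1 [LHS]mxE.
  case: (split_ordP i) => i' ->; last by rewrite !col_mxEd !mxE.
  by rewrite !col_mxEu !mxE !ord1 !eqxx.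
(* Where the equations before the last vanish, the point is in the span of [v] and H; there the
   difference pulls back to tau G - tau G. *)
have : eqideal W D i0 (lform (col i0 D) * G').
  exists F; split=> //; apply: (lspan_vanish (equations_row_full extW kD)) => w wD.
  pose c := (w *m D) 0 i0.
  have wE : (w - c *: v) *m D = 0.
    rewrite mulmxBl -scalemxAl vDE; apply/rowP => j; rewrite !mxE eqxx /=.
    have [->|ne] := eqVneq j i0; first by rewrite mulr1 -[X in X - _]/(\sum_j _) /c mxE subrr.
    rewrite mulr0 subr0; have := wD j; rewrite mxE; apply.
    by rewrite ltn_neqAle val_eqE ne -ltnS i0k ltn_ord.
  have [u uE] := kermx_iota kD wE.
  have -> : w = row_mx c%:M u *m B.
    by rewrite mul_row_col mul_scalar_mx -uE addrCA subrr addr0.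
  by rewrite -meval_lsub lsubB lsubM tB G'E GE subrr meval0.
move=> /(eqideal_regular vV pnV ndV extW kD)[F1 [WF1 [h hE]]].
exists F1; split=> //; rewrite -G'E -[G'](subrK F1) hE lsubD lsub_sum big1 ?add0r // => j lt.
rewrite lsubM (_ : lsub B (lform (col j D)) = 0) ?mul0r //.
rewrite lsub_lform (_ : B *m col j D = 0); last first.
  have -> : B *m col j D = col j (B *m D) by rewrite !colE mulmxA.
  rewrite BD; apply/matrixP => i j'; rewrite !ord1 [LHS]mxE.
  case: (split_ordP i) => i' ->; last by rewrite !col_mxEd !mxE.
  have ne : (j == i0) = false by apply/negbTE; rewrite -val_eqE /= (ltn_eqF lt).
  by rewrite !col_mxEu !mxE ne andbF.
by rewrite /lform big1 // => i _; rewrite mxE scale0r.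
Qed.

(** If [v] lies in H it spans nothing new, and the trivial family replaces the section of W; only
    [v'] has to be outside H'. *)
Lemma deformation_agree k k' (iota : 'M[C]_(n.+1, (n + k).+1)) W
    (iota' : 'M[C]_(n.+1, (n + k').+1)) W' v v' F :
  extension V iota W -> extension V iota' W' ->
  same_direction V iota W iota' W' v v' -> ~~ (v' <= iota')%MS -> vanish W F ->
  exists F', vanish W' F' /\ lsub (col_mx v iota) F = lsub (col_mx v' iota') F'.
Proof.
move=> extW extW' sd vi WF; have [fi vW _ _ _] := extW; have [fi' vW' _ _ _] := extW'.
have [J [dJ hJ]] : exists J, deformation V J /\ forall G, vanish W G -> J (lsub (col_mx v iota) G).
  have [/submxP[u uE]|vi'] := boolP (v <= iota)%MS.
    exists (vanish (fun y => exists c w, V w /\ y = row_mx c (w - c *m u))).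
    split; first exact: trivial_deformation.
    move=> G WG _ [c [w [Vw ->]]].
    rewrite meval_lsub mul_row_col mulmxBl uE mulmxA addrCA subrr addr0.
    exact/WG/(extension_restr extW).
  exists (fun P => exists F, vanish W F /\ P = lsub (col_mx v iota) F).
  by split; [apply: section_deformation|move=> G WG; exists G].
have dJ' := section_deformation extW' vi.
apply: (deformation_unique vV no_sections dJ dJ' _ (hJ F WF)) => d p hp Vp.
have [D kD] := exists_equations fi; have [D' kD'] := exists_equations fi'.
have [G [hG WG GE]] := extension_lift_homog vV pnV ndV extW kD hp Vp.
have [G' [hG' WG' GE']] := extension_lift_homog vV pnV ndV extW' kD' hp Vp.
exists (lsub (col_mx v iota) G), (lsub (col_mx v' iota') G'); split.
- exact: hJ.
- by exists G'.
- by rewrite lsub_lsub special_col_mx.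
- by rewrite lsub_lsub special_col_mx.
move=> w Vw; rewrite !pderiv_lsub /par_dir !mul_row_col !mul1mx !mul0mx !addr0.
rewrite !meval_lsub -!mulmxA !special_col_mx; apply: (sd d) => //.
by rewrite GE GE'.
Qed.

(** Equations of W pulled back by A vanish on W' by comparing families along each point of W'.
    Conversely let F be an equation of W' and lift its restriction to H to an equation G of W. Then
    F - G o A restricts to 0, hence is a sum of t_j g_j with g_j in J' of smaller degree, and
    induction on the degree applies. *)
Lemma extension_pullback k k' (iota : 'M[C]_(n.+1, (n + k).+1)) W
    (iota' : 'M[C]_(n.+1, (n + k').+1)) W' A :
  extension V iota W -> extension V iota' W' -> iota' *m A = iota ->
  (forall v', same_direction V iota W iota' W' (v' *m A) v') ->
  forall w, W' w <-> w != 0 /\ (w *m A = 0 \/ W (w *m A)).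
Proof.
move=> extW extW' iA sd; have [fi vW _ _ _] := extW; have [fi' vW' _ _ _] := extW'.
have cW : pclosed W by case: vW. have cW' : pclosed W' by case: vW'.
have pb F w : vanish W F -> W' w -> F.@[(w *m A) 0] = 0.
  move=> WF Ww; have [/submxP[x xE]|wi] := boolP (w <= iota')%MS.
    rewrite xE -mulmxA iA; apply: WF; apply/(extension_restr extW).
    by apply/(extension_restr extW'); rewrite -xE.
  have [F' [WF' e]] := deformation_agree extW extW' (sd w) wi WF.
  (* The point (1, 0) of the family is [w] on the side of W' and [w *m A] on the side of W. *)
  have := congr1 (fun p : {mpoly C[1 + n.+1]} => p.@[(row_mx 1 0 : 'rV_(1 + n.+1)) 0]) e.
  by rewrite !meval_lsub !mul_row_col !mul1mx !mul0mx !addr0 => ->; apply: WF'.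
move=> w; split=> [Ww|[w0 wA]].
  split; first exact: pclosed_neq0 Ww.
  have [->|wA] := eqVneq (w *m A) 0; first by left.
  by right; apply/(pclosed_vanishP _ cW); split=> // F WF; apply: pb.
apply/(pclosed_vanishP _ cW'); split=> // F.
suff aux d : forall F, F \is d.-homog -> vanish W' F -> F.@[w 0] = 0.
  move=> WF; rewrite (pihomog_partitionE (leqnn (mmeasure mdeg F))) raddf_sum /=.
  rewrite big1 // => d _; apply: (aux d); first exact: pihomogP.
  by apply: vanish_pihomog => //; apply: pclosed_cone.
elim: d {F} => [|d IH] F hF WF.
  have [[x Wx] _] := vW'.2; have := WF x Wx.
  by rewrite (homog0_const hF) !mevalC.
have [D kD] := exists_equations fi; have [D' kD'] := exists_equations fi'.
have [G [hG WG GE]] := extension_lift_homog vV pnV ndV extW kD (lsub_homog iota' hF)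
  (extension_vanish_lsub extW' WF).
pose R := F - lsub A G; have hR : R \is (1 + d).-homog.
  by apply: rpredB => //; apply: lsub_homog.
have WR : vanish W' R.
  by move=> x Wx; rewrite mevalB (WF x Wx) meval_lsub pb ?subr0.
have R0 : lsub iota' R = 0 by rewrite lsubB lsub_lsub iA GE subrr.
have [g [Wg RE]] := vanish_restr0 vV pnV ndV extW' kD' WR R0.
have -> : F = R + lsub A G by rewrite subrK.
rewrite mevalD meval_lsub [G.@[_]](_ : _ = 0) ?addr0; last first.
  by case: wA => [->|/WG//]; apply: (vanish_homog0 vW hG).
clearbody R; move: (pihomog_dE hR); rewrite {1}RE raddf_sum => <- /=.
rewrite raddf_sum /= big1 // => j _.
rewrite (pihomog_homogM _ _ (lform_homog _)) mevalM [X in _ * X]IH ?mulr0 //; first exact: pihomogP.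
by apply: vanish_pihomog => //; apply: pclosed_cone.
Qed.

Lemma same_direction_sym k k' (iota : 'M[C]_(n.+1, (n + k).+1)) W
    (iota' : 'M[C]_(n.+1, (n + k').+1)) W' v v' :
  same_direction V iota W iota' W' v v' -> same_direction V iota' W' iota W v' v.
Proof. by move=> sd d F F' hF hF' WF WF' e w Vw; apply/esym/(sd d). Qed.

Lemma same_directionD k k' (iota : 'M[C]_(n.+1, (n + k).+1)) W
    (iota' : 'M[C]_(n.+1, (n + k').+1)) W' v v' a u u' :
  same_direction V iota W iota' W' v v' -> same_direction V iota W iota' W' u u' ->
  same_direction V iota W iota' W' (v + a *: u) (v' + a *: u').
Proof.
move=> sv su d F F' hF hF' WF WF' e w Vw; rewrite !pderivDl !pderivZl !mevalD !mevalZ.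
by rewrite (sv d F F') // (su d F F').
Qed.

Lemma same_direction_iota k k' (iota : 'M[C]_(n.+1, (n + k).+1)) W
    (iota' : 'M[C]_(n.+1, (n + k').+1)) W' x :
  same_direction V iota W iota' W' (x *m iota) (x *m iota').
Proof.
move=> d F F' _ _ _ _ e w Vw.
by rewrite -!meval_lsub -!pderiv_lsub e.
Qed.

Lemma same_direction_mulmx k k' (iota : 'M[C]_(n.+1, (n + k).+1)) W
    (iota' : 'M[C]_(n.+1, (n + k').+1)) W' A :
  (forall i, same_direction V iota W iota' W' (row i A) (delta_mx 0 i)) ->
  forall v, same_direction V iota W iota' W' (v *m A) v.
Proof.
move=> h v; rewrite [X in same_direction _ _ _ _ _ _ X]row_sum_delta mulmx_sum_row.
apply: (big_ind2 (fun x y => same_direction V iota W iota' W' x y)).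
- by have := @same_direction_iota k k' iota W iota' W' 0; rewrite !mul0mx.
- move=> x1 x2 y1 y2 h1 h2; have := same_directionD 1 h1 h2; by rewrite !scale1r.
- move=> i _; have := @same_direction_iota k k' iota W iota' W' 0; rewrite !mul0mx => h0.
  by have := same_directionD (v 0 i) h0 (h i); rewrite !add0r.
Qed.

(* Corrects A so that it carries H' to H compatibly with the embeddings. *)
Lemma same_direction_adjust k k' (iota : 'M[C]_(n.+1, (n + k).+1)) W
    (iota' : 'M[C]_(n.+1, (n + k').+1)) W' A :
  (forall v, same_direction V iota W iota' W' (v *m A) v) ->
  forall v, same_direction V iota W iota' W'
    (v *m (pinvmx iota' *m iota + (1%:M - pinvmx iota' *m iota') *m A)) v.
Proof.
move=> h v; move: (pinvmx iota') => r.
have := same_directionD 1 (@same_direction_iota k k' iota W iota' W' (v *m r))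
  (h (v *m (1%:M - r *m iota'))).
rewrite !scale1r (_ : v *m r *m iota' + _ = v); last first.
  by rewrite mulmxBr mulmx1 mulmxA addrC subrK.
by rewrite [in X in _ -> X]mulmxDr !mulmxA.
Qed.

(** Each basis direction agrees to first order with itself corrected by a vector of H; the
    corrections assemble into A, adjusted to be the identity on H. *)
Theorem same_KS_iso k (iota : 'M[C]_(n.+1, (n + k).+1)) W W' :
  extension V iota W -> extension V iota W' -> same_KS V iota W W' ->
  extension_iso V iota W iota W'.
Proof.
move=> extW extW' sKS; have fi : row_free iota by case: extW.
have hi (i : 'I_(n + k).+1) : exists u, same_direction V iota W iota W' (delta_mx 0 i) (delta_mx 0 i + u *m iota).
  have [f hf] := exists_KS_section vV pnV ndV extW (delta_mx 0 i).
  apply: (KS_same_direction vV extW extW' hf).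
  by apply/sKS; apply: KS_of_section.
have [u hu] := choice hi; pose U := \matrix_i u i.
have sd v : same_direction V iota W' iota W (v *m (1%:M + U *m iota)) v.
  apply: same_direction_mulmx => i; apply: same_direction_sym.
  rewrite (_ : row i _ = delta_mx 0 i + u i *m iota); first exact: hu.
  by rewrite linearD /= row1 row_mul rowK.
have {}sd := same_direction_adjust sd; have := mulmxVp fi.
move: (pinvmx iota) sd => r sd rI.
set A := (X in forall v, same_direction _ _ _ _ _ (v *m X) _) in sd.
have iA : iota *m A = iota.
  by rewrite mulmxDr !mulmxA rI mul1mx mulmxBr mulmx1 mulmxA rI mul1mx subrr mul0mx addr0.
(* A differs from the identity by a map into H that kills H; its square is 0, so A is invertible. *)
pose N := (1%:M - r *m iota) *m U *m iota.
have AE : A = 1%:M + N.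
  by rewrite /A mulmxDr mulmx1 addrA [r *m iota + _]addrC subrK /N mulmxA.
have NN : N *m N = 0.
  rewrite {1}/N -!mulmxA (_ : iota *m N = 0) ?mulmx0 //.
  by rewrite /N !mulmxA mulmxBr mulmx1 mulmxA rI mul1mx subrr !mul0mx.
have uA : A \in unitmx.
  have /mulmx1_unit[] // : A *m (1%:M - N) = 1%:M.
  by rewrite AE mulmxDl mul1mx mulmxBr mulmx1 NN subr0 subrK.
have pb := extension_pullback extW' extW iA sd.
have cW' : pclosed W' by case: extW' => _ [].
exists A; split=> //; first by rewrite iA.
  move=> x; rewrite pb; split=> [[x0 [xA|//]]|Wx].
    by case/eqP: x0; rewrite -(mulmxK uA x) xA mul0mx.
  split; last by right.
  by apply: contraTneq (pclosed_neq0 cW' Wx) => ->; rewrite mul0mx eqxx.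
by move=> w Vw; exists 1; rewrite ?oner_eq0 // scale1r -mulmxA iA.
Qed.

End Main.

(** * Universal extensions *)

Section Universal.
Variables (C : closedFieldType) (n : nat) (V : pset C n.+1).
Hypotheses (vV : variety V) (pnV : projectively_normal V) (ndV : nondegenerate_pset V).
Hypothesis no_sections : no_normal_sections V (-2).

Let cV : pclosed V. Proof. by case: vV. Qed.

(* The eigenvalue is a regular function on V, hence constant. *)
Lemma eigen_scalar (M : 'M[C]_n.+1) :
  (forall w, V w -> exists c, w *m M = c *: w) -> exists c, M = c%:M.
Proof.
move=> h; pose s (w : 'rV[C]_n.+1) : C :=
  if pselect (exists c, w *m M = c *: w) is left e then sval (cid e) else 0.
have sE w : V w -> w *m M = s w *: w.
  by move=> /h hw; rewrite /s; case: pselect => // e; apply: (svalP (cid e)).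
have /pnV[p [/homog0_const pE hp]] : is_section V pspace 0%N%:Z s.
  move=> w Vw w0; have [c cw] := lform_neq0 w0.
  exists (fun x : 'rV_n.+1 => x != 0 /\ (lform c).@[x 0] != 0); split.
  - exact: popen_neq (lform_homog c).
  - by rewrite cw oner_eq0.
  exists (lform (M *m c)), (lform c), 1%N, 1%N; split=> //; try exact: lform_homog.
  move=> x [Vx _ [_ cx]]; split=> //; rewrite !meval_lform mulmxA sE // -scalemxAl mxE.
  by rewrite -meval_lform mulfK.
pose c := p.@[(0 : 'rV_n.+1) 0].
have sc w : V w -> s w = c by move=> Vw; rewrite hp // pE mevalC.
exists c; apply/eqP; rewrite -subr_eq0; apply/eqP/matrixP => i j; rewrite [RHS]mxE.
have -> : (M - c%:M) i j = (col j (M - c%:M)) i 0 by rewrite [RHS]mxE.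
rewrite (ndV (a := col j _)) ?mxE // => w Vw.
by rewrite colE mulmxA mulmxBr mul_mx_scalar sE // sc // subrr mul0mx.
Qed.

Lemma same_direction_trans k k' (iota : 'M[C]_(n.+1, (n + k).+1)) W
    (iota' : 'M[C]_(n.+1, (n + k').+1)) W' v1 v2 v' :
  extension V iota W -> extension V iota' W' ->
  same_direction V iota W iota' W' v1 v' -> same_direction V iota W iota' W' v2 v' ->
  same_direction V iota W iota W v1 v2.
Proof.
move=> extW extW' s1 s2 d F F' hF hF' WF WF' e w Vw.
have [fi' _ _ _ _] := extW'; have [D' kD'] := exists_equations fi'.
have [G [hG WG GE]] := extension_lift_homog vV pnV ndV extW' kD' (lsub_homog iota hF)
  (extension_vanish_lsub extW WF).
by rewrite (s1 d F G) // (s2 d F' G) // -e.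
Qed.

(** Surjectivity of KS supplies, for each basis vector on the side of W', a direction on the side of
    W with the same class. *)
Lemma universal_direction k m (iota : 'M[C]_(n.+1, (n + k).+1)) W
    (iota' : 'M[C]_(n.+1, (n + m).+1)) W' :
  extension V iota W -> extension V iota' W' ->
  (forall h, is_normal_section V (-1) h -> exists v, KS V iota W v h) ->
  exists A, iota' *m A = iota /\ forall v, same_direction V iota W iota' W' (v *m A) v.
Proof.
move=> extW extW' surj; have fi' : row_free iota' by case: extW'.
have hi (i : 'I_(n + m).+1) : exists v, same_direction V iota W iota' W' v (delta_mx 0 i).
  have [f hf] := exists_KS_section vV pnV ndV extW' (delta_mx 0 i).
  have [v hv] := surj f hf.1; have [u hu] := KS_same_direction vV extW' extW hf hv.
  by exists (v + u *m iota); apply: same_direction_sym.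
have [u hu] := choice hi.
have sd : forall v, same_direction V iota W iota' W' (v *m \matrix_i u i) v.
  by apply: same_direction_mulmx => i; rewrite rowK.
exists (pinvmx iota' *m iota + (1%:M - pinvmx iota' *m iota') *m \matrix_i u i).
split; last exact: same_direction_adjust.
have := mulmxVp fi'; move: (pinvmx iota') => r rI.
by rewrite mulmxDr !mulmxA rI mul1mx mulmxBr mulmx1 mulmxA rI mul1mx subrr mul0mx addr0.
Qed.

(** L is the image of A and the vertex is its kernel; a section of A over L places the base of the
    cone. *)
Lemma pullback_cone k m (iota : 'M[C]_(n.+1, (n + k).+1)) W
    (iota' : 'M[C]_(n.+1, (n + m).+1)) (W' : pset C (n + m).+1) A (L : {vspace 'rV[C]_(n + k).+1}) :
  row_free iota -> cone W -> (exists w, V w) -> (forall w, V w -> W (w *m iota)) ->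
  iota' *m A = iota -> (forall v, (v \in L) = (v <= A)%MS) ->
  (forall w, W' w <-> w != 0 /\ (w *m A = 0 \/ W (w *m A))) ->
  exists l (kappa : 'M[C]_(n.+1, (n + l).+1)) X,
    sub_extension iota W L kappa X /\ cone_extension kappa X iota' W'.
Proof.
move=> fi coW [w0 Vw0] WV iA LA W'E.
have iA' : (iota <= A)%MS by rewrite -iA submxMl.
have [l rA] : exists l, \rank A = (n + l).+1.
  have := mxrankS iA'; rewrite (eqP fi) => le; exists (\rank A - n.+1)%N.
  by move: (\rank A) le => r le; rewrite -addSn subnKC.
have [B fB BA] : exists2 B : 'M_((n + l).+1, (n + k).+1), row_free B & (B :=: A)%MS.
  exists (castmx (rA, erefl) (row_base A)); first by rewrite row_free_castmx row_base_free.
  by apply: eqmx_trans (eqmx_cast _ _) (eq_row_base A).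
have iB : (iota <= B)%MS by rewrite BA.
have [kappa kB] : exists kappa, kappa *m B = iota by exists (iota *m pinvmx B); rewrite mulmxKpV.
have fk : row_free kappa.
  rewrite /row_free eqn_leq rank_leq_row /= -{1}(eqP fi) -{1}kB.
  exact: mxrankM_maxl.
have [j0 j0A] : exists j0, j0 *m A = B by exists (B *m pinvmx A); rewrite mulmxKpV // BA.
have [r kr] : exists r, kappa *m r = 1%:M by exists (pinvmx kappa); rewrite mulmxVp.
(* The correction to the section [j0] has values in the kernel of A and makes [j] carry [kappa] to
   [iota']. *)
pose j := j0 + r *m (iota' - kappa *m j0).
have jA : j *m A = B.
  by rewrite mulmxDl j0A -mulmxA mulmxBl iA -mulmxA j0A kB subrr mulmx0 addr0.
have kj : kappa *m j = iota'.
  by rewrite mulmxDr mulmxA kr mul1mx addrC subrK.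
exists l, kappa, (fun v => W (v *m B)); split.
  by exists B; split=> // v; rewrite LA BA.
clearbody j; have fj : row_free j.
  rewrite /row_free eqn_leq rank_leq_row /= -{1}(eqP fB) -{1}jA.
  exact: mxrankM_maxl.
exists j, (kermx A); split=> //.
  split.
    apply/eqP/rowV0P => v; rewrite sub_capmx => /andP[/submxP[x ->] /sub_kermxP].
    by rewrite -mulmxA jA => xB; rewrite (row_free_inj fB (_ : x *m B = 0 *m B)) ?mul0mx.
  apply/eqmxP; rewrite submx1 /=; apply/row_subP => i; move: (row i 1%:M) => v.
  have /submxP[x xE] : (v *m A <= B)%MS by rewrite BA submxMl.
  rewrite -[v](subrK (x *m j)) addrC; apply: addmx_sub_adds; first exact: submxMl.
  by apply/sub_kermxP; rewrite mulmxBl -mulmxA jA xE subrr.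
move=> v; rewrite W'E; split=> -[v0].
  case=> vA; split=> //.
    (* A point of the vertex still needs some point of the base, taken with coefficient 0. *)
    exists (w0 *m kappa), 0, v; rewrite scale0r add0r; split=> //; last exact/sub_kermxP.
    by rewrite -mulmxA kB; apply: WV.
  have /submxP[x xE] : (v *m A <= B)%MS by rewrite BA submxMl.
  exists x, 1, (v - x *m j); split; first by rewrite -xE.
    by apply/sub_kermxP; rewrite mulmxBl -mulmxA jA xE subrr.
  by rewrite scale1r addrC subrK.
move=> [x [c [z [Xx /sub_kermxP zA vE]]]]; split=> //.
rewrite vE mulmxDl zA addr0 -scalemxAl -mulmxA jA.
by have [->|c0] := eqVneq c 0; [left; rewrite scale0r|right; apply: coW].
Qed.

(** A is the projection from the vertex followed by the inclusion of L, transported by the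
    isomorphism. The scalar by which the latter acts on V is constant by [eigen_scalar] and is
    cancelled by rescaling. *)
Lemma cone_pullback k l m (iota : 'M[C]_(n.+1, (n + k).+1)) W
    (iota' : 'M[C]_(n.+1, (n + m).+1)) W' (L : {vspace 'rV[C]_(n + k).+1})
    (kappa : 'M[C]_(n.+1, (n + l).+1)) X tau Y :
  row_free iota' -> cone W -> sub_extension iota W L kappa X -> cone_extension kappa X tau Y ->
  extension_iso V tau Y iota' W' ->
  exists A, [/\ iota' *m A = iota, forall v, (v \in L) = (v <= A)%MS &
    forall w, W' w -> w *m A = 0 \/ W (w *m A)].
Proof.
move=> fi' coW [B [fB LB iB XE]] [j [Z [fj [jZ0 jZ1] tauE YE]]] [g [ug tg YW gV]].
have dxZ : (<<j>> :&: Z = 0)%MS.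
  by apply/eqP; rewrite -submx0 -jZ0 sub_capmx capmxSr (submx_trans (capmxSl _ _)) // genmxE.
have [P jP zP] : exists2 P, j *m P = 1%:M & forall z : 'rV_(n + m).+1, (z <= Z)%MS -> z *m P = 0.
  exists (proj_mx <<j>>%MS Z *m pinvmx j) => [|z zZ].
    by rewrite [LHS]mulmxA proj_mx_id ?genmxE // mulmxVp.
  by rewrite [LHS]mulmxA proj_mx_0 // mul0mx.
pose AY := P *m B; have jAY : j *m AY = B by rewrite mulmxA jP mul1mx.
have zAY (z : 'rV_(n + m).+1) : (z <= Z)%MS -> z *m AY = 0.
  by move=> /zP zP0; rewrite mulmxA zP0 mul0mx.
have [M ME] : exists M, tau *m g = M *m iota'.
  by apply/submxP; rewrite tg.
have wM w : V w -> exists2 c, c != 0 & w *m M = c *: w.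
  move=> /gV[c c0 e]; exists c => //; apply: (row_free_inj fi').
  by rewrite -mulmxA -ME mulmxA e scalemxAl.
have [c cE] : exists c, M = c%:M by apply: eigen_scalar => w /wM[c _ ?]; exists c.
have c0 : c != 0.
  have [[w Vw] _] := vV.2; have [d d0] := wM w Vw; rewrite cE mul_mx_scalar.
  apply: contra_eq_neq => ->; rewrite scale0r eq_sym scaler_eq0 negb_or d0.
  exact: pclosed_neq0 Vw.
have tgE : tau *m g = c *: iota' by rewrite ME cE mul_scalar_mx.
have AYB : (AY :=: B)%MS.
  by apply/eqmxP; rewrite submxMl /= -{1}jAY submxMl.
exists (c *: (invmx g *m AY)); split.
- rewrite -scalemxAr scalemxAl -tgE -mulmxA mulKVmx //.
  by rewrite tauE -mulmxA jAY -iB.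
- move=> v; rewrite LB; have ge : (c *: (invmx g *m AY) :=: B)%MS.
    apply: eqmx_trans (eqmx_scale _ c0) _; apply: eqmx_trans AYB.
    by apply: eqmxMfull; rewrite row_full_unit unitmx_inv.
  by rewrite ge.
move=> w Ww; have /YE[w0 [x [b [z [Xx zZ wE]]]]] : Y (w *m invmx g).
  by apply/YW; rewrite mulmxKV.
rewrite -scalemxAr mulmxA wE mulmxDl (zAY _ zZ) addr0 -scalemxAl -mulmxA jAY scalerA.
have [->|b0] := eqVneq b 0; first by left; rewrite mulr0 scale0r.
by right; apply: coW; [rewrite mulf_neq0|apply/XE].
Qed.

(** F o A and F' are two equations of W' with the same restriction to H, so their derivatives agree
    on V. *)
Lemma pullback_direction k m (iota : 'M[C]_(n.+1, (n + k).+1)) W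
    (iota' : 'M[C]_(n.+1, (n + m).+1)) W' A :
  extension V iota W -> extension V iota' W' -> iota' *m A = iota ->
  (forall w, W' w -> w *m A = 0 \/ W (w *m A)) ->
  forall v, same_direction V iota W iota' W' (v *m A) v.
Proof.
move=> extW extW' iA WA v d F F' hF hF' WF WF' e w Vw.
have vW : variety W by case: extW.
have WAF : vanish W' (lsub A F).
  move=> x /WA; rewrite meval_lsub => -[->|/WF//]; exact: (vanish_homog0 vW hF).
have := pderiv_restr0 vV pnV ndV extW' v (idealB (vanish_ideal W') WAF WF') _ Vw.
rewrite lsubB lsub_lsub iA e subrr pderivB mevalB pderiv_lsub meval_lsub -mulmxA iA.
by move=> /(_ erefl)/eqP; rewrite subr_eq0 => /eqP.
Qed.

(** For uniqueness, two subspaces L give maps A and A' inducing the same first-order directions. By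
    injectivity of KS they differ by a map into H, which lies in both images, so the images
    coincide. *)
Theorem KS_universal k (iota : 'M[C]_(n.+1, (n + k).+1)) W :
  extension V iota W -> KS_bijective V iota W -> universal_extension V iota W.
Proof.
move=> extW [inj surj] m iota' W' extW'; have [fi vW _ _ _] := extW.
have fi' : row_free iota' by case: extW'.
have cW : cone W by apply: pclosed_cone; case: vW.
have [A [iA sd]] := universal_direction extW extW' surj.
have pb := extension_pullback vV pnV ndV no_sections extW extW' iA sd.
pose L : {vspace 'rV[C]_(n + k).+1} := limg (linfun (mulmxr A)).
have LA v : (v \in L) = (v <= A)%MS.
  apply/memv_imgP/submxP => [[u _ ->]|[u ->]]; exists u; rewrite ?memvf ?lfunE //.
have iA' (w : 'rV_n.+1) : (w *m iota <= A)%MS by rewrite -iA mulmxA submxMl.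
exists L; split.
  split; first by move=> w; rewrite LA.
  have [||l [kappa [X [subX coneX]]]] := pullback_cone fi cW _ _ iA LA pb.
  - by case: vV => _ [].
  - by move=> w /(extension_restr extW).
  exists l, kappa, X, iota', W'; split=> //; exists 1%:M; split=> //.
  - exact: unitmx1.
  - by rewrite mulmx1.
  - by move=> x; rewrite mulmx1.
  - by move=> w _; exists 1; rewrite ?oner_eq0 // mulmx1 scale1r.
move=> L' [iL' [l [kappa [X [tau [Y [subX coneX iso]]]]]]].
have [A' [iA1 LA' WA']] := cone_pullback fi' cW subX coneX iso.
have sd' := pullback_direction extW extW' iA1 WA'.
have AA (v : 'rV_(n + m).+1) : (v *m A' - v *m A <= iota)%MS.
  apply: inj => h; split; apply: same_direction_KS => //.
    exact: same_direction_trans extW extW' (sd' v) (sd v).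
  exact: same_direction_trans extW extW' (sd v) (sd' v).
have iotaA B : iota' *m B = iota -> (iota <= B)%MS by move=> <-; rewrite submxMl.
apply/vspaceP => v; rewrite LA LA'; apply/idP/idP => /submxP[u ->].
  rewrite -[u *m A](subrK (u *m A')) addmx_sub ?submxMl // -opprB eqmx_opp.
  exact: submx_trans (AA u) (iotaA _ iA1).
rewrite -[u *m A'](subrK (u *m A)) addmx_sub ?submxMl //.
exact: submx_trans (AA u) (iotaA _ iA).
Qed.
End Universal.

Unset Implicit Arguments.

Theorem theorem1p9 (R : realType) (n : nat) (V : pset R[i] n.+1)
  (V_variety : variety V)
  (V_normal : normal_variety V)
  (V_projectively_normal : projectively_normal V)
  (V_nondegenerate : nondegenerate_pset V)
  (V_no_sections : no_normal_sections V (-2)) :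
  (forall (k : nat) (iota : 'M[R[i]]_(n.+1, (n + k).+1))
          (W W' : pset R[i] (n + k).+1),
     extension V iota W -> extension V iota W' ->
     same_KS V iota W W' ->
     extension_iso V iota W iota W') /\
  (forall (k : nat) (iota : 'M[R[i]]_(n.+1, (n + k).+1))
          (W : pset R[i] (n + k).+1),
     extension V iota W -> KS_bijective V iota W ->
     universal_extension V iota W).
Proof.
split=> [k iota W W' extW extW' sKS|k iota W extW bij].
  exact: same_KS_iso.
exact: KS_universal.
Qed.
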